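(* (Equilibrium states.) Let $(X,T,\Omega,P,\theta)$ be a random countable topological Markov chain with the b.i.p.-property and let $\varphi:X\to\mathbb{R}$ be a potential satisfying (H) and (S). Let $\lambda$, $\{h_\omega\}$, $\{\mu_\omega\}$ be the random variable, random function and random probability measure described in the context, and let $\nu=\{\nu_\omega\}$ be the random probability measure defined by $d\nu_\omega=h_\omega\,d\mu_\omega$. Then $$P_G(\varphi)=h^{(r)}_\nu(T)+\int\varphi_\omega\,d\nu_\omega\,dP,$$ that is, $\{\nu_\omega\}$ is an equilibrium state.
   Context: **Random countable topological Markov chain.** $\theta$ is an ergodic automorphism (invertible, bimeasurable, probability preserving, ergodic) of a probability space $(\Omega,\mathcal{F},P)$; $\{\mathcal{W}^1_\omega\}$ is a measurable family of subsets of $\mathbb{N}$; for a.e. $\omega$, $A_\omega=(\alpha^\omega_{ij}:i\in\mathcal{W}^1_\omega,j\in\mathcal{W}^1_{\theta\omega})$ is a matrix with entries in $\{0,1\}$, measurable in $\omega$, with $\sum_{j\in\mathcal{W}^1_{\theta\omega}}\alpha^\omega_{ij}>0$ and $\sum_{j\in\mathcal{W}^1_{\theta^{-1}\omega}}\alpha^{\theta^{-1}\omega}_{ji}>0$ for all $i\in\mathcal{W}^1_\omega$. Put $X_\omega=\{(x_0,x_1,\dots):\alpha^{\theta^i\omega}_{x_ix_{i+1}}=1\ \forall i\ge0\}$, $T_\omega:X_\omega\to X_{\theta\omega}$ the shift, $X=\{(\omega,x):x\in X_\omega\}$ (measurable structure induced from $\mathbb{N}^{\mathbb{N}}\times\Omega$),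 $T(\omega,x)=(\theta\omega,T_\omega x)$, $T^n_\omega=T_{\theta^{n-1}\omega}\circ\cdots\circ T_\omega$. $\mathcal{W}^n_\omega$ is the set of $\omega$-admissible words $(x_0,\dots,x_{n-1})$, i.e. $x_i\in\mathcal{W}^1_{\theta^i\omega}$ and $\alpha^{\theta^i\omega}_{x_ix_{i+1}}=1$ for consecutive letters; $[a]_\omega=\{x\in X_\omega:x_i=a_i,\ 0\le i<n\}$; $\Omega_a=\{\omega:[a]_\omega\neq\emptyset\}$; $\mathcal{W}^n$ is the set of words $a$ of length $n$ with $P(\Omega_a)>0$. **Random probability measure** $\mu=\{\mu_\omega\}$: a map $(B,\omega)\mapsto\mu_\omega(B)\in[0,1]$ on (Borel sets of $\mathbb{N}^{\mathbb{N}}$)$\times\Omega$ which is measurable in $\omega$ for each $B$ and such that, for a.e. $\omega$, $\mu_\omega$ is a probability measure with support $X_\omega$. **b.i.p.-property.** $(X,T)$ is topologically mixing if for all $a,b\in\mathcal{W}^1$ there is an $\mathbb{N}$-valued random variable $N_{ab}$ such that $[a]_\omega\cap(T^n_\omega)^{-1}[b]_{\theta^n\omega}\neq\emptyset$ whenever $n\ge N_{ab}(\omega)$, $a\in\mathcal{W}^1_\omega$ and $\theta^n\omega\in\Omega_b$. $(X,T)$ has the b.i.p.-property if it is topologically mixing and there are $\Omega_{\rm bi},\Omega_{\rm bp}\subset\Omega$ of positive measure and a finite $\mathcal{I}\subset\mathbb{N}$ such that (1) for $\omega\in\Omega_{\rm bi}$, $a\in\mathcal{W}^1_{\theta^{-1}\omega}$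 there is $b\in\mathcal{I}$ with $ab\in\mathcal{W}^2_{\theta^{-1}\omega}$; (2) for $\omega\in\Omega_{\rm bp}$, $a\in\mathcal{W}^1_\omega$ there is $b\in\mathcal{I}$ with $ba\in\mathcal{W}^2_{\theta^{-1}\omega}$. **Potential and Ruelle operator.** For $f:X\to\mathbb{R}$, $V^\omega_n(f)=\sup\{|f_\omega(x)-f_\omega(y)|:x_i=y_i,\ 0\le i<n\}$. $f$ is locally Hölder continuous with parameter $r\in(0,1)$ and index $k$ if there is a random variable $\kappa\ge0$ with $\int\log\kappa\,dP<\infty$ and $V^\omega_n(f)\le\kappa(\omega)r^n$ for all $n\ge k$ ($\kappa$ is its Hölder constant of index $k$); it is Hölder continuous if in addition $\|f_\omega\|_\infty<\infty$ a.s. For measurable $\varphi:X\to\mathbb{R}$, $\mathcal{L}_\omega(f)(x)=\sum_{y\in X_\omega:T_\omega y=x}e^{\varphi_\omega(y)}f(y)$ ($x\in X_{\theta\omega}$), $\mathcal{L}^n_\omega=\mathcal{L}_{\theta^{n-1}\omega}\circ\cdots\circ\mathcal{L}_\omega$, $\int f\,d\mathcal{L}_\omega^\ast(\mu)=\int\mathcal{L}_\omega(f)\,d\mu$. (H): $\varphi$ is locally Hölder continuous with index $2$, its random variable $\kappa$ satisfies $\int\kappa\,dP<\infty$, and $V^\omega_1(\varphi)<\infty$ for a.e. $\omega\in\theta^{-1}(\Omega_{\rm bi}\cup\Omega_{\rm bp})$. (S): $\int\|\log\mathcal{L}_{\theta^{-1}\omega}(1)\|_\infty\,dP(\omega)<\infty$.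 $B_\omega:=\exp\sum_{k=1}^\infty\kappa(\theta^{-k}\omega)r^k$. **Relative Gurevič pressure.** Fix $a\in\mathcal{W}^1$ and a measurable family $\xi_\omega\in[a]_\omega$ ($\omega\in\Omega_a$); set $\mathcal{Z}^\omega_n(a)=\mathcal{L}^n_\omega(1_{[a]})(\xi_{\theta^n\omega})$ for $\omega\in\Omega_a\cap\theta^{-n}(\Omega_a)$. For $N$ such that $\Omega^\ast=\{\omega\in\Omega_a:N_{aa}(\omega)\le N\}$ has positive measure, $P_G(\varphi)=\lim_{n\to\infty,\ \theta^n\omega\in\Omega^\ast}\frac1n\log\mathcal{Z}^\omega_n(a)$; it is known that this limit exists, is finite, a.s. constant on $\Omega_a$, and independent of $a$ and $N$. **$\lambda$, $\{h_\omega\}$, $\{\mu_\omega\}$.** Under these hypotheses there exist (and we fix) $\lambda:\Omega\to(0,\infty)$ with $\int\log\lambda_\omega\,dP=P_G(\varphi)$, a measurable family of strictly positive functions $h_\omega:X_\omega\to\mathbb{R}$ and a random probability measure $\{\mu_\omega\}$ such that a.s. $\mathcal{L}_\omega h_\omega=\lambda_\omega h_{\theta\omega}$, $\int h_\omega\,d\mu_\omega=1$, $\mathcal{L}^\ast_\omega(\mu_{\theta\omega})=\lambda_\omega\mu_\omega$, and $\{\log h_\omega\}$ is Hölder continuous with parameter $r$ and Hölder constant of index $1$ bounded by $B_\omega-1$; the measure $h_\omega\,d\mu_\omega\,dP$ is $T$-invariant and ergodic. **Fiber entropy and equilibrium states.** $m=\{m_\omega\}$ is a random invariant probability measure if $m_\omega\circ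 T_\omega^{-1}=m_{\theta\omega}$ a.s.; its fiber entropy is $h^{(r)}_m(T)=-\lim_{n\to\infty}\frac1n\sum_{a\in\mathcal{W}^n_\omega}m_\omega([a]_\omega)\log m_\omega([a]_\omega)$ (for a.e. $\omega$). The known variational principle states $P_G(\varphi)=\sup\{h^{(r)}_m(T)+\int\varphi_\omega\,dm_\omega\,dP\}$ over random invariant probability measures $m$; $m$ is an equilibrium state if it attains the supremum.
   Formalization: The equality and the equilibrium property are asserted when fiber entropy plus the integral of the potential is not of the form infinity minus infinity (which can occur, e.g. a Bernoulli measure of infinite entropy); the supremum likewise ranges over measures whose sum is defined. *)

(* Defs.v *)
From HB Require Import structures.
From mathcomp Require Import all_boot all_order all_algebra.
From mathcomp Require Import all_classical all_reals all_analysis.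
From mathcomp Require Import measurable_realfun.

Set Implicit Arguments.
Unset Strict Implicit.
Unset Printing Implicit Defensive.

Import Order.TTheory GRing.Theory Num.Theory.
Import numFieldNormedType.Exports.

Local Open Scope classical_set_scope.
Local Open Scope ring_scope.

(* N^N with the product of the discrete topologies and its Borel
   sigma-algebra. *)
Definition seqspace :=
  g_sigma_algebraType (@open {ptws nat -> nat}).

Definition left_shift (x : seqspace) : seqspace := fun i => x i.+1.

(* theta, its inverse, the alphabets W^1_w and the transition matrices.  Only
   the entries [transition w i j] with i in [alphabet w] and j in
   [alphabet (base w)] matter: every definition below ignores the others. *)
Record rcmc (Omega : Type) := RCMC {
  base : Omega -> Omega;
  base_inv : Omega -> Omega;
  alphabet : Omega -> set nat;
  transition : Omega -> nat -> nat -> bool }.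

Section automorphism.
Context (d : measure_display) (T : measurableType d) (R : realType).
Variable P : probability T R.

Record ergodic_automorphism (f g : T -> T) : Prop := ErgodicAutomorphism {
  ergodic_measurable : measurable_fun setT f;
  ergodic_measurable_inv : measurable_fun setT g;
  ergodic_cancel : cancel f g;
  ergodic_cancel_inv : cancel g f;
  ergodic_preserving : forall A, measurable A -> P (f @^-1` A) = P A;
  ergodic_trivial : forall A, measurable A -> f @^-1` A = A ->
    P A = 0%E \/ P A = 1%E }.

(* The sets Omega_a below need not be measurable, only measurable up to a null
   set, and the value of [P] on a non-measurable set is meaningless.  Positive
   measure is therefore read with respect to the completion of [P]. *)
Definition positive_mass (A : set T) : Prop := ~ P.-negligible A.

End automorphism.

Section random_chain.
Context (d : measure_display) (Omega : measurableType d) (R : realType).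
Variables (P : probability Omega R) (S : rcmc Omega).
Local Notation theta := (base S).
Local Notation thetaV := (base_inv S).
Implicit Types (w : Omega) (x y : seqspace) (a : seq nat).

Record is_rcmc : Prop := IsRcmc {
  rcmc_ergodic : ergodic_automorphism P theta thetaV;
  rcmc_alphabet : forall i, measurable [set w | alphabet S w i];
  rcmc_transition : forall i j, measurable
    [set w | [/\ alphabet S w i, alphabet S (theta w) j & transition S w i j]];
  rcmc_row : {ae P, forall w, forall i, alphabet S w i ->
    (0 < \esum_(j in alphabet S (theta w))
           ((transition S w i j)%:R : R)%:E)%E};
  rcmc_col : {ae P, forall w, forall i, alphabet S w i ->
    (0 < \esum_(j in alphabet S (thetaV w))
           ((transition S (thetaV w) j i)%:R : R)%:E)%E} }.

Definition fiber w : set seqspace := [set x | forall i,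
  alphabet S (iter i theta w) (x i) /\
  transition S (iter i theta w) (x i) (x i.+1)].

Definition total_space : set (Omega * seqspace) := [set p | fiber p.1 p.2].

Definition skew_product (p : Omega * seqspace) : Omega * seqspace :=
  (theta p.1, left_shift p.2).

Definition words (n : nat) w : set (seq nat) := [set a |
  [/\ size a = n,
      forall i, (i < n)%N -> alphabet S (iter i theta w) (nth 0%N a i) &
      forall i, (i.+1 < n)%N ->
        transition S (iter i theta w) (nth 0%N a i) (nth 0%N a i.+1)]].

Definition cylinder w a : set seqspace :=
  [set x | fiber w x /\ forall i, (i < size a)%N -> x i = nth 0%N a i].

Definition word_base a : set Omega := [set w | cylinder w a !=set0].

(* W^1 *)
Definition letter (i : nat) : Prop := positive_mass P (word_base [:: i]).

Definition mixing_times (N : nat -> nat -> Omega -> nat) : Prop :=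
  forall i j, letter i -> letter j ->
    measurable_fun setT (N i j) /\
    {ae P, forall w, forall n, (N i j w <= n)%N -> alphabet S w i ->
      word_base [:: j] (iter n theta w) ->
      cylinder w [:: i] `&`
        (iter n left_shift @^-1` cylinder (iter n theta w) [:: j]) !=set0}.

Record is_bip (N : nat -> nat -> Omega -> nat) (Obi Obp : set Omega)
    (I : set nat) : Prop := IsBip {
  bip_mixing : mixing_times N;
  bip_bi_measurable : measurable Obi;
  bip_bi_positive : (0 < P Obi)%E;
  bip_bp_measurable : measurable Obp;
  bip_bp_positive : (0 < P Obp)%E;
  bip_finite : finite_set I;
  bip_images : forall w, Obi w -> forall i, alphabet S (thetaV w) i ->
    exists2 j, I j & words 2 (thetaV w) [:: i; j];
  bip_preimages : forall w, Obp w -> forall i, alphabet S w i ->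
    exists2 j, I j & words 2 (thetaV w) [:: j; i] }.

(* Real functions on [total_space] are curried functions on Omega * N^N whose
   values outside [total_space] are irrelevant. *)
Implicit Types (f phi h : Omega -> seqspace -> R).

Definition measurable_on_total f : Prop :=
  measurable_fun total_space (fun p : Omega * seqspace => f p.1 p.2).

Definition variation f (n : nat) w : \bar R :=
  ereal_sup [set e | exists x y, [/\ fiber w x, fiber w y,
    forall i, (i < n)%N -> x i = y i & e = `|f w x - f w y|%:E]].

Definition sup_norm w (g : seqspace -> \bar R) : \bar R :=
  ereal_sup [set `|g x|%E | x in fiber w].

(* The integral of log kappa is an integral in [-oo, +oo]: the condition is on
   the positive part, [lne] being -oo at 0. *)
Definition locally_holder (r : R) (k : nat) (kappa : Omega -> R) f : Prop :=
  [/\ measurable_fun setT kappa,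
      forall w, 0 <= kappa w,
      (\int[P]_w ((fun v => lne (kappa v)%:E)^\+ w) < +oo)%E &
      {ae P, forall w, forall n, (k <= n)%N ->
        (variation f n w <= (kappa w * r ^+ n)%:E)%E}].

Definition holder (r : R) (k : nat) (kappa : Omega -> R) f : Prop :=
  locally_holder r k kappa f /\
  {ae P, forall w, (sup_norm w (EFin \o f w) < +oo)%E}.

(* Ruelle's operator on functions with values in [0, +oo] ([\esum] is the sum
   of a nonnegative family); all its uses below are of this kind. *)
Definition ruelle phi w (g : seqspace -> \bar R) : seqspace -> \bar R :=
  fun x => (\esum_(y in [set y | fiber w y /\ left_shift y = x])
              ((expR (phi w y))%:E * g y))%E.

Fixpoint ruelle_iter phi (n : nat) w (g : seqspace -> \bar R) :
    seqspace -> \bar R :=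
  if n is m.+1 then ruelle phi (iter m theta w) (ruelle_iter phi m w g)
  else g.

Definition condition_H (Obi Obp : set Omega) (r : R) (kappa : Omega -> R)
    phi : Prop :=
  [/\ locally_holder r 2 kappa phi,
      P.-integrable setT (EFin \o kappa) &
      {ae P, forall w, (Obi `|` Obp) (theta w) ->
        (variation phi 1 w < +oo)%E}].

Definition condition_S phi : Prop :=
  P.-integrable setT (fun w =>
    sup_norm w (fun x => lne (ruelle phi (thetaV w) (cst 1%E) x))).

Definition distortion (r : R) (kappa : Omega -> R) w : \bar R :=
  expeR (\sum_(1 <= k <oo) (kappa (iter k thetaV w) * r ^+ k)%:E)%E.

Definition partition_function phi (i : nat) (xi : Omega -> seqspace)
    (n : nat) w : \bar R :=
  ruelle_iter phi n w
    (fun x => (\1_(cylinder w [:: i]) x)%:E) (xi (iter n theta w)).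

Definition return_base (N : nat -> nat -> Omega -> nat) (i N0 : nat) :
    set Omega := [set w | word_base [:: i] w /\ (N i i w <= N0)%N].

Record is_gurevic_pressure (N : nat -> nat -> Omega -> nat) phi (i : nat)
    (xi : Omega -> seqspace) (N0 : nat) (pG : R) : Prop := IsGurevicPressure {
  gurevic_letter : letter i;
  gurevic_measurable : measurable_fun setT xi;
  gurevic_cylinder : forall w, word_base [:: i] w -> cylinder w [:: i] (xi w);
  gurevic_return : positive_mass P (return_base N i N0);
  gurevic_limit : {ae P, forall w, word_base [:: i] w ->
    (fun n => ((n%:R : R)^-1%:E * lne (partition_function phi i xi n w))%E)
      @ within [set n | return_base N i N0 (iter n theta w)] \oo
      --> pG%:E} }.

Definition msupport (m : set seqspace -> \bar R) : set seqspace :=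
  [set x | forall U : set {ptws nat -> nat}, open U -> U x -> (0 < m U)%E].

(* The kernel structure provides measurability in w and values in [0, 1]. *)
Definition random_probability (m : R.-spker Omega ~> seqspace) : Prop :=
  {ae P, forall w, m w setT = 1%E /\ msupport (m w) = fiber w}.

Definition random_invariant (m : R.-spker Omega ~> seqspace) : Prop :=
  random_probability m /\
  {ae P, forall w, forall B, measurable B ->
    m w (fiber w `&` left_shift @^-1` B) = m (theta w) B}.

(* The measure dm_w dP on Omega * N^N. *)
Definition joint (m : R.-spker Omega ~> seqspace)
    (C : set (Omega * seqspace)) : \bar R :=
  (\int[P]_w m w (xsection C w))%E.

Record is_rpf phi (r : R) (kappa : Omega -> R) (pG : R)
    (lambda : Omega -> R) h (mu nu : R.-spker Omega ~> seqspace) : Prop :=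
  IsRpf {
  rpf_lambda_measurable : measurable_fun setT lambda;
  rpf_lambda_gt0 : forall w, 0 < lambda w;
  rpf_lambda_pressure : (\int[P]_w (ln (lambda w))%:E)%E = pG%:E;
  rpf_h_measurable : measurable_on_total h;
  rpf_h_gt0 : forall w x, fiber w x -> 0 < h w x;
  rpf_mu : random_probability mu;
  rpf_eigenfunction : {ae P, forall w, forall x, fiber (theta w) x ->
    ruelle phi w (EFin \o h w) x = (lambda w * h (theta w) x)%:E};
  rpf_normalized : {ae P, forall w,
    (\int[mu w]_(x in fiber w) (h w x)%:E)%E = 1%E};
  rpf_conformal : {ae P, forall w, forall g : seqspace -> \bar R,
    measurable_fun setT g -> (forall x, 0 <= g x)%E ->
    (\int[mu (theta w)]_(x in fiber (theta w)) ruelle phi w g x =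
     (lambda w)%:E * \int[mu w]_(x in fiber w) g x)%E};
  rpf_holder : exists2 kh : Omega -> R,
    holder r 1 kh (fun w x => ln (h w x)) &
    {ae P, forall w, ((kh w)%:E <= distortion r kappa w - 1)%E};
  rpf_density : {ae P, forall w, forall B, measurable B ->
    nu w B = (\int[mu w]_(x in B `&` fiber w) (h w x)%:E)%E};
  rpf_invariant : forall C : set (Omega * seqspace), measurable C ->
    joint nu (total_space `&` skew_product @^-1` C) = joint nu C;
  rpf_ergodic : forall C : set (Omega * seqspace), measurable C ->
    C `<=` total_space -> total_space `&` skew_product @^-1` C = C ->
    joint nu C = 0%E \/ joint nu C = 1%E }.

Definition fiber_integral phi (m : R.-spker Omega ~> seqspace) : \bar R :=
  (\int[P]_w \int[m w]_(x in fiber w) (phi w x)%:E)%E.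

(* The minus sign of the entropy is moved inside the sum, whose terms are then
   nonnegative; the sum may be +oo. *)
Definition word_entropy (m : R.-spker Omega ~> seqspace) (n : nat) w : \bar R :=
  (\esum_(a in words n w)
     (- (fine (m w (cylinder w a)) * ln (fine (m w (cylinder w a)))))%:E)%E.

Definition is_fiber_entropy (m : R.-spker Omega ~> seqspace) (e : \bar R) :
    Prop :=
  {ae P, forall w,
    (fun n => ((n%:R : R)^-1%:E * word_entropy m n w)%E) @ \oo --> e}.

(* The values h_m + int phi dm dP, where +oo + -oo is excluded. *)
Definition free_energies phi : set (\bar R) :=
  [set v | exists (m : R.-spker Omega ~> seqspace) (e : \bar R),
    [/\ random_invariant m, is_fiber_entropy m e,
        (e +? fiber_integral phi m)%E & v = (e + fiber_integral phi m)%E]].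

Definition equilibrium_state phi (m : R.-spker Omega ~> seqspace) : Prop :=
  random_invariant m /\
  exists e : \bar R,
    [/\ is_fiber_entropy m e, (e +? fiber_integral phi m)%E &
        (e + fiber_integral phi m)%E = ereal_sup (free_energies phi)].

End random_chain.

(* Main.v *)
(** Along the skew product, [nu] has conditional information
    [I = ln lambda + ln h (theta w) (left_shift x) - ln h w x - phi w x], which is
    nonnegative by the eigenfunction equation, so the entropies [H n w] of the words
    of length [n] satisfy [H n.+1 w >= int I dnu_w + H n (theta w)]; with Birkhoff's
    theorem this bounds the entropy from below by [e = int I dnu].

    From above: by the big image property there is a set [good M] of positive
    probability on which [mu_v [a c] <= M * mu_v [a] * mu_w [c]] whenever
    [w = theta^n v] and [a] has length [n].  Combined with the bounded distortion of
    [phi], this gives at the times [n] with [theta^n w] in [good M] the Gibbs bound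
    [exp (S_n phi - sum ln lambda) <= C * mu_w [x_0 ... x_(n-1)]], and then, by the
    inequality between entropy and cross entropy, an upper bound of [H n w] by the
    Birkhoff sums of [ln lambda - phi] for every random invariant measure.  These
    times have positive density, so that the monotone sequence [H n w] is controlled
    at all times.  The upper bound also yields the variational inequality; for [nu]
    it equals [e], because [I] is cohomologous to [ln lambda - phi].

    Since [phi] is only bounded above by an integrable function of [w], all integrals
    of [phi] are computed through its defect below this bound, which is nonnegative
    but may have infinite integral. *)
Require Import Defs.
From HB Require Import structures.
From mathcomp Require Import all_boot all_order all_algebra.
From mathcomp Require Import all_classical all_reals all_analysis.
From mathcomp Require Import measurable_realfun.
From mathcomp Require Import ring lra.

Set Implicit Arguments.
Unset Strict Implicit.
Unset Printing Implicit Defensive.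

Import Order.TTheory GRing.Theory Num.Theory.
Import numFieldNormedType.Exports.

Local Open Scope classical_set_scope.
Local Open Scope ring_scope.

(** Conformality determines the mass of a word only through its last letter: the integral of
    [exp (- S_n)] over [[x_0 ... x_n]] is the [mu]-mass of [[x_n]] on the fiber at time [n]. The
    alphabet may be infinite, so this mass has no uniform lower bound and distortion alone does not
    give a Gibbs inequality. The good set is designed so that the mass of [[x_n]] appears on both
    sides, where it cancels; big images make this possible, since every word can be followed by one
    of finitely many letters, whose masses are bounded below.

    The second obstacle is that the fiber mean of [ln h] is finite on almost every fiber, but is not
    known to be integrable over the base. The coboundary is therefore not removed by integration:
    its mean is bounded on the good set, and Birkhoff averages are compared only at returns to that
    set.

    Both entropy estimates come from integrating [1 + t <= exp t], arranged so that all integrands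
    are nonnegative; thus no entropy has to be finite. *)

Lemma exists_natr_gt (R : realType) (x : R) : exists n : nat, x < n%:R.
Proof. by exists (Num.truncn x).+1; exact: truncnS_gt. Qed.

Lemma integral_cst_unit_mass d (T : measurableType d) (R : realType)
    (m : {measure set T -> \bar R}) (D : set T) (c : \bar R) :
  measurable D -> m D = 1%E -> (\int[m]_(x in D) c = c)%E.
Proof. by move=> mD mD1; rewrite integral_cst// mD1 mule1. Qed.

Lemma average_close (R : realFieldType) (n b m K1 K2 e i : R) : 0 < n ->
  `|K1| + `|K2| <= n * (e / 2) -> n * i <= n * (e / 2) ->
  b <= K1 + n * (m + i) -> - b <= K2 + n * (- m + i) ->
  `|m - n^-1 * b| <= e.
Proof.
move=> n0 K12 ni b1 b2.
have K1n : K1 <= `|K1| by exact: ler_norm.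
have K2n : K2 <= `|K2| by exact: ler_norm.
have K1p : 0 <= `|K1| by [].
have K2p : 0 <= `|K2| by [].
have bE : b = n * (n^-1 * b) by rewrite mulrA divff ?gt_eqF// mul1r.
rewrite -(ler_pM2l n0) -{1}(gtr0_norm n0) -normrM mulrBr -bE.
move: K12 ni b1 b2; rewrite !mulrDr mulrN mulrA.
move: `|K1| `|K2| K1n K2n K1p K2p => a1 a2 K1n K2n K1p K2p.
move: (n * e) (n * m) (n * i) => ne nm ni *.
by rewrite ler_norml; apply/andP; split; lra.
Qed.

(** * Birkhoff's ergodic theorem *)

Section birkhoff.
Context (d : measure_display) (T : measurableType d) (R : realType).
Context (P : probability T R) (f : T -> T).
Context (mf : measurable_fun setT f).
Context (fP : forall A, measurable A -> P (f @^-1` A) = P A).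
Context (ferg : forall A, measurable A -> f @^-1` A = A -> P A = 0%E \/ P A = 1%E).

Lemma ge0_integral_preserving (u : T -> \bar R) :
  measurable_fun setT u -> (forall x, (0 <= u x)%E) ->
  (\int[P]_x u (f x) = \int[P]_x u x)%E.
Proof.
move=> mu u0.
have := @ge0_integral_pushforward _ _ _ _ R f mf P setT u measurableT mu (fun y _ => u0 y).
rewrite preimage_setT => <-.
by apply: eq_measure_integral => A mA _; rewrite /= /pushforward fP.
Qed.

Lemma integrable_preserving (u : T -> \bar R) :
  P.-integrable setT u -> P.-integrable setT (u \o f).
Proof.
move=> /integrableP[mu iu]; apply/integrableP; split.
  exact: measurableT_comp.
have mau : measurable_fun setT (abse \o u) by exact: measurableT_comp.
by have := ge0_integral_preserving mau (fun=> abse_ge0 _) => /= ->.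
Qed.

Lemma integral_preserving (u : T -> \bar R) :
  measurable_fun setT u ->
  (\int[P]_x u (f x) = \int[P]_x u x)%E.
Proof.
move=> mu; rewrite integralE [RHS]integralE.
congr (_ - _)%E.
  have := ge0_integral_preserving (measurable_funepos mu) (funepos_ge0 u).
  by move=> <-; apply: eq_integral => x _; rewrite -[LHS]/((u \o f)^\+%E x) funepos_comp.
have := ge0_integral_preserving (measurable_funeneg mu) (funeneg_ge0 u).
by move=> <-; apply: eq_integral => x _; rewrite -[LHS]/((u \o f)^\-%E x) funeneg_comp.
Qed.

Lemma measurable_iter n : measurable_fun setT (iter n f).
Proof.
elim: n => [|n ih]; first exact: measurable_id.
exact: (measurableT_comp mf ih).
Qed.

Lemma preserving_iter n A : measurable A -> P (iter n f @^-1` A) = P A.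
Proof.
move=> mA; elim: n => // n ih; rewrite -{}ih.
rewrite -[in RHS]fP//; last by rewrite -[X in measurable X]setTI; exact: measurable_iter.
by congr (P _); apply/seteqP; split=> x /=; rewrite -iterSr.
Qed.

Lemma ae_iter (Q : T -> Prop) : {ae P, forall w, Q w} ->
  {ae P, forall w, forall k, Q (iter k f w)}.
Proof.
move=> [A [mA A0 QA]]; apply/ae_foralln => k.
exists (iter k f @^-1` A); split.
- by rewrite -[X in measurable X]setTI; exact: measurable_iter.
- by rewrite -A0; exact: preserving_iter.
- by move=> w nQ; apply: QA.
Qed.


Definition bsum (u : T -> R) n w : R := \sum_(k < n) u (iter k f w).

Lemma bsumS (u : T -> R) n w : bsum u n.+1 w = u w + bsum u n (f w).
Proof.
rewrite /bsum big_ord_recl; congr (_ + _).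
by apply: eq_bigr => j _; rewrite -iterSr.
Qed.

(** The maximum of the ergodic sums of lengths 0 to [n]. The recursion peels off the first term, so
    that [bmax u n.+1 - bmax u n \o f] simplifies to the maximum of [- bmax u n \o f] and [u]. *)
Fixpoint bmax (u : T -> R) n w : R :=
  if n is m.+1 then Num.max 0 (u w + bmax u m (f w)) else 0.

Lemma bmax_ge0 u n w : 0 <= bmax u n w.
Proof. by case: n => //= n; rewrite le_max lexx. Qed.

Lemma bmax_nd u n w : bmax u n w <= bmax u n.+1 w.
Proof.
elim: n w => [|n ih] w; first exact: bmax_ge0.
rewrite [bmax u n.+1 w]/= [leRHS]/=.
by rewrite ge_max !le_max lexx /= lerD2l ih orbT.
Qed.

Lemma bsum_le_bmax u n w : bsum u n w <= bmax u n w.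
Proof.
elim: n w => [|n ih] w; first by rewrite /bsum big_ord0.
by rewrite bsumS/= le_max lerD2l ih orbT.
Qed.

Lemma measurable_bmax u n : measurable_fun setT u ->
  measurable_fun setT (bmax u n).
Proof.
move=> mu; elim: n => [|n ih] //=.
apply: measurable_maxr => //; apply: measurable_funD => //.
exact: measurableT_comp ih mf.
Qed.

Lemma integrable_bmax u n : P.-integrable setT (EFin \o u) ->
  P.-integrable setT (EFin \o bmax u n).
Proof.
move=> iu; have mu : measurable_fun setT u.
  by apply/measurable_EFinP; exact: measurable_int iu.
elim: n => [|n ih]; first exact: integrable0.
apply: (@le_integrable _ _ _ _ _ measurableT _
   (fun x => (`|(u x)%:E| + (bmax u n (f x))%:E)%E)) => //.
- by apply/measurable_EFinP; exact: measurable_bmax.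
- move=> x _ /=; rewrite lee_fin ger0_norm ?le_max ?lexx//.
  rewrite ger0_norm; last by rewrite addr_ge0// bmax_ge0.
  rewrite ge_max addr_ge0 ?bmax_ge0//=.
  by rewrite lerD2r ler_norm.
- apply: integrableD => //; first exact: integrable_abse.
  exact: integrable_preserving ih.
Qed.

(* The set where the running maxima of the ergodic sums are unbounded is
   strictly invariant; were it of full measure, [bmax u n.+1 - bmax u n \o f]
   would converge to [u], and these functions have nonnegative integral. *)
Lemma bsum_bounded u : P.-integrable setT (EFin \o u) ->
  (\int[P]_x (u x)%:E < 0)%E ->
  {ae P, forall w, exists K : R, forall n, bsum u n w <= K}.
Proof.
move=> iu u0; have mu : measurable_fun setT u.
  by apply/measurable_EFinP; exact: measurable_int iu.
pose A := [set w | forall k : nat, exists n, k%:R <= bmax u n w].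
have mA : measurable A.
  rewrite (_ : A = \bigcap_k \bigcup_n [set w | k%:R <= bmax u n w]).
    apply: bigcapT_measurable => k; apply: bigcupT_measurable => n.
    rewrite -[X in measurable X]setTI.
    by apply: measurable_fun_le => //; exact: measurable_bmax.
  apply/seteqP; split => w /=.
    by move=> Aw k _; have [n kn] := Aw k; exists n.
  by move=> Aw k; have [n _ kn] := Aw k Logic.I; exists n.
have invA : f @^-1` A = A.
  apply/seteqP; split => w /= Aw k.
    have [m km] := exists_natr_gt (k%:R - u w); have [n mn] := Aw m; exists n.+1.
    by rewrite /= le_max; apply/orP; right; lra.
  have [m km] := exists_natr_gt (Num.max 0 (k%:R + u w)); have [[|n] mn] := Aw m.
    by move: km; rewrite ltNge le_max (le_trans mn).
  exists n; move: mn; rewrite /= le_max => /orP[mn|mn].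
    by move: km; rewrite ltNge le_max mn.
  by move: km; rewrite gt_max => /andP[_]; lra.
have [A0|A1] := ferg mA invA.
  exists A; split => // w /=; apply: contra_notP => nA.
  have [k kA] : exists k : nat, forall n, bmax u n w < k%:R.
    apply: contrapT => h; apply: nA => k; apply: contrapT => h'; apply: h.
    by exists k => n; rewrite ltNge; apply/negP => kn; apply: h'; exists n.
  exists k%:R => n; rewrite (le_trans (bsum_le_bmax u n w))//.
  exact/ltW/kA.
exfalso; move: u0; rewrite ltNge => /negP; apply.
pose D n w := bmax u n.+1 w - bmax u n (f w).
have DE n w : D n w = Num.max (- bmax u n (f w)) (u w).
  by rewrite /D/= addr_maxl sub0r addrK.
have mD n : measurable_fun setT (D n).
  apply: measurable_funB; first exact: measurable_bmax.
  exact: measurableT_comp (measurable_bmax n mu) mf.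
have intD n : (0 <= \int[P]_x (D n x)%:E)%E.
  rewrite (_ : (\int[P]_x _)%E = (\int[P]_x ((bmax u n.+1 x)%:E - (bmax u n (f x))%:E))%E)//.
  rewrite integralB_EFin//; [|exact: integrable_bmax|]; last first.
    exact: integrable_preserving (integrable_bmax n iu).
  rewrite (integral_preserving (u := EFin \o bmax u n)); last first.
    by apply/measurable_EFinP; exact: measurable_bmax.
  rewrite sube_ge0; last first.
    by rewrite integrable_fin_num// integrable_bmax.
  apply: le_integral => //; [exact: integrable_bmax..|].
  by move=> x _; rewrite lee_fin bmax_nd.
have aeA : {ae P, forall w, A w}.
  exists (~` A); split => //; first exact: measurableC.
  by rewrite probability_setC// A1 subee.
(* On [A] some running maximum at [f x] exceeds [- u x], and by monotonicity so do all later ones;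
   from then on the maximum in [DE] is exactly [u x]. *)
have cvgD : {ae P, forall x, setT x -> (D n x)%:E @[n --> \oo] --> (u x)%:E}.
  apply: filterS aeA => x; rewrite -invA => /= Ax _.
  have [k kx] := exists_natr_gt (- u x); have [n0 n0x] := Ax k.
  apply: cvg_near_cst; exists n0 => // n /= n0n.
  rewrite DE; congr EFin; apply/max_idPr.
  rewrite lerNl (le_trans (ltW kx))// (le_trans n0x)//.
  exact: (homo_leq lexx le_trans (fun n => bmax_nd u n (f x))).
have domD : {ae P, forall x (n : nat), setT x -> (`|(D n x)%:E| <= `|(u x)%:E|)%E}.
  apply: aeW => x n _; rewrite lee_fin DE.
  have := bmax_ge0 u n (f x); move: (bmax u n _) (u x) => b v b0.
  rewrite ler_norml; apply/andP; split.
    by rewrite le_max; apply/orP; right; rewrite lerNl -normrN ler_norm.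
  by rewrite ge_max ler_norm andbT (le_trans _ (normr_ge0 v))// oppr_le0.
have mDE n : measurable_fun setT (EFin \o D n) by exact/measurable_EFinP.
have [_ _ cvgI] := dominated_convergence measurableT mDE (measurable_int _ iu)
  cvgD (integrable_abse iu) domD.
rewrite -(cvg_lim _ cvgI)//; apply: lime_ge; first by apply/cvg_ex; eexists; exact: cvgI.
exact: nearW.
Qed.

Lemma bsum_shift_bounded u (c : R) : P.-integrable setT (EFin \o u) ->
  (\int[P]_x (u x)%:E < c%:E)%E ->
  {ae P, forall w, exists K : R, forall n, bsum u n w <= K + n%:R * c}.
Proof.
move=> iu uc; pose v x := u x - c.
have ic : P.-integrable setT (EFin \o cst c).
  by apply: finite_measure_integrable_cst.
have iv : P.-integrable setT (EFin \o v).
  exact: (integrableB measurableT iu ic).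
have v0 : (\int[P]_x (v x)%:E < 0)%E.
  under eq_integral do rewrite EFinB.
  have Ic : (\int[P]_x (cst c x)%:E = c%:E)%E.
    apply: (integral_cst_unit_mass c%:E measurableT).
    exact: probability_setT.
  by rewrite (integralB_EFin measurableT iu ic) Ic sube_lt0 ?orbT.
apply: filterS (bsum_bounded iv v0) => w [K wK]; exists K => n.
have := wK n; rewrite /bsum /v sumrB big_const_ord iter_addr_0.
by rewrite mulr_natl; lra.
Qed.

(** The one-sided bound is applied to [u] and [- u] at the levels [1/(j+1)] above their means, so
    that there are countably many exceptional sets; elsewhere the additive constants [K1] and [K2]
    vanish after division by [n]. *)
Lemma birkhoff u : P.-integrable setT (EFin \o u) ->
  {ae P, forall w, n%:R^-1 * bsum u n w @[n --> \oo] -->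
    fine (\int[P]_x (u x)%:E)}.
Proof.
move=> iu; have ifin := integrable_fin_num measurableT iu.
set m := fine _.
have mE : (\int[P]_x (u x)%:E)%E = m%:E by rewrite fineK.
have iNu : P.-integrable setT (EFin \o (fun x => - u x)).
  exact: (integrableN iu).
have up (j : nat) : {ae P, forall w, exists K : R,
    forall n, bsum u n w <= K + n%:R * (m + j.+1%:R^-1)}.
  by apply: bsum_shift_bounded => //; rewrite mE lte_fin ltrDl invr_gt0.
have lo (j : nat) : {ae P, forall w, exists K : R,
    forall n, bsum (fun x => - u x) n w <= K + n%:R * (- m + j.+1%:R^-1)}.
  apply: bsum_shift_bounded => //.
  under eq_integral do rewrite EFinN.
  rewrite integralN; last exact: integrable_add_def.
  by rewrite mE lte_fin ltrDl invr_gt0.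
apply: filterS2 (ae_foralln up) (ae_foralln lo) => w wup wlo.
apply/cvgrPdist_le => e e0.
have [j je] : exists j : nat, j.+1%:R^-1 <= e / 2.
  have [j je] := exists_natr_gt (e / 2)^-1; exists j.
  rewrite invf_ple ?posrE ?divr_gt0// ?ltr0n//.
  by rewrite (le_trans (ltW je))// ler_nat.
have [K1 h1] := wup j; have [K2 h2] := wlo j.
have [q Kq] := exists_natr_gt ((`|K1| + `|K2|) / (e / 2)).
exists q.+1 => // n /= qn.
have n0 : 0 < n%:R :> R by rewrite ltr0n (leq_trans _ qn).
have KKn : `|K1| + `|K2| <= n%:R * (e / 2).
  rewrite -ler_pdivrMr ?divr_gt0//; apply: (le_trans (ltW Kq)).
  by rewrite ler_nat ltnW.
have jn : n%:R * j.+1%:R^-1 <= n%:R * (e / 2) by rewrite ler_pM2l.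
apply: (average_close n0 KKn jn (h1 n)).
suff -> : - bsum u n w = bsum (fun x => - u x) n w by exact: h2.
by rewrite /bsum sumrN.
Qed.

(** An infinite integral is reached by truncation: the averages of [min u j] bound those of [u] from
    below, and their limits tend to infinity with [j] by monotone convergence. *)
Lemma ebirkhoff (u : T -> \bar R) : measurable_fun setT u ->
  (forall x, 0 <= u x)%E ->
  {ae P, forall w, ((n%:R : R)^-1%:E * \sum_(k < n) u (iter k f w))%E
    @[n --> \oo] --> (\int[P]_x u x)%E}.
Proof.
move=> mu u0; have [ufin|uinf] := boolP (\int[P]_x u x < +oo)%E.
  have iu : P.-integrable setT u.
    apply/integrableP; split => //.
    by under eq_integral do rewrite gee0_abs//.
  have fu := ae_iter (integrable_ae measurableT iu).
  have ifu : P.-integrable setT (EFin \o (fine \o u)).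
    apply: (le_integrable measurableT _ _ iu) => //.
      apply/measurable_EFinP; exact: measurableT_comp.
    by move=> x _ /=; case: (u x) => [r||] //=; rewrite leey.
  apply: filterS2 (birkhoff ifu) fu => w cw fw.
  have -> : (\int[P]_x u x = (fine (\int[P]_x ((fine \o u) x)%:E))%:E)%E.
    rewrite fineK ?(integrable_fin_num _ ifu)//; apply: ae_eq_integral => //.
      by apply/measurable_EFinP; exact: measurableT_comp.
    apply: filterS (integrable_ae measurableT iu) => x /= h _.
    by rewrite fineK// h.
  suff -> : (fun n => (n%:R : R)^-1%:E * \sum_(k < n) u (iter k f w))%E
      = EFin \o (fun n => n%:R^-1 * bsum (fine \o u) n w).
    by apply: cvg_EFin; [exact: nearW|exact: cw].
  apply/funext => n /=; rewrite /bsum.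
  rewrite [in LHS](eq_bigr (fun k : 'I_n => (fine (u (iter k f w)))%:E)).
    by rewrite sumEFin -EFinM.
  by move=> k _; rewrite fineK// fw.
have {}uinf : (\int[P]_x u x = +oo)%E by move: uinf; rewrite -leNgt leye_eq => /eqP.
rewrite uinf.
pose v (j : nat) x := mine (u x) j%:R%:E.
have v0 j x : (0 <= v j x)%E by rewrite /v le_min u0 lee_fin ler0n.
have mv j : measurable_fun setT (v j) by apply: measurable_mine.
have vfin j x : v j x \is a fin_num.
  rewrite ge0_fin_numE//; apply: le_lt_trans (ltry j%:R).
  by rewrite /v ge_min lexx orbT.
have iv j : P.-integrable setT (EFin \o (fine \o v j)).
  rewrite (_ : _ \o _ = v j); last by apply/funext => x /=; rewrite fineK.
  have ic : P.-integrable setT (EFin \o cst j%:R).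
    exact: finite_measure_integrable_cst.
  apply: (le_integrable measurableT _ _ ic) => // x _ /=.
  by rewrite gee0_abs// ger0_norm ?ler0n// /v ge_min lexx orbT.
have cv : (\int[P]_x v j x)%E @[j --> \oo] --> (+oo)%E.
  have -> : (+oo = \int[P]_x limn (v ^~ x))%E.
    rewrite -uinf; apply: eq_integral => x _; apply/esym/cvg_lim => //.
    case ux : (u x) (u0 x) => [r| |]// _.
      have [q rq] := exists_natr_gt r.
      apply: cvg_near_cst; exists q => // j /= qj.
      rewrite /v ux; apply/min_idPl; rewrite lee_fin (le_trans (ltW rq))//.
      by rewrite ler_nat.
    apply/cvgeyPge => A; have [q Aq] := exists_natr_gt A.
    exists q => // j /= qj; rewrite /v ux le_min leey lee_fin (le_trans (ltW Aq))//.
    by rewrite ler_nat.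
  apply: cvg_monotone_convergence => //.
  move=> x _ j k jk; rewrite /v le_min ge_min lexx/= ge_min lee_fin ler_nat jk.
  by rewrite orbT.
apply: filterS (ae_foralln (fun j => birkhoff (iv j))) => w cw.
apply/cvgeyPge => A.
move/cvgeyPge : cv => /(_ (A + 1)) [j _ /(_ j (leqnn j))] jA.
have {}jA : A < fine (\int[P]_x ((fine \o v j) x)%:E).
  rewrite -lte_fin fineK ?(integrable_fin_num _ (iv j))//.
  under eq_integral do rewrite /= fineK//.
  by apply: lt_le_trans jA; rewrite lte_fin ltrDl.
have {}cw : \forall n \near \oo, A <= n%:R^-1 * bsum (fine \o v j) n w.
  exact: (cvgr_ge _ (cw j) _ jA).
apply: filterS cw => n An.
apply: (@le_trans _ _ (n%:R^-1 * bsum (fine \o v j) n w)%:E); first by rewrite lee_fin.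
rewrite EFinM; apply: lee_wpmul2l; first by rewrite lee_fin invr_ge0.
rewrite /bsum -sumEFin; apply: lee_sum => k _ /=.
by rewrite fineK// /v ge_min lexx.
Qed.

End birkhoff.

(** * Sequence space and fibers *)

Section sequence_space.
Implicit Types (x y : seqspace) (a : seq nat).

Definition has_prefix a : set seqspace :=
  [set x | forall i, (i < size a)%N -> x i = nth 0%N a i].

Definition initial_word n x : seq nat := mkseq x n.

Lemma size_initial_word n x : size (initial_word n x) = n.
Proof. exact: size_mkseq. Qed.

Lemma has_prefixP a x : has_prefix a x <-> initial_word (size a) x = a.
Proof.
split => [ax|<- i].
  apply: (@eq_from_nth _ 0%N); rewrite size_mkseq// => i ia.
  by rewrite nth_mkseq// ax.
by rewrite size_initial_word => ix; rewrite nth_mkseq.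
Qed.

Lemma initial_wordS n x : initial_word n.+1 x = x 0%N :: initial_word n (left_shift x).
Proof. by rewrite /initial_word /mkseq/= -[1%N]addn0 iotaDl -map_comp. Qed.

(** The filter generated by the prefix cylinders at [x] converges to [x] coordinatewise, hence in
    the product topology, so it is finer than the neighbourhood filter. *)
Lemma nbhs_initial_word x (U : set {ptws nat -> nat}) :
  nbhs (x : {ptws nat -> nat}) U -> exists n, has_prefix (initial_word n x) `<=` U.
Proof.
move=> xU; pose F : set_system {ptws nat -> nat} :=
  filter_from setT (fun n => has_prefix (initial_word n x)).
have FF : Filter F.
  apply: filter_from_filter; first by exists 0%N.
  move=> m n _ _; exists (maxn m n) => // y; rewrite /has_prefix/= !size_mkseq => xy.
  split=> i ilt.
    have ltm : (i < maxn m n)%N by rewrite leq_max ilt.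
    by rewrite xy// !nth_mkseq.
  have ltn : (i < maxn m n)%N by rewrite leq_max ilt orbT.
  by rewrite xy// !nth_mkseq.
have cF : {ptws, F --> x}.
  apply/pointwise_cvgP => i V; rewrite nbhs_principalE => /principal_filterP Vx.
  exists i.+1 => // y /= /(_ i); rewrite size_initial_word => /(_ (ltnSn i)).
  by rewrite nth_mkseq// => ->.
by have [n _ xnU] := cF _ xU; exists n.
Qed.

Lemma open_has_prefix a : open (has_prefix a : set {ptws nat -> nat}).
Proof.
have o1 i k : open [set x : {ptws nat -> nat} | x i = k].
  rewrite (_ : [set x | _] = (fun x : {ptws nat -> nat} => x i) @^-1` [set k])//.
  apply: open_comp; last exact: discrete_open.
  by move=> x _; exact: (@proj_continuous nat (fun=> nat) i).
suff on n : open [set x : {ptws nat -> nat} |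
    forall i, (i < n)%N -> x i = nth 0%N a i] by exact: on.
elim: n => [|n ih].
  by rewrite (_ : [set x | _] = setT); [exact: openT|apply/seteqP; split].
rewrite (_ : [set x | _] = [set x : {ptws nat -> nat} |
    forall i, (i < n)%N -> x i = nth 0%N a i] `&` [set x | x n = nth 0%N a n]).
  exact: openI.
apply/seteqP; split => x /=.
  by move=> h; split => [i /ltnW ilt|]; apply: h.
by move=> [h hn] i; rewrite ltnS leq_eqVlt => /orP[/eqP ->//|/h].
Qed.

Lemma measurable_open (U : set {ptws nat -> nat}) : open U ->
  measurable (U : set seqspace).
Proof. by move=> oU; exact: sub_sigma_algebra. Qed.

Lemma measurable_has_prefix a : measurable (has_prefix a).
Proof. exact: (measurable_open (@open_has_prefix a)). Qed.

(** There are countably many words, so a function of the first [n] letters is measurable whatever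
    [F] is. *)
Lemma measurable_fun_initial_word d (T : sigmaRingType d) n (F : seq nat -> T)
    (D : set seqspace) : measurable D ->
  measurable_fun D (fun x => F (initial_word n x)).
Proof.
move=> mD _ B mB; apply: measurableI => //.
rewrite (_ : _ @^-1` B = \bigcup_(a in [set a | size a = n /\ B (F a)]) has_prefix a).
  rewrite bigcup_mkcond; apply: countable_bigcupT_measurable => [|a].
    exact: countableP.
  by case: ifP => _; [exact: measurable_has_prefix|exact: measurable0].
apply/seteqP; split => x /=.
  move=> Bx; exists (initial_word n x) => /=; first by rewrite size_initial_word.
  by apply/has_prefixP; rewrite size_initial_word.
by move=> [a [<- BFa]] /has_prefixP ->.
Qed.

Lemma measurable_left_shift : measurable_fun setT left_shift.
Proof.
apply: (@measurability _ _ (seqspace : measurableType _) (seqspace : measurableType _) setT left_shift (@open {ptws nat -> nat})) => //.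
move=> _ [U oU <-]; rewrite setTI.
apply: measurable_open; rewrite openE => x Ux.
have [n xnU] : exists n, has_prefix (initial_word n (left_shift x)) `<=` U.
  by apply: nbhs_initial_word; move: oU; rewrite openE; exact.
apply: (@filterS _ _ _ (has_prefix (initial_word n.+1 x))).
  move=> y /has_prefixP; rewrite size_initial_word !initial_wordS => -[_ e].
  by apply: xnU; apply/has_prefixP; rewrite size_initial_word e.
apply: open_nbhs_nbhs; split; first exact: open_has_prefix.
by apply/has_prefixP; rewrite size_initial_word.
Qed.

End sequence_space.

(** The family is reindexed over [nat] by [pickle], numbers that encode no index receiving the empty
    set; countable additivity over [nat] then applies. *)
Lemma ge0_integral_countable_bigcup d (T : measurableType d) (R : realType)
    (m : {measure set T -> \bar R}) (I : countType) (D : set I)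
    (F : I -> set T) (f : T -> \bar R) :
  (forall i, measurable (F i)) -> trivIset D F ->
  measurable_fun (\bigcup_(i in D) F i) f ->
  (forall x, (\bigcup_(i in D) F i) x -> 0 <= f x)%E ->
  (\int[m]_(x in \bigcup_(i in D) F i) f x =
   \esum_(i in D) \int[m]_(x in F i) f x)%E.
Proof.
move=> mF tF mf f0.
pose G k := if @pickle_inv I k is Some i then if i \in D then F i else set0 else set0.
have GE i : G (pickle i) = if i \in D then F i else set0.
  by rewrite /G pickleK_inv.
have GN k : ~ range (@pickle I) k -> G k = set0.
  rewrite /G; case ik : pickle_inv => [i|//] nk; exfalso; apply: nk.
  by exists i => //; have := @pickle_invK I k; rewrite ik.
have UG : \bigcup_(i in D) F i = \bigcup_k G k.
  apply/seteqP; split => x.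
    by move=> [i Di Fix]; exists (pickle i) => //; rewrite GE mem_set.
  move=> [k _]; rewrite /G; case: pickle_inv => // i; case: ifPn => // /set_mem Di Fx.
  by exists i.
have mG k : measurable (G k).
  by rewrite /G; case: pickle_inv => // i; case: ifP.
have tG : trivIset setT G.
  apply/trivIsetP => k l _ _; apply: contra_neqP => /eqP/set0P[x [Gk Gl]].
  have [[i _ ik]|nk] := pselect (range (@pickle I) k); last by rewrite (GN _ nk) in Gk.
  have [[j _ jl]|nl] := pselect (range (@pickle I) l); last by rewrite (GN _ nl) in Gl.
  move: Gk Gl; rewrite -ik -jl !GE; case: ifPn => // /set_mem Di Fi.
  case: ifPn => // /set_mem Dj Fj; congr pickle.
  by apply: (tF i j Di Dj); exists x.
rewrite UG ge0_integral_bigcup -?UG//.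
rewrite nneseries_esumT; last first.
  by move=> k; apply: integral_ge0 => x Gx; apply: f0; rewrite UG; exists k.
rewrite (esum_mkcond D).
transitivity (\esum_(k in range (@pickle I)) \int[m]_(x in G k) f x)%E.
  rewrite [RHS]esum_mkcond; apply: eq_esum => k _.
  case: ifPn => // /negP nk; rewrite GN ?integral_set0//.
  by move=> h; apply: nk; exact: mem_set.
rewrite (esum_image setT (@pickle I)); last first.
  by move=> i j _ _; exact: (pcan_inj pickleK).
apply: eq_esum => i _; rewrite GE; case: ifP => // _.
by rewrite integral_set0.
Qed.

Lemma countable_bigcup_measure0 d (T : measurableType d) (R : realType)
    (m : {measure set T -> \bar R}) (I : countType) (D : set I)
    (F : I -> set T) :
  (forall i, D i -> m.-negligible (F i)) -> m.-negligible (\bigcup_(i in D) F i).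
Proof.
move=> nF.
pose G k := if @pickle_inv I k is Some i then if i \in D then F i else set0 else set0.
apply: (@negligibleS _ _ _ _ (\bigcup_k G k)).
  by move=> x [i Di Fx]; exists (pickle i) => //; rewrite /G pickleK_inv mem_set.
apply: negligible_bigcup => k; rewrite /G.
case: pickle_inv => [i|]; last exact: negligible_set0.
case: ifPn => [/set_mem /nF//|_]; exact: negligible_set0.
Qed.

(** * Fibers, cylinders and their measurability over the base *)

Section chain.
Context (d : measure_display) (Omega : measurableType d) (R : realType).
Context (P : probability Omega R) (S : rcmc Omega).
Local Notation theta := (base S).
Local Notation thetaV := (base_inv S).
Implicit Types (w : Omega) (x y : seqspace) (a : seq nat).

Lemma fiber_shift w x : fiber S w x -> fiber S (theta w) (left_shift x).
Proof. by move=> wx i; rewrite -iterSr; exact: wx i.+1. Qed.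

Lemma fiber_shift_iter w x n : fiber S w x ->
  fiber S (iter n theta w) (iter n left_shift x).
Proof. by elim: n => // n ih /ih; exact: fiber_shift. Qed.

Definition scons (k : nat) x : seqspace := fun i => if i is j.+1 then x j else k.

Lemma scons_shift x : scons (x 0%N) (left_shift x) = x.
Proof. by apply/funext => -[]. Qed.

Lemma fiber_scons w k x : fiber S (theta w) x -> alphabet S w k ->
  transition S w k (x 0%N) -> fiber S w (scons k x).
Proof. by move=> wx ak t [|i]//=; rewrite -iterS iterSr; exact: wx. Qed.

Lemma cylinderE w a : cylinder S w a = fiber S w `&` has_prefix a.
Proof. by []. Qed.

Lemma words_initial_word w x n : fiber S w x -> words S n w (initial_word n x).
Proof.
move=> wx; split; first exact: size_initial_word.
  by move=> i ilt; rewrite nth_mkseq//; have [] := wx i.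
by move=> i ilt; rewrite !nth_mkseq// 1?ltnW//; have [] := wx i.
Qed.

Lemma fiber_bigcup_words w n : fiber S w = \bigcup_(a in words S n w) cylinder S w a.
Proof.
apply/seteqP; split => x; last by move=> [a _ []].
move=> wx; exists (initial_word n x); first exact: words_initial_word.
by split => //; apply/has_prefixP; rewrite size_initial_word.
Qed.

Lemma trivIset_cylinder w n : trivIset (words S n w) (cylinder S w).
Proof.
move=> a b [sa _ _] [sb _ _] [x [[_ /has_prefixP xa] [_ /has_prefixP xb]]].
by rewrite -xa -xb sa sb.
Qed.

(** The path condition failing at position [i] reads only the letters [i] and [i.+1], so every
    sequence with the same first [i.+2] letters fails as well. *)
Lemma fiber_closed w x : ~ fiber S w x ->
  exists n, has_prefix (initial_word n x) `<=` ~` fiber S w.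
Proof.
move=> /existsNP[i nwi]; exists i.+2 => y /has_prefixP.
rewrite size_initial_word => xy wy; apply: nwi.
have [ay ty] := wy i.
have xyi j : (j < i.+2)%N -> y j = x j.
  by move=> ji; have := congr1 (fun s => nth 0%N s j) xy; rewrite !nth_mkseq.
by rewrite -!xyi.
Qed.

Lemma open_fiberC w : open (~` fiber S w : set {ptws nat -> nat}).
Proof.
rewrite openE => x /= /fiber_closed[n h]; apply: filterS h _.
apply: open_nbhs_nbhs; split; first exact: open_has_prefix.
by apply/has_prefixP; rewrite size_initial_word.
Qed.

Lemma measurable_fiber w : measurable (fiber S w).
Proof. by rewrite -[fiber S w]setCK; apply: measurableC; exact: measurable_open (@open_fiberC w). Qed.

Lemma measurable_fiberC w : measurable (~` fiber S w).
Proof. by apply: measurableC; exact: measurable_fiber. Qed.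

Lemma measurable_cylinder w a : measurable (cylinder S w a).
Proof.
rewrite cylinderE; apply: measurableI; first exact: measurable_fiber.
exact: measurable_has_prefix.
Qed.

Section support.
Context (m : {measure set seqspace -> \bar R}) (w : Omega).
Context (m1 : m setT = 1%E) (ms : msupport m = fiber S w).

(** A point outside the support has a null open neighbourhood, hence a null prefix cylinder, and
    there are only countably many prefix cylinders. *)
Lemma msupport_compl0 : m (~` fiber S w) = 0%E.
Proof.
apply/negligibleP; first exact: measurable_fiberC.
apply: (@negligibleS _ _ _ _ (\bigcup_(a in [set a | m (has_prefix a) = 0%E]) has_prefix a)).
  move=> x; rewrite -ms => /existsNP[U /not_implyP[oU /not_implyP[Ux mU]]].
  have [n nU] := nbhs_initial_word (open_nbhs_nbhs (conj oU Ux)).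
  exists (initial_word n x) => /=; last by apply/has_prefixP; rewrite size_initial_word.
  apply/eqP; rewrite eq_le measure_ge0 andbT leNgt; apply/negP => h; apply: mU.
  apply: (lt_le_trans h); apply: le_measure => //; rewrite inE.
    exact: measurable_has_prefix.
  exact: measurable_open.
apply: countable_bigcup_measure0 => a /= m0.
by apply/negligibleP => //; exact: measurable_has_prefix.
Qed.

Lemma msupport_fiber1 : m (fiber S w) = 1%E.
Proof.
rewrite -m1 -(setUv (fiber S w)) measureU.
- by rewrite [X in (_ + X)%E]msupport_compl0 adde0.
- exact: measurable_fiber.
- exact: measurable_fiberC.
- exact: setICr.
Qed.

Lemma measureI_fiber A : measurable A -> m (fiber S w `&` A) = m A.
Proof.
move=> mA; apply/esym.
rewrite -[in LHS](setIT A) -(setUv (fiber S w)) setIUr measureU.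
- rewrite [X in (_ + X)%E](_ : _ = 0%E) ?adde0 1?setIC//.
  apply/eqP; rewrite eq_le measure_ge0 andbT -msupport_compl0.
  apply: le_measure; rewrite ?inE.
  + by apply: measurableI => //; exact: measurable_fiberC.
  + exact: measurable_fiberC.
  + by move=> x [].
- by apply: measurableI => //; exact: measurable_fiber.
- by apply: measurableI => //; exact: measurable_fiberC.
- by rewrite setIACA setICr setI0.
Qed.

Lemma msupport_cylinder_gt0 x n : fiber S w x ->
  (0 < m (cylinder S w (initial_word n x)))%E.
Proof.
move=> wx; rewrite cylinderE measureI_fiber; last exact: measurable_has_prefix.
rewrite -ms in wx; apply: wx; first exact: open_has_prefix.
by apply/has_prefixP; rewrite size_initial_word.
Qed.

End support.

Lemma integral_words (m : {measure set seqspace -> \bar R}) w n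
    (f : seqspace -> \bar R) :
  measurable_fun (fiber S w) f -> (forall x, fiber S w x -> 0 <= f x)%E ->
  (\int[m]_(x in fiber S w) f x =
   \esum_(a in words S n w) \int[m]_(x in cylinder S w a) f x)%E.
Proof.
rewrite (fiber_bigcup_words w n) => mf f0.
apply: ge0_integral_countable_bigcup => //; first exact: measurable_cylinder.
exact: trivIset_cylinder.
Qed.

Lemma measure_words (m : {measure set seqspace -> \bar R}) w n :
  (m (fiber S w) = \esum_(a in words S n w) m (cylinder S w a))%E.
Proof.
have mF := measurable_fiber w.
rewrite -[LHS]mul1e -(integral_cst m mF) (integral_words m n)//.
apply: eq_esum => a _; rewrite integral_cst ?mul1e//; exact: measurable_cylinder.
Qed.

Context (HS : is_rcmc P S).

Let mtheta : measurable_fun setT theta := ergodic_measurable (rcmc_ergodic HS).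

Lemma measurable_iter_base n : measurable_fun setT (iter n theta).
Proof. exact: measurable_iter. Qed.

(** Each step of a path is tested through the sets of [rcmc_transition], which already contain the
    conditions that both letters belong to their alphabets; what remains is countable operations on
    products. *)
Lemma measurable_total_space : measurable (total_space S).
Proof.
pose A i k l := (iter i theta @^-1` [set w | [/\ alphabet S w k,
  alphabet S (theta w) l & transition S w k l]]) `*` [set x : seqspace | x i = k /\ x i.+1 = l].
have -> : total_space S = \bigcap_i \bigcup_k \bigcup_l A i k l.
  apply/seteqP; split => -[w x] /=.
    move=> wx i _; exists (x i) => //; exists (x i.+1) => //; split => //=.
    by have [? ?] := wx i; have [? ?] := wx i.+1.
  by move=> h i; have [k _ [l _ [[/= ak _ t] [-> ->]]]] := h i Logic.I.
apply: bigcapT_measurable => i; apply: bigcupT_measurable => k.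
apply: bigcupT_measurable => l; apply: measurableX.
  rewrite -[X in measurable X]setTI; apply: measurable_iter_base => //.
  exact: (rcmc_transition HS).
have := @measurable_fun_initial_word _ bool i.+2 (fun s => (nth 0%N s i == k) && (nth 0%N s i.+1 == l)) setT measurableT measurableT [set true].
rewrite setTI (_ : _ @^-1` _ = [set x | x i = k /\ x i.+1 = l]).
  by apply.
have e1 x : nth 0%N (initial_word i.+2 x) i = x i by rewrite nth_mkseq.
have e2 x : nth 0%N (initial_word i.+2 x) i.+1 = x i.+1 by rewrite nth_mkseq.
apply/seteqP; split => x; rewrite /preimage /mkset e1 e2.
  by move=> /andP[/eqP ? /eqP].
by move=> [-> ->]; rewrite !eqxx.
Qed.

Lemma measurable_skew_product : measurable_fun setT (skew_product S).
Proof.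
apply/measurable_fun_pairP; split.
  exact: (measurableT_comp mtheta measurable_fst).
exact: (measurableT_comp measurable_left_shift measurable_snd).
Qed.

Lemma skew_product_total : total_space S `<=` skew_product S @^-1` total_space S.
Proof. by move=> [w x]; exact: fiber_shift. Qed.

Implicit Types (f : Omega -> seqspace -> R).

Lemma measurable_on_fiber f w : measurable_on_total S f ->
  measurable_fun (fiber S w) (f w).
Proof.
move=> mf; have := @measurable_comp _ _ _ _ _ _ (total_space S)
  (fun p : Omega * seqspace => f p.1 p.2) (fiber S w) (fun x => (w, x)).
apply => //; first exact: measurable_total_space.
  by move=> _ [x wx <-].
apply: measurable_funTS; exact: pair1_measurable.
Qed.

Lemma measurable_on_total_shift f : measurable_on_total S f ->
  measurable_on_total S (fun w x => f (theta w) (left_shift x)).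
Proof.
move=> mf; have := @measurable_comp _ _ _ _ _ _ (total_space S)
  (fun p : Omega * seqspace => f p.1 p.2) (total_space S) (skew_product S).
apply => //; first exact: measurable_total_space.
  by move=> _ [p wx <-]; exact: skew_product_total.
apply: measurable_funTS; exact: measurable_skew_product.
Qed.

Lemma measurable_on_total_base (u : Omega -> R) : measurable_fun setT u ->
  measurable_on_total S (fun w _ => u w).
Proof. by move=> mu; apply: measurable_funTS; exact: (measurableT_comp mu measurable_fst). Qed.

(** The domain of integration varies with [w]. Extending the integrand by 0 outside [total_space]
    gives a function measurable on the whole product, to which measurability of kernel integrals
    applies. *)
Lemma measurable_fiber_integral (m : R.-spker Omega ~> seqspace) f :
  measurable_on_total S f -> (forall w x, 0 <= f w x) ->
  measurable_fun setT (fun w => \int[m w]_(x in fiber S w) (f w x)%:E)%E.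
Proof.
move=> mf f0.
pose g (p : Omega * seqspace) : \bar R := ((EFin \o (fun p => f p.1 p.2)) \_ (total_space S)) p.
have mg : measurable_fun setT g.
  apply/(measurable_restrictT _ measurable_total_space).
  exact/measurable_EFinP.
have g0 p : (0 <= g p)%E.
  by rewrite /g patchE; case: ifP => // _; rewrite lee_fin.
have := @measurable_fun_integral_sfinite_kernel _ _ _ _ _ g m g0 mg.
apply: eq_measurable_fun => w _; rewrite [RHS]integral_mkcond.
apply: eq_integral => x _; rewrite /g !patchE.
by congr (if _ then _ else _); apply/idP/idP; rewrite !inE.
Qed.

Lemma measurable_cylinder_kernel (m : R.-spker Omega ~> seqspace) a :
  measurable_fun setT (fun w => m w (cylinder S w a)).
Proof.
pose f w x : R := \1_(has_prefix a) x.
have mf : measurable_on_total S f.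
  apply: measurable_funTS.
  have := @measurableT_comp _ _ _ _ _ _ (\1_(has_prefix a) : seqspace -> R) _ (@snd Omega seqspace).
  by apply => //; apply: measurable_indic; exact: measurable_has_prefix.
have := measurable_fiber_integral m mf.
rewrite (_ : (fun w => _) = (fun w => m w (cylinder S w a))); first by apply => w x; rewrite /f indicE.
apply/funext => w.
have := @integral_indic _ _ _ (m w) _ (measurable_fiber w) _ (@measurable_has_prefix a).
by rewrite setIC.
Qed.

End chain.

(** * Integrals *)

Section measure_extra.
Context d (T : measurableType d) (R : realType).
Implicit Types (m mu nu : {measure set T -> \bar R}) (D : set T).

Import HBNNSimple.

(** The density relation is given on sets inside [D]; it passes to simple functions by linearity and
    to nonnegative functions by monotone convergence. *)
Lemma ge0_integral_density mu nu D (h : T -> R) (f : T -> \bar R) :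
  measurable D -> measurable_fun D h -> (forall x, D x -> 0 <= h x) ->
  (forall B, measurable B -> B `<=` D ->
    nu B = (\int[mu]_(x in B) (h x)%:E)%E) ->
  measurable_fun D f -> (forall x, D x -> 0 <= f x)%E ->
  (\int[nu]_(x in D) f x = \int[mu]_(x in D) (f x * (h x)%:E))%E.
Proof.
move=> mD mh h0 nuE mf f0; pose f_ := nnsfun_approx mD mf.
have cf x : D x -> (f_ n x)%:E @[n --> \oo] --> f x.
  by move=> Dx; exact: cvg_nnsfun_approx.
have mf_ n : measurable_fun D (EFin \o f_ n).
  by apply/measurable_EFinP; exact: measurable_funTS.
have mhE : measurable_fun D (EFin \o h) by exact/measurable_EFinP.
have -> : (\int[nu]_(x in D) f x = limn (fun n => \int[nu]_(x in D) (f_ n x)%:E))%E.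
  rewrite -monotone_convergence//.
  - by apply: eq_integral => x /[!inE] Dx; apply/esym/cvg_lim => //; exact: cf.
  - by move=> n x _; rewrite lee_fin.
  - by move=> x _ a b ab; rewrite lee_fin; exact/lefP/nd_nnsfun_approx.
have -> : (\int[mu]_(x in D) (f x * (h x)%:E) =
    limn (fun n => \int[mu]_(x in D) ((f_ n x)%:E * (h x)%:E)))%E.
  rewrite -monotone_convergence//.
  - apply: eq_integral => x /[!inE] Dx; apply/esym/cvg_lim => //.
    by apply: cvgeZr => //; exact: cf.
  - by move=> n; apply: emeasurable_funM => //; exact: mf_.
  - by move=> n x Dx; rewrite mule_ge0// lee_fin// h0.
  - move=> x Dx a b ab; apply: lee_wpmul2r; rewrite ?lee_fin ?h0//.
    exact/lefP/nd_nnsfun_approx.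
congr (limn _); apply/funext => n.
have mk k : measurable (f_ n @^-1` [set k]) by [].
transitivity (\sum_(k \in range (f_ n))
    k%:E * nu (D `&` f_ n @^-1` [set k]))%E.
  under eq_integral do rewrite fimfunE -fsumEFin//.
  rewrite ge0_integral_fsum//; last 2 first.
  - by move=> k; apply/measurable_EFinP; apply: measurable_funM => //; exact: measurable_funTS.
  - by move=> k x _; rewrite nnfun_muleindic_ge0.
  apply: eq_fsbigr => k _; rewrite integralZl_indic_nnsfun// integral_indic//=.
  by rewrite setIC.
transitivity (\sum_(k \in range (f_ n))
    \int[mu]_(x in D) ((k * \1_(f_ n @^-1` [set k]) x)%:E * (h x)%:E))%E; last first.
  rewrite -ge0_integral_fsum//.
  - apply: eq_integral => x _; rewrite -ge0_mule_fsuml//.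
      by rewrite fsumEFin// -fimfunE.
    by move=> k; rewrite nnfun_muleindic_ge0.
  - move=> k; apply: emeasurable_funM => //.
    by apply/measurable_EFinP; apply: measurable_funM => //; exact: measurable_funTS.
  - by move=> k x Dx; rewrite mule_ge0// ?nnfun_muleindic_ge0// lee_fin h0.
apply: eq_fsbigr => k /[!inE] -[x _ kx].
rewrite nuE; last by move=> ? [].
  have k0 : 0 <= k by rewrite -kx.
  rewrite integral_mkcondr -ge0_integralZl_EFin//.
  - apply: eq_integral => y _; rewrite patchE indicE.
    by case: ifPn => _; rewrite ?mulr1 ?mulr0 ?mule0 ?mul0e.
  - by move=> y Dy; rewrite patchE; case: ifPn => // _; rewrite lee_fin h0.
  - apply/measurable_restrict => //.
    by apply: measurable_funS mhE => // ? [].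
by apply: measurableI.
Qed.

(** The integral of [g] may be infinite. In that case the negative part of [f + g] is dominated by
    that of [f], while its positive part cannot have finite integral, since [g] is at most that
    positive part plus the absolute value of [f]. *)
Lemma integralDr_ge0 mu D (f g : T -> \bar R) : measurable D ->
  mu.-integrable D f -> measurable_fun D g -> (forall x, D x -> 0 <= g x)%E ->
  (\int[mu]_(x in D) (f x + g x) = \int[mu]_(x in D) f x + \int[mu]_(x in D) g x)%E.
Proof.
move=> mD intf mg g0.
have [gfin|] := boolP (\int[mu]_(x in D) g x < +oo)%E.
  rewrite integralD//; apply/integrableP; split => //.
  by under eq_integral => x /[!inE] Dx do rewrite gee0_abs ?g0//.
rewrite -leNgt leye_eq => /eqP ginf.
have ffin := integrable_fin_num mD intf.
have mf := measurable_int _ intf.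
rewrite ginf addey; last by case: (\int[mu]_(x in D) f x)%E ffin.
rewrite integralE.
have negfin : (\int[mu]_(x in D) (fun x => f x + g x)^\- x < +oo)%E.
  apply: le_lt_trans (integral_funeneg_lt_pinfty mD intf).
  apply: ge0_le_integral => //.
  - by apply: measurable_funeneg; exact: emeasurable_funD.
  - exact: measurable_funeneg.
  - move=> x Dx; rewrite !funenegE ge_max !le_max lexx orbT andbT.
    by rewrite leeN2 leeDl// g0.
suff -> : (\int[mu]_(x in D) (fun x => f x + g x)^\+ x = +oo)%E.
  by move: negfin; case: (\int[mu]_(x in D) _)%E.
apply/eqP; rewrite -leye_eq leNgt; apply/negP => posfin.
have : (\int[mu]_(x in D) g x <= \int[mu]_(x in D) (fun x => f x + g x)^\+ x +
    \int[mu]_(x in D) `|f x|)%E.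
  rewrite -ge0_integralD//.
  - apply: ge0_le_integral => //.
    + apply: emeasurable_funD; last by apply: measurableT_comp.
      by apply: measurable_funepos; exact: emeasurable_funD.
    + move=> x Dx; rewrite funeposE; case: (f x) (g x) (g0 x Dx) => [r||] [s||]//= s0.
      * rewrite -EFinD -EFin_max -EFinD lee_fin.
        have : r + s <= Num.max (r + s) 0 by rewrite le_max lexx.
        by have := ler_norm (- r); rewrite normrN; lra.
      * by rewrite [leRHS]addey ?leey// -ltNye lt_max ltNyr orbT.
      * by rewrite [leRHS]addey ?leey// -ltNye lt_max ltNyr orbT.
      * by rewrite [leRHS]addey ?leey// -ltNye lt_max ltNyr orbT.
  - by apply: measurable_funepos; exact: emeasurable_funD.
  - by apply: measurableT_comp.
rewrite ginf leye_eq => /eqP; apply/eqP; rewrite lt_eqF// lte_add_pinfty//.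
by case/integrableP : intf.
Qed.

(** Neither integral is assumed finite and [r] may be negative; a negative [r] is moved to the other
    side, so that only nonnegative functions are added. *)
Lemma le_integral_shift m D (f g : T -> \bar R) (r : R) : measurable D ->
  m D = 1%E -> measurable_fun D f -> measurable_fun D g ->
  (forall x, D x -> 0 <= f x)%E -> (forall x, D x -> 0 <= g x)%E ->
  (forall x, D x -> f x + r%:E <= g x)%E ->
  (\int[m]_(x in D) f x + r%:E <= \int[m]_(x in D) g x)%E.
Proof.
move=> mD mD1 mf mg f0 g0 fg.
have Ir (c : R) : (\int[m]_(x in D) (cst c%:E x) = c%:E)%E.
  by rewrite integral_cst// mD1 mule1.
have [r0|r0] := leP 0 r.
  rewrite -(Ir r) -ge0_integralD//; apply: ge0_le_integral => //.
  - by move=> x Dx; rewrite adde_ge0// f0.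
  - exact: emeasurable_funD.
rewrite -leeBrDr//.
have -> : (- r%:E = \int[m]_(x in D) (cst (- r)%:E x))%E by rewrite Ir.
rewrite -ge0_integralD//; last by move=> x _; rewrite lee_fin oppr_ge0 ltW.
apply: ge0_le_integral => //.
- exact: emeasurable_funD.
- by move=> x Dx; rewrite /= EFinN leeBrDr// fg.
Qed.

Lemma fin_sub_oppD (x y : \bar R) : x \is a fin_num -> (x - y = - (- x + y))%E.
Proof.
case: x => [a| |]// _; case: y => [b| |]//=.
by rewrite -EFinD opprD opprK.
Qed.

Lemma integralBr_ge0 mu D (f g : T -> \bar R) : measurable D ->
  mu.-integrable D f -> measurable_fun D g -> (forall x, D x -> 0 <= g x)%E ->
  (\int[mu]_(x in D) (f x - g x) = \int[mu]_(x in D) f x - \int[mu]_(x in D) g x)%E.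
Proof.
move=> mD intf mg g0.
have intNf : mu.-integrable D (fun x => - f x)%E by exact: integrableN.
have mNf := measurable_int _ intNf; have mf := measurable_int _ intf.
have ffin := integrable_fin_num mD intf.
pose k := (fun x => - f x + g x)%E.
have mk : measurable_fun D k by exact: emeasurable_funD.
have kneg : (\int[mu]_(x in D) k^\- x < +oo)%E.
  apply: le_lt_trans (integral_funeneg_lt_pinfty mD intNf).
  apply: ge0_le_integral => //.
  - exact: measurable_funeneg.
  - exact: measurable_funeneg.
  - move=> x Dx; rewrite !funenegE ge_max !le_max lexx orbT andbT.
    by rewrite leeN2 leeDl// g0.
have kneg0 : (0 <= \int[mu]_(x in D) k^\- x)%E by exact: integral_ge0.
transitivity (\int[mu]_(x in D) (- k x))%E.
  apply: ae_eq_integral => //.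
  - exact: emeasurable_funB.
  - exact: measurableT_comp.
  - apply: filterS (integrable_ae mD intf) => x /= fx Dx; rewrite /k.
    exact: fin_sub_oppD (fx Dx).
rewrite integralN; last first.
  by move: kneg kneg0; case: (\int[mu]_(x in D) k^\- x)%E => // z _ _; rewrite fin_num_adde_defl.
rewrite integralDr_ge0// integralN; last exact: integrable_add_def.
by rewrite -fin_sub_oppD.
Qed.

Lemma integral_shift_eq m D (f g : T -> \bar R) (r : R) : measurable D ->
  m D = 1%E -> measurable_fun D f -> measurable_fun D g ->
  (forall x, D x -> 0 <= f x)%E -> (forall x, D x -> 0 <= g x)%E ->
  (forall x, D x -> f x + r%:E = g x)%E ->
  (\int[m]_(x in D) f x + r%:E = \int[m]_(x in D) g x)%E.
Proof.
move=> mD mD1 mf mg f0 g0 fg; apply/eqP; rewrite eq_le; apply/andP; split.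
  by apply: le_integral_shift => // x /fg ->.
rewrite -leeBlDr// -EFinN; apply: le_integral_shift => // x /fg <-.
by rewrite EFinN addeK.
Qed.

Lemma ge0_integral_image d' (U : measurableType d') mu
    (nu : {measure set U -> \bar R}) (phi : T -> U) (D : set U) (f : U -> \bar R) :
  measurable_fun setT phi ->
  (forall B, measurable B -> mu (phi @^-1` B) = nu B) ->
  measurable D -> measurable_fun D f -> (forall x, D x -> 0 <= f x)%E ->
  (\int[mu]_(x in phi @^-1` D) f (phi x) = \int[nu]_(x in D) f x)%E.
Proof.
move=> mphi munu mD mf f0.
have f0' : {in D, forall y, (0 <= f y)%E} by move=> y /[!inE]; exact: f0.
rewrite -[LHS](ge0_integral_pushforward mphi mu mD mf f0').
by apply: eq_measure_integral => B mB _; exact: munu.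
Qed.

End measure_extra.

(** * Entropy of words *)

Section entropy.
Context (d : measure_display) (Omega : measurableType d) (R : realType).
Context (S : rcmc Omega).
Local Notation theta := (base S).
Implicit Types (w : Omega) (x y : seqspace) (a : seq nat).
Implicit Types (m : R.-spker Omega ~> seqspace).

Definition supported m w : Prop :=
  m w setT = 1%E /\ msupport (m w) = fiber S w.

Definition invariant_at m w : Prop := forall B, measurable B ->
  m w (fiber S w `&` left_shift @^-1` B) = m (theta w) B.

Definition cylinder_prob m w a : R := fine (m w (cylinder S w a)).

Lemma cylinder_probE m w a :
  (cylinder_prob m w a)%:E = m w (cylinder S w a).
Proof.
rewrite fineK// ge0_fin_numE//; apply: le_lt_trans (ltry 1).
apply: le_trans (sprob_kernel_le1 m w).
by apply: le_measure; rewrite ?inE//; exact: measurable_cylinder.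
Qed.

Lemma cylinder_prob_ge0 m w a : 0 <= cylinder_prob m w a.
Proof. exact: fine_ge0. Qed.

Lemma cylinder_prob_le1 m w a : cylinder_prob m w a <= 1.
Proof.
rewrite -lee_fin cylinder_probE; apply: le_trans (sprob_kernel_le1 m w).
by apply: le_measure; rewrite ?inE//; exact: measurable_cylinder.
Qed.

Lemma le_cylinder_prob m w a b : cylinder S w a `<=` cylinder S w b ->
  cylinder_prob m w a <= cylinder_prob m w b.
Proof.
move=> ab; rewrite -lee_fin !cylinder_probE.
by apply: le_measure; rewrite ?inE//; exact: measurable_cylinder.
Qed.

Lemma cylinder_prob_gt0 m w x n : supported m w -> fiber S w x ->
  0 < cylinder_prob m w (initial_word n x).
Proof.
by move=> [m1 ms] wx; rewrite -lte_fin cylinder_probE; exact: msupport_cylinder_gt0.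
Qed.

Lemma initial_word_cylinder w a x : cylinder S w a x -> initial_word (size a) x = a.
Proof. by move=> [_ /has_prefixP]. Qed.

Lemma cylinder_initial_word w n x : fiber S w x -> cylinder S w (initial_word n x) x.
Proof. by move=> wx; split => //; apply/has_prefixP; rewrite size_initial_word. Qed.

Lemma integral_cylinder m w n (F : seq nat -> R) a : words S n w a ->
  (\int[m w]_(x in cylinder S w a) (F (initial_word n x))%:E =
   (F a * cylinder_prob m w a)%:E)%E.
Proof.
move=> [sa _ _]; rewrite EFinM cylinder_probE -integral_cst; last exact: measurable_cylinder.
by apply: eq_integral => x /[!inE] /initial_word_cylinder; rewrite sa => ->.
Qed.

Definition information m n w x : R := - ln (cylinder_prob m w (initial_word n x)).

Lemma information_ge0 m n w x : 0 <= information m n w x.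
Proof. by rewrite oppr_ge0 ln_le0// cylinder_prob_le1. Qed.

Lemma measurable_information m n w :
  measurable_fun (fiber S w) (EFin \o information m n w).
Proof.
apply/measurable_EFinP.
apply: (@measurable_fun_initial_word _ _ n (fun a => - ln (cylinder_prob m w a))).
exact: measurable_fiber.
Qed.

Lemma word_entropyE m n w :
  word_entropy S m n w = (\int[m w]_(x in fiber S w) (information m n w x)%:E)%E.
Proof.
rewrite (integral_words (m w) n); last 2 first.
- exact: measurable_information.
- by move=> x _; rewrite lee_fin information_ge0.
apply: eq_esum => a wa.
rewrite (integral_cylinder m (fun a => - ln (cylinder_prob m w a)) wa).
by rewrite mulNr mulrC.
Qed.

(** A longer cylinder is smaller, so the information increases pointwise. Since the support is the
    whole fiber, the cylinder masses are positive and the convention [ln 0 = 0] never interferes. *)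
Lemma word_entropy_nd m w n : supported m w ->
  (word_entropy S m n w <= word_entropy S m n.+1 w)%E.
Proof.
move=> sm; rewrite !word_entropyE; apply: ge0_le_integral => //.
- exact: measurable_fiber.
- by move=> x _; rewrite lee_fin information_ge0.
- exact: measurable_information.
- exact: measurable_information.
- move=> x wx; rewrite lee_fin lerN2 ler_ln ?posrE ?cylinder_prob_gt0//.
  apply: le_cylinder_prob => y [wy /has_prefixP]; rewrite size_initial_word => e.
  split => // i; rewrite size_initial_word => ilt.
  have := congr1 (fun s => nth 0%N s i) e.
  by rewrite !nth_mkseq// ltnS ltnW.
Qed.

Lemma integral_supported m w A (f : seqspace -> \bar R) : supported m w ->
  measurable A -> fiber S w `<=` A -> measurable_fun A f ->
  (forall x, A x -> 0 <= f x)%E ->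
  (\int[m w]_(x in A) f x = \int[m w]_(x in fiber S w) f x)%E.
Proof.
move=> [m1 ms] mA wA mf f0.
rewrite (@ge0_negligible_integral _ _ _ (m w) A (~` fiber S w))//.
- by congr integral; rewrite setDE setCK; exact/setIidPr.
- exact: measurable_fiberC.
- exact: msupport_compl0.
Qed.

(** The preimage under the shift of the fiber over [theta w] leaves the first letter free and
    contains the fiber over [w]. The difference is null because [m w] is carried by its fiber, so
    the change of variables is made on the preimage. *)
Lemma ge0_integral_shift m w (f : seqspace -> \bar R) :
  supported m w -> invariant_at m w ->
  measurable_fun (fiber S (theta w)) f ->
  (forall x, fiber S (theta w) x -> 0 <= f x)%E ->
  (\int[m w]_(x in fiber S w) f (left_shift x) =
   \int[m (theta w)]_(x in fiber S (theta w)) f x)%E.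
Proof.
move=> sm im mf f0; have mF := measurable_fiber S (theta w).
have mpre A : measurable A -> measurable (left_shift @^-1` A).
  by move=> mA; rewrite -[X in measurable X]setTI; exact: measurable_left_shift.
rewrite -(@integral_supported m w (left_shift @^-1` fiber S (theta w)))//.
- apply: ge0_integral_image => // [|B mB]; first exact: measurable_left_shift.
  rewrite -[RHS](im _ mB).
  by case: sm => m1 ms; have := measureI_fiber ms (mpre _ mB) => ->.
- exact: mpre.
- by move=> x; exact: fiber_shift.
- have := @measurable_comp _ _ _ _ _ _ _ f (left_shift @^-1` fiber S (theta w)) left_shift mF _ mf.
  apply; first by move=> _ [x wx <-].
  by apply: measurable_funTS; exact: measurable_left_shift.
- by move=> x; exact: f0.
Qed.

End entropy.

(** * Ruelle's operator on cylinders and conformal measures *)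

Lemma measurable_scons k : measurable_fun setT (scons k).
Proof.
apply: (@measurability _ _ (seqspace : measurableType _) (seqspace : measurableType _)
  setT (scons k) (@open {ptws nat -> nat})) => //.
move=> _ [U oU <-]; rewrite setTI.
apply: measurable_open; rewrite openE => x Ux.
have [n xnU] : exists n, has_prefix (initial_word n (scons k x)) `<=` U.
  by apply: nbhs_initial_word; move: oU; rewrite openE; exact.
apply: (@filterS _ _ _ (has_prefix (initial_word n x))).
  move=> y; rewrite /has_prefix/= size_initial_word => xy.
  apply: xnU => i; rewrite size_initial_word => ilt; rewrite nth_mkseq//.
  case: i ilt => //= i ilt; rewrite xy ?nth_mkseq//; exact: ltnW.
apply: open_nbhs_nbhs; split; first exact: open_has_prefix.
by apply/has_prefixP; rewrite size_initial_word.
Qed.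

Section transfer.
Context (d : measure_display) (Omega : measurableType d) (R : realType).
Context (S : rcmc Omega).
Local Notation theta := (base S).
Implicit Types (w : Omega) (x y : seqspace) (a : seq nat).
Implicit Types (phi : Omega -> seqspace -> R) (lambda : Omega -> R).
Context (mu : R.-spker Omega ~> seqspace).

Definition conformal_at phi lambda w : Prop :=
  forall g : seqspace -> \bar R, measurable_fun setT g -> (forall x, 0 <= g x)%E ->
    (\int[mu (theta w)]_(x in fiber S (theta w)) ruelle S phi w g x =
     (lambda w)%:E * \int[mu w]_(x in fiber S w) g x)%E.

(* The normalised potential, for which the conformal measures have
   multiplier 1. *)
Definition normalized phi lambda w x : R := phi w x - ln (lambda w).

Fixpoint birkhoff_sum phi n w x : R :=
  if n is k.+1 then phi w x + birkhoff_sum phi k (theta w) (left_shift x) else 0.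

(** The image of the cylinder of [k :: a] under the shift, written as a preimage under [scons k] so
    that it is measurable. *)
Definition extension w k a : set seqspace := scons k @^-1` cylinder S w (k :: a).

Lemma sub_extension w k a : extension w k a `<=` cylinder S (theta w) a.
Proof.
move=> x [wx ax]; split; first exact: (fiber_shift wx).
by move=> i ia; have := ax i.+1; exact.
Qed.

(** The second letter has to be prescribed: the image of a one-letter cylinder contains only the
    paths whose first letter may follow [k]. *)
Lemma extension_word w k l a n : words S n.+2 w [:: k, l & a] ->
  extension w k (l :: a) = cylinder S (theta w) (l :: a).
Proof.
move=> [sa wa ta]; apply/seteqP; split; first exact: sub_extension.
move=> x [wx ax]; split; last by case=> // i; exact: ax.
apply: fiber_scons => //; first exact: (wa 0%N).
by rewrite (ax 0%N)//; exact: (ta 0%N).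
Qed.

Lemma measurable_extension w k a : measurable (extension w k a).
Proof.
rewrite -[X in measurable X]setTI; apply: measurable_scons => //.
exact: measurable_cylinder.
Qed.

(** At most one preimage of [x] lies in the cylinder, namely [scons k x], and there [exp phi]
    cancels against [exp (- phi)]. This turns conformality into a change of variables on
    cylinders. *)
Lemma ruelle_cylinder phi w k a (G : seqspace -> \bar R) x :
  (forall x, fiber S (theta w) x -> 0 <= G x)%E -> fiber S (theta w) x ->
  ruelle S phi w ((fun y => (expR (- phi w y))%:E * G (left_shift y))%E
    \_ (cylinder S w (k :: a))) x =
  (G \_ (extension w k a)) x.
Proof.
move=> G0 wx; rewrite /ruelle.
have cylP y : left_shift y = x -> cylinder S w (k :: a) y -> y = scons k x.
  by move=> <- [_ ya]; rewrite -[LHS]scons_shift (ya 0%N).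
rewrite [RHS]patchE; case: ifPn => [/set_mem xA|/negP xA]; last first.
  apply: esum1 => y [wy yx]; rewrite patchE; case: ifPn => [/set_mem ya|_].
    by exfalso; apply: xA; apply/mem_set; rewrite /extension/= -(cylP y yx ya).
  by rewrite mule0.
have eq1 y : left_shift y = x -> y <> scons k x ->
    ((expR (phi w y))%:E * ((fun y => (expR (- phi w y))%:E * G (left_shift y))
      \_ (cylinder S w (k :: a))) y = 0)%E.
  move=> yx yk; rewrite patchE; case: ifPn => [/set_mem ya|_]; last exact: mule0.
  by exfalso; apply: yk; exact: cylP.
transitivity (\esum_(y in [set scons k x]) ((expR (phi w y))%:E *
  ((fun y => (expR (- phi w y))%:E * G (left_shift y))
      \_ (cylinder S w (k :: a))) y)%E).
  rewrite esum_mkcond [RHS]esum_mkcond; apply: eq_esum => y _.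
  case: ifPn => [/set_mem[wy yx]|/negP ny]; case: ifPn => [/set_mem|/negP nk]//.
    by apply: eq1 => // e; apply: nk; exact: mem_set.
  move=> /= yk; exfalso; apply: ny; apply/mem_set; rewrite yk; split => //.
  by case: xA.
rewrite esum_set1; last first.
  rewrite mule_ge0 ?lee_fin ?expR_ge0// patchE; case: ifPn => // /set_mem [wk _].
  by rewrite mule_ge0 ?lee_fin ?expR_ge0//; exact: G0.
rewrite patchE mem_set//.
by rewrite muleA -EFinM -expRD subrr expR0 mul1e.
Qed.

Lemma measurable_shift_cylinder w a (G : seqspace -> \bar R) :
  measurable_fun (fiber S (theta w)) G ->
  measurable_fun (cylinder S w a) (fun x => G (left_shift x)).
Proof.
move=> mG; have mF := measurable_fiber S (theta w).
have := @measurable_comp _ _ _ _ _ _ _ G (cylinder S w a) left_shift mF _ mG.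
apply; first by move=> _ [x [wx _] <-]; exact: fiber_shift.
by apply: measurable_funTS; exact: measurable_left_shift.
Qed.

Lemma integral_extension phi lambda w k a (G : seqspace -> \bar R) :
  0 < lambda w -> conformal_at phi lambda w ->
  measurable_fun (fiber S w) (phi w) ->
  measurable_fun (fiber S (theta w)) G ->
  (forall x, fiber S (theta w) x -> 0 <= G x)%E ->
  (\int[mu (theta w)]_(x in extension w k a) G x =
   \int[mu w]_(x in cylinder S w (k :: a))
     ((expR (- normalized phi lambda w x))%:E * G (left_shift x)))%E.
Proof.
move=> l0 cw mphi mG G0.
have mC : measurable (cylinder S w (k :: a)) by exact: measurable_cylinder.
have sC : cylinder S w (k :: a) `<=` fiber S w by move=> x [].
pose g0 y := ((expR (- phi w y))%:E * G (left_shift y))%E.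
have g00 y : cylinder S w (k :: a) y -> (0 <= g0 y)%E.
  by move=> [wy _]; rewrite mule_ge0 ?lee_fin ?expR_ge0//; exact/G0/fiber_shift.
have mg0 : measurable_fun (cylinder S w (k :: a)) g0.
  apply: emeasurable_funM; last exact: measurable_shift_cylinder.
  apply/measurable_EFinP; apply: measurableT_comp => //.
  apply: measurableT_comp => //; apply: measurable_funS mphi => //.
  exact: measurable_fiber.
have sE : extension w k a `<=` fiber S (theta w).
  by move=> x /sub_extension[].
have mg : measurable_fun setT (g0 \_ (cylinder S w (k :: a))).
  by apply/(measurable_restrictT _ mC).
have gg0 y : (0 <= (g0 \_ (cylinder S w (k :: a))) y)%E.
  by rewrite patchE; case: ifPn => // /set_mem; exact: g00.
have := cw _ mg gg0.
rewrite (eq_integral (G \_ (extension w k a))); last first.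
  by move=> x /[!inE] wx; exact: ruelle_cylinder.
rewrite -!integral_mkcondr (setIidr sE) (setIidr sC) => ->.
rewrite -ge0_integralZl_EFin//; last exact: ltW.
apply: eq_integral => x _; rewrite /g0 muleA -EFinM; congr (_%:E * _)%E.
by rewrite /normalized opprB expRD lnK.
Qed.

Lemma measurable_birkhoff_sum phi n w :
  (forall w, measurable_fun (fiber S w) (phi w)) ->
  measurable_fun (fiber S w) (birkhoff_sum phi n w).
Proof.
move=> mphi; elim: n w => [|n ih] w //=.
apply: measurable_funD => //; have mF := measurable_fiber S (theta w).
have := @measurable_comp _ _ _ _ _ _ _ (birkhoff_sum phi n (theta w))
  (fiber S w) left_shift mF _ (ih (theta w)).
apply; first by move=> _ [x wx <-]; exact: fiber_shift.
by apply: measurable_funTS; exact: measurable_left_shift.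
Qed.

Lemma words_behead n w k a : words S n.+1 w (k :: a) -> words S n (theta w) a.
Proof.
move=> [[sa] wa ta]; split => // i ilt; rewrite -iterSr.
  exact: (wa i.+1).
exact: (ta i.+1).
Qed.

(** Each step removes the first letter together with one term of the Birkhoff sum. A word of length
    [n.+1] is used for [n] steps, so that a letter always remains and every image is a full
    cylinder. *)
Lemma integral_cylinder_birkhoff phi lambda n w b :
  (forall w, 0 < lambda w) ->
  (forall w, measurable_fun (fiber S w) (phi w)) ->
  (forall k, conformal_at phi lambda (iter k theta w)) ->
  words S n.+1 w b ->
  (\int[mu w]_(x in cylinder S w b)
     (expR (- birkhoff_sum (normalized phi lambda) n w x))%:E =
   mu (iter n theta w) (cylinder S (iter n theta w) [:: nth 0%N b n]))%E.
Proof.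
move=> l0 mphi; elim: n w b => [|n ih] w [|k [|l a]] cw wb; try by case: wb.
  rewrite -[RHS]mul1e -integral_cst; last exact: measurable_cylinder.
  by apply: eq_integral => x _ /=; rewrite oppr0 expR0.
have mPhi w' : measurable_fun (fiber S w') (normalized phi lambda w').
  exact: measurable_funB.
have cw' j : conformal_at phi lambda (iter j theta (theta w)).
  by rewrite -iterSr; exact: (cw j.+1).
rewrite iterSr [nth _ _ _]/= -(ih (theta w) (l :: a) cw' (words_behead wb)).
rewrite -(extension_word wb) (integral_extension _ _ (l0 w) (cw 0%N) (mphi w))//.
- by apply: eq_integral => x _ /=; rewrite -EFinM -expRD opprD.
- apply/measurable_EFinP; apply: measurableT_comp => //.
  by apply: measurableT_comp => //; exact: measurable_birkhoff_sum.
Qed.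

End transfer.

(** * Distortion and the Gibbs bound *)

Section distortion.
Context (d : measure_display) (Omega : measurableType d) (R : realType).
Context (S : rcmc Omega).
Local Notation theta := (base S).
Local Notation thetaV := (base_inv S).
Implicit Types (w : Omega) (x y : seqspace) (a : seq nat).
Implicit Types (phi : Omega -> seqspace -> R) (lambda : Omega -> R).
Context (mu : R.-spker Omega ~> seqspace).
Context (r : R) (kappa : Omega -> R).
Context (r01 : 0 < r < 1) (kappa0 : forall w, 0 <= kappa w).
Context (thetaK : cancel theta thetaV) (thetaVK : cancel thetaV theta).

Let r0 : 0 <= r := ltW (andP r01).1.

Lemma iter_baseK n : cancel (iter n theta) (iter n thetaV).
Proof. by elim: n => // n ih w; rewrite iterSr [iter n.+1 theta w]iterS thetaK ih. Qed.

Lemma iter_baseVK n : cancel (iter n thetaV) (iter n theta).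
Proof. by elim: n => // n ih w; rewrite iterSr [iter n.+1 thetaV w]iterS thetaVK ih. Qed.

Definition holder_at phi w : Prop := forall n x y, (2 <= n)%N ->
  fiber S w x -> fiber S w y -> (forall i, (i < n)%N -> x i = y i) ->
  `|phi w x - phi w y| <= kappa w * r ^+ n.

Definition past_series w : \bar R :=
  (\sum_(1 <= k <oo) (kappa (iter k thetaV w) * r ^+ k)%:E)%E.

Lemma past_series_ge n w :
  ((\sum_(1 <= k < n) kappa (iter k thetaV w) * r ^+ k)%:E <= past_series w)%E.
Proof.
rewrite -sumEFin; apply: nneseries_lim_ge => k _ _.
by rewrite lee_fin mulr_ge0// exprn_ge0.
Qed.

Lemma variation_le phi n w x y (c : R) : (Defs.variation S phi n w <= c%:E)%E ->
  fiber S w x -> fiber S w y -> (forall i, (i < n)%N -> x i = y i) ->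
  `|phi w x - phi w y| <= c.
Proof.
move=> vc wx wy xy; rewrite -lee_fin; apply: le_trans vc.
by apply: ereal_sup_ubound; exists x, y.
Qed.

Lemma birkhoff_sum_recr phi n w x : birkhoff_sum S phi n.+1 w x =
  birkhoff_sum S phi n w x + phi (iter n theta w) (iter n left_shift x).
Proof.
elim: n w x => [|n ih] w x; first by rewrite /= addr0 add0r.
by rewrite [LHS]/= -/(birkhoff_sum S phi n.+1 _ _) ih addrA -!iterSr.
Qed.

(** Agreement on [n.+1] letters leaves at least two common letters at every time before [n], as the
    index 2 in [holder_at] demands; the spare factor [r] is dropped to match the terms of
    [past_series]. *)
Lemma birkhoff_sum_dist phi n w x y :
  (forall k, holder_at phi (iter k theta w)) ->
  fiber S w x -> fiber S w y -> (forall i, (i <= n)%N -> x i = y i) ->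
  `|birkhoff_sum S phi n w x - birkhoff_sum S phi n w y| <=
  \sum_(1 <= k < n.+1) kappa (iter k thetaV (iter n theta w)) * r ^+ k.
Proof.
elim: n w x y => [|n ih] w x y hw wx wy xy; first by rewrite subrr normr0 big_geq.
rewrite big_nat_recr//= opprD addrACA (le_trans (ler_normD _ _))//.
rewrite [leRHS]addrC; apply: lerD.
  rewrite -[thetaV _]iterS -[theta (iter n theta w)]iterS iter_baseK.
  apply: le_trans (hw 0%N n.+2 _ _ _ wx wy xy) _ => //=.
  by apply: ler_wpM2l => //; apply: ler_wiXn2l => //; case/andP: r01 => _ /ltW.
rewrite -[theta (iter n theta w)]iterS iterSr; apply: ih.
- by move=> k; rewrite -iterSr; exact: (hw k.+1).
- exact: fiber_shift.
- exact: fiber_shift.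
- by move=> i ilt; exact: xy.
Qed.

(** A one-sided decoupling of the letter [c], read over [w], from the word [a] read just before it.
    The same [M] serves all lengths of [a] and all letters. *)
Definition quasi_independent (M : R) w : Prop := forall a c, (0 < size a)%N ->
  cylinder_prob S mu (iter (size a) thetaV w) (rcons a c) <=
  M * cylinder_prob S mu (iter (size a) thetaV w) a * cylinder_prob S mu w [:: c].

Lemma iter_left_shift n x j : iter n left_shift x j = x (n + j)%N.
Proof. by elim: n j => //= n ih j; rewrite /left_shift ih addnS. Qed.

Lemma initial_word_rcons n x : initial_word n.+1 x = rcons (initial_word n x) (x n).
Proof. by rewrite /initial_word /mkseq -addn1 iotaD map_cat cats1. Qed.

Lemma normalized_holder phi lambda w : holder_at phi w ->
  holder_at (normalized phi lambda) w.
Proof.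
by move=> hw n x y n2 wx wy xy; rewrite /normalized opprB addrA subrK; exact: hw.
Qed.

Lemma cylinder_agree w a x y : cylinder S w a x -> cylinder S w a y ->
  forall i, (i < size a)%N -> x i = y i.
Proof. by move=> [_ ax] [_ ay] i ia; rewrite ax// ay. Qed.

Lemma integral_cylinder_le w a (f : seqspace -> R) (c : R) :
  measurable_fun (fiber S w) f ->
  (forall x, cylinder S w a x -> 0 <= f x <= c) ->
  (\int[mu w]_(x in cylinder S w a) (f x)%:E <= (c * cylinder_prob S mu w a)%:E)%E.
Proof.
move=> mf fc; have mC : measurable (cylinder S w a) by exact: measurable_cylinder.
rewrite EFinM cylinder_probE -integral_cst//.
apply: ge0_le_integral => //.
- by move=> x /fc /andP[].
- apply/measurable_EFinP; apply: measurable_funS mf => //; first exact: measurable_fiber.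
  by move=> x [].
- by move=> x /fc /andP[].
Qed.

Lemma integral_cylinder_ge w a (f : seqspace -> R) (c : R) : 0 <= c ->
  measurable_fun (fiber S w) f ->
  (forall x, cylinder S w a x -> c <= f x) ->
  ((c * cylinder_prob S mu w a)%:E <= \int[mu w]_(x in cylinder S w a) (f x)%:E)%E.
Proof.
move=> c0 mf fc; have mC : measurable (cylinder S w a) by exact: measurable_cylinder.
rewrite EFinM cylinder_probE -integral_cst//.
apply: ge0_le_integral => //.
- apply/measurable_EFinP; apply: measurable_funS mf => //; first exact: measurable_fiber.
  by move=> x [].
Qed.

Section gibbs.
Context phi lambda (l0 : forall w, 0 < lambda w).
Context (mphi : forall w, measurable_fun (fiber S w) (phi w)).

Local Notation Sn := (birkhoff_sum S (normalized phi lambda)).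

Let mexp n w : measurable_fun (fiber S w) (fun x => expR (- Sn n w x)).
Proof.
apply: measurableT_comp => //; apply: measurableT_comp => //.
by apply: measurable_birkhoff_sum => w'; exact: measurable_funB.
Qed.

(** The conformal identity on [[y_0 ... y_n]] and distortion bound the mass of [[y_n]] by
    [exp (M - S_n)] times that of [[y_0 ... y_n]]. By quasi-independence the latter contains the
    mass of [[y_n]] as a factor, which is positive and cancels. *)
Lemma gibbs_upper (M : R) n w y : (0 < n)%N ->
  (forall k, conformal_at S mu phi lambda (iter k theta w)) ->
  (forall k, holder_at phi (iter k theta w)) ->
  supported S mu (iter n theta w) ->
  quasi_independent M (iter n theta w) ->
  (past_series (iter n theta w) <= M%:E)%E ->
  fiber S w y ->
  expR (Sn n w y) <= expR M * M * cylinder_prob S mu w (initial_word n y).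
Proof.
move=> n0 cw hw sw qM pM wy.
have pyn := fiber_shift_iter n wy.
have c0 : 0 < cylinder_prob S mu (iter n theta w) [:: y n].
  have := cylinder_prob_gt0 1 sw pyn.
  suff -> : initial_word 1 (iter n left_shift y) = [:: y n] by [].
  by rewrite /initial_word /mkseq/= iter_left_shift addn0.
have := integral_cylinder_birkhoff (mu := mu) l0 mphi cw (words_initial_word n.+1 wy).
rewrite nth_mkseq// -cylinder_probE => Ic.
have cond x : cylinder S w (initial_word n.+1 y) x ->
    0 <= expR (- Sn n w x) <= expR (M - Sn n w y).
  move=> xy; rewrite expR_ge0/= ler_expR.
  have wyy := cylinder_initial_word n.+1 wy.
  have agree := cylinder_agree xy wyy; rewrite size_initial_word in agree.
  have := birkhoff_sum_dist (fun k => normalized_holder lambda (hw k)) (proj1 xy) wy agree.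
  have := past_series_ge n.+1 (iter n theta w).
  move=> /le_trans /(_ pM); rewrite lee_fin => h1 h2.
  have := le_trans h2 h1; rewrite ler_norml => /andP[h3 _]; lra.
have le1 := integral_cylinder_le (@mexp n w) cond.
rewrite Ic lee_fin in le1.
have := qM (initial_word n y) (y n); rewrite size_initial_word => /(_ n0).
rewrite iter_baseK -initial_word_rcons => le2.
have le3 := le_trans le1 (ler_wpM2l (expR_ge0 _) le2).
rewrite mulrA -[leLHS]mul1r ler_pM2r// expRD expRN in le3.
move: le3; set E := expR (Sn n w y); have E0 : 0 < E by exact: expR_gt0.
by rewrite mulrAC ler_pdivlMr// mul1r mulrA.
Qed.

Lemma words_rcons n w a l : words S n w a -> (0 < n)%N ->
  alphabet S (iter n theta w) l ->
  transition S (iter n.-1 theta w) (nth 0%N a n.-1) l ->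
  words S n.+1 w (rcons a l).
Proof.
move=> [sa wa ta] n0 al tl; split; first by rewrite size_rcons sa.
  move=> i; rewrite ltnS leq_eqVlt nth_rcons sa => /orP[/eqP->|ilt].
    by rewrite ltnn eqxx.
  by rewrite ilt; exact: wa.
move=> i ilt; rewrite !nth_rcons sa ltnS in ilt *; rewrite ilt.
move: ilt; rewrite leq_eqVlt => /orP[/eqP e|ilt]; last by rewrite ilt; exact: ta.
by move: tl; rewrite -e/= ltnn eqxx.
Qed.

(** Big images give a letter [l] from a finite set that may follow [a]. On the words [a c] and [a l]
    the Birkhoff sums differ by a bounded amount, so comparing their conformal identities bounds [mu
    [a c]] by a multiple of [mu [a] * mu [c] / mu [l]], and [mu [l]] is bounded below over the
    finite set. *)
Lemma quasi_independentP (I : set nat) (w : Omega) (V : R) :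
  finite_set I ->
  (forall n k, conformal_at S mu phi lambda (iter k theta (iter n thetaV w))) ->
  (forall n k, holder_at phi (iter k theta (iter n thetaV w))) ->
  (past_series (thetaV w) < +oo)%E ->
  (Defs.variation S phi 1 (thetaV w) <= V%:E)%E ->
  (forall i, alphabet S (thetaV w) i -> exists2 j, I j & words S 2 (thetaV w) [:: i; j]) ->
  (forall j, alphabet S w j -> 0 < cylinder_prob S mu w [:: j]) ->
  exists M : nat, quasi_independent M%:R w.
Proof.
move=> finI cw hw pw Vw bi posw.
have [K Kw] : exists K : R, (past_series (thetaV w) <= K%:E)%E.
  by case: (past_series (thetaV w)) pw => // [s _|_]; [exists s|exists 0; exact: leNye].
(* [K] bounds the distortion over the first [n.-1] steps; [V] covers the last step, over [thetaV w],
   where only one common letter is left. *)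
pose D := K + V; pose q j := cylinder_prob S mu w [:: j].
have [s Is] := (finite_seqP I).1 finI; rewrite {}Is in bi.
(* The sum dominates the inverse mass of whichever letter [l] is provided; letters of mass 0
   contribute 0. *)
pose B := \sum_(j <- undup s) (q j)^-1.
have Bq j : j \in s -> (q j)^-1 <= B.
  move=> js; rewrite /B (bigD1_seq j)//= ?undup_uniq ?mem_undup//.
  by rewrite lerDl sumr_ge0// => i _; rewrite invr_ge0 cylinder_prob_ge0.
(* Each of the two comparisons, for [a c] and for [a l], costs a factor [exp D]. *)
have [M BM] := exists_natr_gt (B * expR (D + D)).
exists M => a c a0; set n := size a in a0 *; set v := iter n thetaV w.
have vw : iter n theta v = w by exact: iter_baseVK.
have Mp : 0 <= M%:R * cylinder_prob S mu v a * cylinder_prob S mu w [:: c].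
  by rewrite !mulr_ge0 ?cylinder_prob_ge0.
have [[y acy]|nac] := pselect (cylinder S v (rcons a c) !=set0); last first.
  have -> : cylinder_prob S mu v (rcons a c) = 0 => //.
  rewrite /cylinder_prob (_ : cylinder S v (rcons a c) = set0) ?measure0//.
  by apply: contrapT => h; apply: nac; apply/set0P/eqP.
have sub_ac l : cylinder S v (rcons a l) `<=` cylinder S v a.
  move=> x [vx ax]; split => // i ia; rewrite ax ?size_rcons ?ltnS 1?ltnW//.
  by rewrite nth_rcons ia.
have ay := sub_ac _ _ acy; have vy := proj1 ay.
have wa : words S n v a.
  by rewrite -(initial_word_cylinder ay); exact: words_initial_word.
have wac : words S n.+1 v (rcons a c).
  by rewrite -(initial_word_cylinder acy) size_rcons; exact: words_initial_word.
have n1 : n = n.-1.+1 by rewrite prednK.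
have vn1 : iter n.-1 theta v = thetaV w.
  by rewrite -vw {2}n1 iterS thetaK.
have dist x : cylinder S v a x -> `|Sn n v x - Sn n v y| <= D.
  move=> ax; have vx := proj1 ax; have agree := cylinder_agree ax ay.
  rewrite n1 !birkhoff_sum_recr opprD addrACA (le_trans (ler_normD _ _))//.
  apply: lerD.
    have agree' i : (i <= n.-1)%N -> x i = y i.
      by move=> ilt; apply: agree; rewrite -/n n1 ltnS.
    have := birkhoff_sum_dist (fun k => normalized_holder lambda (hw n k)) vx vy agree'.
    rewrite vn1 => /le_trans; apply; rewrite -lee_fin; apply: le_trans Kw.
    exact: past_series_ge.
  rewrite vn1 /normalized opprB addrA subrK.
  apply: (variation_le Vw).
  - by rewrite -vn1; exact: fiber_shift_iter.
  - by rewrite -vn1; exact: fiber_shift_iter.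
  - case=> // _; rewrite !iter_left_shift addn0; apply: agree.
    by rewrite -/n {2}n1.
have [l ls wl] : exists2 l, l \in s & words S 2 (thetaV w) [:: nth 0%N a n.-1; l].
  apply: bi; case: wa => _ + _ => /(_ n.-1).
  by rewrite vn1; apply; rewrite {2}n1.
have [al tl] : alphabet S w l /\ transition S (thetaV w) (nth 0%N a n.-1) l.
  case: wl => _ /(_ 1%N isT)/= + /(_ 0%N isT)/=.
  by rewrite thetaVK.
have wal : words S n.+1 v (rcons a l) by apply: words_rcons; rewrite ?vw ?vn1.
have := integral_cylinder_birkhoff (mu := mu) l0 mphi (cw n) wal.
have := integral_cylinder_birkhoff (mu := mu) l0 mphi (cw n) wac.
rewrite vw !nth_rcons -/n ltnn eqxx -!cylinder_probE => Ic Il'.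
have lo : expR (- D - Sn n v y) * cylinder_prob S mu v (rcons a c) <= q c.
  rewrite -lee_fin -Ic; apply: integral_cylinder_ge => //.
  by move=> x /sub_ac /dist; rewrite ler_expR ler_norml => /andP[h1 h2]; lra.
have up : q l <= expR (D - Sn n v y) * cylinder_prob S mu v a.
  apply: (@le_trans _ _ (expR (D - Sn n v y) * cylinder_prob S mu v (rcons a l))).
    rewrite -lee_fin -Il'; apply: integral_cylinder_le; first exact: mexp.
    move=> x /sub_ac /dist; rewrite expR_ge0 ler_expR ler_norml => /andP[h1 h2]; lra.
  apply: ler_wpM2l; first exact: expR_ge0.
  exact: le_cylinder_prob.
have ql : 0 < q l by exact: posw.
have qc0 : 0 <= q c := cylinder_prob_ge0 _ _ _ _.
set A := cylinder_prob S mu v (rcons a c) in lo *.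
set A' := cylinder_prob S mu v a in up *.
have A'0 : 0 <= A' := cylinder_prob_ge0 _ _ _ _.
have {}lo : A <= expR (D + Sn n v y) * q c.
  rewrite -(ler_pM2l (expR_gt0 (- D - Sn n v y))) mulrA -expRD.
  by rewrite (_ : - D - _ + _ = 0) ?expR0 ?mul1r//; ring.
have {}up : 1 <= expR (D - Sn n v y) * A' * B.
  rewrite -[1](mulfV (lt0r_neq0 ql)); apply: ler_pM => //.
    exact: ltW.
    by rewrite invr_ge0 ltW.
  exact: Bq.
apply: (le_trans lo); rewrite -[leLHS]mulr1.
apply: (le_trans (ler_wpM2l _ up)); first by rewrite mulr_ge0 ?expR_ge0.
have -> : expR (D + Sn n v y) * q c * (expR (D - Sn n v y) * A' * B) =
    B * expR (D + D) * (A' * q c).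
  have -> : expR (D + D) = expR (D + Sn n v y) * expR (D - Sn n v y).
    by rewrite -expRD; congr expR; ring.
  ring.
by rewrite -[leRHS]mulrA; apply: ler_wpM2r; [exact: mulr_ge0|exact: ltW].
Qed.

End gibbs.

End distortion.

Lemma mulr_expR_ln (R : realType) (u z : R) : 0 < z ->
  expR u * z = expR (u + ln z).
Proof. by move=> z0; rewrite expRD lnK. Qed.

(** * The lower bound of the entropy *)

Section equilibrium_measure.
Context (d : measure_display) (Omega : measurableType d) (R : realType).
Context (S : rcmc Omega).
Local Notation theta := (base S).
Implicit Types (w : Omega) (x y : seqspace) (a : seq nat).
Context (phi h : Omega -> seqspace -> R) (lambda : Omega -> R).
Context (mu nu : R.-spker Omega ~> seqspace).
Context (l0 : forall w, 0 < lambda w).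
Context (mphi : forall w, measurable_fun (fiber S w) (phi w)).
Context (mh : forall w, measurable_fun (fiber S w) (h w)).
Context (h0 : forall w x, fiber S w x -> 0 < h w x).

Definition density_at w : Prop := forall B, measurable B ->
  nu w B = (\int[mu w]_(x in B `&` fiber S w) (h w x)%:E)%E.

Definition eigenfunction_at w : Prop := forall x, fiber S (theta w) x ->
  ruelle S phi w (EFin \o h w) x = (lambda w * h (theta w) x)%:E.

(** A zero integral would make the positive function [h] vanish almost everywhere on [U], so that
    [U] would be null for [mu]. *)
Lemma density_gt0 w (U : set seqspace) : supported S mu w -> density_at w ->
  measurable U -> (0 < mu w U)%E -> (0 < nu w U)%E.
Proof.
move=> [m1 ms] dw mU mUp; have mF := measurable_fiber S w.
have mUF : measurable (U `&` fiber S w : set seqspace) by exact: measurableI.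
have mhU : measurable_fun (U `&` fiber S w) (h w).
  by apply: measurable_funS (@mh w) => // y [].
rewrite dw// lt0e integral_ge0 ?andbT; last first.
  by move=> y [_ /h0]; rewrite lee_fin => /ltW.
apply/eqP => I0.
have : (\int[mu w]_(y in U `&` fiber S w) `|(h w y)%:E| = 0)%E.
  rewrite -[RHS]I0; apply: eq_integral => y /[!inE] -[_ /h0 hy].
  by rewrite gee0_abs// lee_fin ltW.
move/ae_eq_integral_abs => /(_ mUF (proj2 (measurable_EFinP _ _) mhU)) [N [mN N0 subN]].
suff : (mu w U <= 0)%E by rewrite leNgt mUp.
rewrite -N0 -(measureI_fiber ms mU); apply: le_measure; rewrite ?inE//.
  by rewrite setIC.
move=> y [wy Uy]; apply: subN => /= /(_ (conj Uy wy)) [hy].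
by have := h0 wy; rewrite hy ltxx.
Qed.

Lemma density_supported w : supported S mu w -> density_at w ->
  (\int[mu w]_(x in fiber S w) (h w x)%:E = 1)%E -> supported S nu w.
Proof.
move=> [m1 ms] dw hw; have mF := measurable_fiber S w; split.
  by rewrite dw// setTI.
apply/seteqP; split => x.
  move=> sx; apply: contrapT => nx.
  have := sx _ (@open_fiberC _ _ S w) nx.
  rewrite dw; last exact: measurable_fiberC.
  by rewrite setICl integral_set0 ltxx.
move=> wx U oU Ux; apply: (density_gt0 (conj m1 ms)) => //; first exact: measurable_open.
by rewrite -ms in wx; exact: wx.
Qed.

(** Conformality is applied to [h] times the indicator of the preimage of [B]: Ruelle's operator
    maps it to the indicator of [B] times [lambda w * h (theta w)], and [lambda w] cancels. *)
Lemma density_invariant w : conformal_at S mu phi lambda w ->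
  eigenfunction_at w -> density_at w -> density_at (theta w) ->
  invariant_at S nu w.
Proof.
move=> cw ew dw dtw B mB.
have mF := measurable_fiber S w; have mF' := measurable_fiber S (theta w).
pose D := fiber S w `&` left_shift @^-1` B.
have mD : measurable D.
  apply: measurableI => //; rewrite -[X in measurable X]setTI.
  exact: measurable_left_shift.
have DF : D `<=` fiber S w by move=> x [].
pose g := (EFin \o h w) \_ D.
have mg : measurable_fun setT g.
  apply/(measurable_restrictT _ mD); apply/measurable_EFinP.
  exact: measurable_funS (@mh w).
have g0 x : (0 <= g x)%E.
  by rewrite /g patchE; case: ifPn => // /set_mem[/h0 hx _]; rewrite lee_fin ltW.
have := cw g mg g0; rewrite -integral_mkcondr (setIidr DF).
rewrite dw// (setIidl DF) dtw// => e.
have {}e : ((lambda w)%:E * \int[mu (theta w)]_(x in B `&` fiber S (theta w)) (h (theta w) x)%:E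
    = (lambda w)%:E * \int[mu w]_(x in D) (h w x)%:E)%E.
  rewrite -[RHS]e -ge0_integralZl_EFin//; last first.
  - exact: ltW.
  - apply/measurable_EFinP; apply: measurable_funS (@mh (theta w)) => //.
  - by move=> x [_ /h0 hx]; rewrite lee_fin ltW.
  - exact: measurableI.
  rewrite setIC integral_mkcondr; apply: eq_integral => x /[!inE] wx.
  rewrite patchE; case: ifPn => [/set_mem Bx|/negP nB].
    rewrite -EFinM -(ew _ wx); apply: eq_esum => y [wy yx].
    by rewrite /g patchE mem_set//; split => //=; rewrite yx.
  apply/esym/esum1 => y [wy yx]; rewrite /g patchE.
  case: ifPn => [/set_mem[_ /=]|_]; last by rewrite mule0.
  by rewrite yx => Bx; exfalso; apply: nB; exact: mem_set.
have := congr1 (fun z => ((lambda w)^-1%:E * z)%E) e.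
by rewrite !muleA -EFinM mulVf ?gt_eqF// !mul1e.
Qed.

(** The maximum with 0 makes the function nonnegative on the whole product; where the eigenfunction
    equation holds it changes nothing on the fiber. *)
Definition cond_information w x : R := Num.max 0
  (ln (lambda w) + ln (h (theta w) (left_shift x)) - ln (h w x) - phi w x).

(** The point [x] contributes one term [exp phi * h] to a sum of nonnegative terms whose value is
    [lambda w * h (theta w)], so this term is at most that value. *)
Lemma cond_informationE w x : eigenfunction_at w -> fiber S w x ->
  cond_information w x =
  ln (lambda w) + ln (h (theta w) (left_shift x)) - ln (h w x) - phi w x.
Proof.
move=> ew wx; apply/max_idPr.
have wsx := fiber_shift wx.
have : ((expR (phi w x) * h w x)%:E <= (lambda w * h (theta w) (left_shift x))%:E)%E.
  rewrite -(ew _ wsx) EFinM /ruelle; apply: esum_ge.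
  exists [set x]; last by rewrite fsbig_set1.
  by split; [exact: finite_set1|move=> _ ->].
rewrite lee_fin -ler_ln ?posrE ?mulr_gt0 ?expR_gt0 ?h0//.
by rewrite !lnM ?posrE ?expR_gt0 ?h0// expRK; lra.
Qed.

Lemma cond_information_ge0 w x : 0 <= cond_information w x.
Proof. by rewrite le_max lexx. Qed.

Let mhs w : measurable_fun (fiber S w) (fun x => h (theta w) (left_shift x)).
Proof.
have mF := measurable_fiber S (theta w).
have := @measurable_comp _ _ _ _ _ _ _ (h (theta w)) (fiber S w) left_shift mF _ (@mh (theta w)).
apply; first by move=> _ [x wx <-]; exact: fiber_shift.
by apply: measurable_funTS; exact: measurable_left_shift.
Qed.

Lemma measurable_cond_information w :
  measurable_fun (fiber S w) (cond_information w).
Proof.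
apply: measurable_maxr => //; apply: measurable_funB => //.
apply: measurable_funB; last exact: measurableT_comp.
by apply: measurable_funD => //; exact: measurableT_comp (@measurable_ln R) (@mhs w).
Qed.

Let mexpI w : measurable_fun (fiber S w) (fun x => (expR (cond_information w x))%:E).
Proof.
apply/measurable_EFinP; apply: measurableT_comp => //.
exact: measurable_cond_information.
Qed.

(* [expR \o cond_information] is the Jacobian of the shift with respect to
   [nu], so that its integral over a cylinder is the measure of the image. *)
Lemma integral_jacobian_le w k a : conformal_at S mu phi lambda w ->
  eigenfunction_at w -> density_at w -> density_at (theta w) ->
  (\int[nu w]_(x in cylinder S w (k :: a)) (expR (cond_information w x))%:E <=
   nu (theta w) (cylinder S (theta w) a))%E.
Proof.
move=> cw ew dw dtw.
have mC : measurable (cylinder S w (k :: a)) by exact: measurable_cylinder.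
have mC' : measurable (cylinder S (theta w) a) by exact: measurable_cylinder.
have mF := measurable_fiber S w.
have sC : cylinder S w (k :: a) `<=` fiber S w by move=> x [].
rewrite (@ge0_integral_density _ _ _ (mu w) (nu w) _ (h w))//; last 4 first.
- exact: measurable_funS (@mh w).
- by move=> x [/h0 /ltW].
- by move=> B mB BC; rewrite dw// (setIidl (subset_trans BC sC)).
- exact: measurable_funS (@mexpI w).
have -> : (\int[mu w]_(x in cylinder S w (k :: a))
    ((expR (cond_information w x))%:E * (h w x)%:E) =
    \int[mu w]_(x in cylinder S w (k :: a)) ((expR (- normalized phi lambda w x))%:E *
      (h (theta w) (left_shift x))%:E))%E.
  apply: eq_integral => x /[!inE] -[wx _]; rewrite -!EFinM; congr EFin.
  rewrite cond_informationE// /normalized.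
  have hx := h0 wx; have hsx := h0 (fiber_shift wx).
  by rewrite !mulr_expR_ln//; congr expR; ring.
rewrite -(integral_extension (mu := mu) k a (G := EFin \o h (theta w)) (l0 w) cw (@mphi w)); last 2 first.
- exact/measurable_EFinP.
- by move=> x /h0 hx; rewrite lee_fin ltW.
have sE := @sub_extension _ _ S w k a.
rewrite dtw// (setIidl (_ : cylinder S (theta w) a `<=` fiber S (theta w))); last by move=> x [].
(* Only an inclusion is available: for empty [a] the image of the cylinder may be smaller than the
   fiber. *)
apply: ge0_subset_integral => //.
- exact: measurable_extension.
- apply/measurable_EFinP; apply: measurable_funS (@mh (theta w)) => //.
    exact: measurable_fiber.
  by move=> x [].
- by move=> x [/h0 /ltW]; rewrite lee_fin.
Qed.

(** The conditional mass of the first letter given the next [n] letters, multiplied by [exp I], has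
    integral at most 1; applying [1 + t <= exp t] to its logarithm and integrating gives the claim.
    This is the nonnegativity of a relative entropy, in a form that tolerates infinite entropies. *)
Lemma word_entropy_step w n : supported S nu w -> supported S nu (theta w) ->
  invariant_at S nu w -> conformal_at S mu phi lambda w ->
  eigenfunction_at w -> density_at w -> density_at (theta w) ->
  (word_entropy S nu n (theta w) +
     \int[nu w]_(x in fiber S w) (cond_information w x)%:E <=
   word_entropy S nu n.+1 w)%E.
Proof.
move=> sw stw iw cw ew dw dtw.
have mF := measurable_fiber S w.
pose Q x := cylinder_prob S nu w (initial_word n.+1 x) /
  cylinder_prob S nu (theta w) (initial_word n (left_shift x)) *
  expR (cond_information w x).
pose F2 x := information S nu n (theta w) (left_shift x).
have mQ : measurable_fun (fiber S w) (EFin \o Q).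
  apply/measurable_EFinP; apply: measurable_funM; last first.
    by apply/measurable_EFinP; exact: mexpI.
  have := @measurable_fun_initial_word _ _ n.+1 (fun s => cylinder_prob S nu w s /
    cylinder_prob S nu (theta w) (behead s)) _ mF.
  by apply: eq_measurable_fun => x _; rewrite initial_wordS.
have Q0 x : 0 <= Q x.
  by rewrite mulr_ge0 ?expR_ge0// divr_ge0// cylinder_prob_ge0.
have mI := @measurable_information _ _ _ S nu n.+1 w.
have mI2 : measurable_fun (fiber S w) (EFin \o F2).
  have := @measurable_fun_initial_word _ _ n.+1
    (fun s => (- ln (cylinder_prob S nu (theta w) (behead s)))%:E) _ mF.
  by apply: eq_measurable_fun => x _; rewrite initial_wordS.
have mc : measurable_fun (fiber S w) (EFin \o cond_information w).
  by apply/measurable_EFinP; exact: measurable_cond_information.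
have IQ : (\int[nu w]_(x in fiber S w) (Q x)%:E <= 1)%E.
  case: (sw) => sw1 sw2; rewrite -(msupport_fiber1 sw1 sw2).
  rewrite (integral_words (nu w) n.+1 mQ); last by move=> x _; rewrite lee_fin.
  rewrite (measure_words S (nu w) w n.+1); apply: le_esum => -[|k a] wa; first by case: wa.
  pose q := cylinder_prob S nu w (k :: a) / cylinder_prob S nu (theta w) a.
  have q0 : 0 <= q by rewrite divr_ge0// cylinder_prob_ge0.
  have mC : measurable (cylinder S w (k :: a)) by exact: measurable_cylinder.
  rewrite (eq_integral (fun x => q%:E * (expR (cond_information w x))%:E)%E); last first.
    move=> x /[!inE] /initial_word_cylinder /=.
    have [[sa] _ _] := wa; rewrite sa /Q => e.
    by rewrite e -EFinM; move: e; rewrite initial_wordS => -[_ ->].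
  rewrite ge0_integralZl_EFin//; last first.
    by apply: measurable_funS (@mexpI w) => // x [].
  apply: (le_trans (lee_wpmul2l _ (integral_jacobian_le k a cw ew dw dtw))).
    by rewrite lee_fin.
  rewrite -!cylinder_probE -EFinM lee_fin /q.
  (* A null cylinder has inverse mass 0 by convention, and the bound is then trivial. *)
  have [->|nz] := eqVneq (cylinder_prob S nu (theta w) a) 0.
    by rewrite mulr0 cylinder_prob_ge0.
  by rewrite divfK.
have pointwise x : fiber S w x ->
    ((F2 x)%:E + (cond_information w x)%:E + 1%:E <=
     (information S nu n.+1 w x)%:E + (Q x)%:E)%E.
  move=> wx; rewrite -!EFinD lee_fin.
  have A0 := cylinder_prob_gt0 n.+1 sw wx.
  have B0 := cylinder_prob_gt0 n stw (fiber_shift wx).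
  rewrite /F2 /information /Q.
  move: (cylinder_prob S nu w _) (cylinder_prob S nu (theta w) _) A0 B0 => a b a0 b0.
  have := expR_ge1Dx (ln a - ln b + cond_information w x).
  by rewrite !expRD expRN !lnK ?posrE//; lra.
have F20 x : 0 <= F2 x by exact: information_ge0.
have I2 : (\int[nu w]_(x in fiber S w) (F2 x)%:E = word_entropy S nu n (theta w))%E.
  rewrite word_entropyE -(ge0_integral_shift (f := EFin \o information S nu n (theta w)) sw iw)//.
  - exact: measurable_information.
  - by move=> x _; rewrite lee_fin information_ge0.
have le1 : (\int[nu w]_(x in fiber S w) ((F2 x)%:E + (cond_information w x)%:E) + 1%:E <=
    \int[nu w]_(x in fiber S w) ((information S nu n.+1 w x)%:E + (Q x)%:E))%E.
  apply: le_integral_shift => //.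
  - by case: sw => sw1 sw2; exact: (msupport_fiber1 sw1 sw2).
  - exact: emeasurable_funD.
  - exact: emeasurable_funD.
  - by move=> x _; rewrite adde_ge0 ?lee_fin ?cond_information_ge0.
  - by move=> x _; rewrite adde_ge0 ?lee_fin ?information_ge0.
have D1 : (\int[nu w]_(x in fiber S w) ((F2 x)%:E + (cond_information w x)%:E) =
    \int[nu w]_(x in fiber S w) (F2 x)%:E +
    \int[nu w]_(x in fiber S w) (cond_information w x)%:E)%E.
  by apply: ge0_integralD => // x _; rewrite lee_fin// cond_information_ge0.
have D2 : (\int[nu w]_(x in fiber S w) ((information S nu n.+1 w x)%:E + (Q x)%:E) =
    \int[nu w]_(x in fiber S w) (information S nu n.+1 w x)%:E +
    \int[nu w]_(x in fiber S w) (Q x)%:E)%E.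
  by apply: ge0_integralD => // x _; rewrite lee_fin// information_ge0.
move: le1; rewrite D1 D2 I2 -word_entropyE => le1.
by have := le_trans le1 (leeD2l _ IQ); rewrite leeD2rE.
Qed.

End equilibrium_measure.

(** A successor is chosen once for every pair of a time and a letter, so that the path becomes a
    plain recursion. *)
Lemma cylinder1_nonempty d (Omega : measurableType d) (S : rcmc Omega) w i :
  (forall k i, alphabet S (iter k (base S) w) i -> exists j,
    alphabet S (iter k.+1 (base S) w) j /\ transition S (iter k (base S) w) i j) ->
  alphabet S w i -> cylinder S w [:: i] !=set0.
Proof.
move=> ext ai.
have /choice[F HF] (p : nat * nat) : exists j,
    alphabet S (iter p.1 (base S) w) p.2 ->
    alphabet S (iter p.1.+1 (base S) w) j /\ transition S (iter p.1 (base S) w) p.2 j.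
  have [ap|nap] := pselect (alphabet S (iter p.1 (base S) w) p.2).
    by have [j Hj] := ext _ _ ap; exists j.
  by exists 0%N.
pose x : seqspace := fix x n := if n is k.+1 then F (k, x k) else i.
have ax k : alphabet S (iter k (base S) w) (x k).
  by elim: k => // k /(HF (k, x k))[].
exists x; split; first by move=> k; split => //; have [] := HF (k, x k) (ax k).
by case.
Qed.

Lemma esum_nat_gt0 (R : realType) (A : set nat) (b : nat -> bool) :
  (0 < \esum_(j in A) ((b j)%:R : R)%:E)%E -> exists j, A j /\ b j.
Proof.
move=> s0; apply: contrapT => nj; move: s0; rewrite esum1 ?ltxx// => j Aj.
by case bj : (b j) => //; exfalso; apply: nj; exists j.
Qed.

(** * The upper bound of the entropy *)

Section upper_bound.
Context (d : measure_display) (Omega : measurableType d) (R : realType).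
Context (S : rcmc Omega).
Local Notation theta := (base S).
Implicit Types (w : Omega) (x y : seqspace) (a : seq nat).
Context (phi : Omega -> seqspace -> R) (lambda s : Omega -> R).
Context (mu m : R.-spker Omega ~> seqspace).
Context (mphi : forall w, measurable_fun (fiber S w) (phi w)).

Definition defect w x : R := Num.max 0 (s w - phi w x).

Lemma defect_ge0 w x : 0 <= defect w x.
Proof. by rewrite le_max lexx. Qed.

Lemma measurable_defect w : measurable_fun (fiber S w) (defect w).
Proof. by apply: measurable_maxr => //; exact: measurable_funB. Qed.

Lemma birkhoff_sum_ge0 (f : Omega -> seqspace -> R) n w x : (forall w x, 0 <= f w x) -> 0 <= birkhoff_sum S f n w x.
Proof. by move=> f0; elim: n w x => //= n ih w x; rewrite addr_ge0. Qed.

Lemma integral_birkhoff_sum (f : Omega -> seqspace -> R) n w :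
  (forall w x, 0 <= f w x) -> (forall w, measurable_fun (fiber S w) (f w)) ->
  (forall k, supported S m (iter k theta w)) ->
  (forall k, invariant_at S m (iter k theta w)) ->
  (\int[m w]_(x in fiber S w) (birkhoff_sum S f n w x)%:E =
   \sum_(k < n) \int[m (iter k theta w)]_(x in fiber S (iter k theta w))
     (f (iter k theta w) x)%:E)%E.
Proof.
move=> f0 mf; elim: n w => [|n ih] w sw iw.
  by rewrite big_ord0 integral0_eq.
rewrite big_ord_recl /=.
have mF := measurable_fiber S w.
have mB : measurable_fun (fiber S (theta w)) (EFin \o birkhoff_sum S f n (theta w)).
  by apply/measurable_EFinP; exact: measurable_birkhoff_sum.
under eq_integral do rewrite EFinD.
rewrite ge0_integralD//=; last 4 first.
- by move=> x _; rewrite lee_fin.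
- by apply/measurable_EFinP.
- by move=> x _; rewrite lee_fin birkhoff_sum_ge0.
- have mF' := measurable_fiber S (theta w).
  have := @measurable_comp _ _ _ _ _ _ _ _ (fiber S w) left_shift mF' _ mB.
  apply; first by move=> _ [x wx <-]; exact: fiber_shift.
  by apply: measurable_funTS; exact: measurable_left_shift.
congr (_ + _)%E.
rewrite (ge0_integral_shift (f := EFin \o birkhoff_sum S f n (theta w)) (sw 0%N) (iw 0%N))//; last first.
  by move=> x _; rewrite lee_fin birkhoff_sum_ge0.
rewrite ih; last 2 first.
- by move=> k; rewrite -iterSr; exact: (sw k.+1).
- by move=> k; rewrite -iterSr; exact: (iw k.+1).
by apply: eq_bigr => k _; rewrite -iterSr.
Qed.

Lemma birkhoff_sum_normalized n w x :
  (forall k x, fiber S (iter k theta w) x -> phi (iter k theta w) x <= s (iter k theta w)) ->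
  fiber S w x ->
  birkhoff_sum S (normalized phi lambda) n w x =
  bsum theta (fun v => s v - ln (lambda v)) n w - birkhoff_sum S defect n w x.
Proof.
elim: n w x => [|n ih] w x sphi wx; first by rewrite /bsum big_ord0 subr0.
rewrite bsumS/= ih; last 2 first.
- by move=> k y; rewrite -iterSr; exact: (sphi k.+1).
- exact: fiber_shift.
rewrite /normalized /defect (max_idPr _); first by ring.
by rewrite subr_ge0; exact: (sphi 0%N).
Qed.

(** Gibbs' inequality between [m] and [mu]: the ratio [Q] of their cylinder masses has [m]-integral
    at most 1, and the hypothesis bounds minus the logarithm of the [mu]-mass by [ln C] minus the
    Birkhoff sum. The defect stays on the right so that all integrands are nonnegative. *)
Lemma word_entropy_upper n w (C : R) : 0 < C ->
  (forall k, supported S m (iter k theta w)) ->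
  (forall k, invariant_at S m (iter k theta w)) ->
  (forall k x, fiber S (iter k theta w) x -> phi (iter k theta w) x <= s (iter k theta w)) ->
  (forall x, fiber S w x -> expR (birkhoff_sum S (normalized phi lambda) n w x) <=
    C * cylinder_prob S mu w (initial_word n x)) ->
  (word_entropy S m n w +
    (bsum theta (fun v => s v - ln (lambda v)) n w - ln C)%:E <=
   \sum_(k < n) \int[m (iter k theta w)]_(x in fiber S (iter k theta w))
     (defect (iter k theta w) x)%:E)%E.
Proof.
move=> C0 sm im sphi gibbs; have mF := measurable_fiber S w.
have sm0 : supported S m w := sm 0%N.
have [sm1 sm2] := sm0.
rewrite -integral_birkhoff_sum//; [|exact: defect_ge0|exact: measurable_defect].
pose Q x := cylinder_prob S mu w (initial_word n x) / cylinder_prob S m w (initial_word n x).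
have Q0 x : 0 <= Q x by rewrite divr_ge0// cylinder_prob_ge0.
have mQ : measurable_fun (fiber S w) (EFin \o Q).
  apply/measurable_EFinP.
  exact: (@measurable_fun_initial_word _ _ n (fun a => cylinder_prob S mu w a / cylinder_prob S m w a) _ mF).
have IQ : (\int[m w]_(x in fiber S w) (Q x)%:E <= 1)%E.
  rewrite (integral_words (m w) n mQ); last by move=> x _; rewrite lee_fin.
  apply: (@le_trans _ _ (mu w (fiber S w))); last first.
    apply: le_trans (sprob_kernel_le1 mu w).
    by apply: le_measure; rewrite ?inE.
  rewrite (measure_words S (mu w) w n); apply: le_esum => a wa.
  rewrite (integral_cylinder m (fun a => cylinder_prob S mu w a / cylinder_prob S m w a) wa).
  rewrite -cylinder_probE lee_fin.
  have [->|nz] := eqVneq (cylinder_prob S m w a) 0.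
    by rewrite mulr0 cylinder_prob_ge0.
  by rewrite divfK.
have mB : measurable_fun (fiber S w) (EFin \o birkhoff_sum S defect n w).
  apply/measurable_EFinP; apply: measurable_birkhoff_sum; exact: measurable_defect.
have B0 x : 0 <= birkhoff_sum S defect n w x.
  by apply: birkhoff_sum_ge0; exact: defect_ge0.
have mI := @measurable_information _ _ _ S m n w.
set c := bsum _ _ _ _ - ln C.
have le1 : (\int[m w]_(x in fiber S w) (information S m n w x)%:E + (1 + c)%:E <=
    \int[m w]_(x in fiber S w) ((Q x)%:E + (birkhoff_sum S defect n w x)%:E))%E.
  apply: le_integral_shift => //.
  - exact: (msupport_fiber1 sm1 sm2).
  - exact: emeasurable_funD.
  - by move=> x _; rewrite lee_fin information_ge0.
  - by move=> x _; rewrite adde_ge0 ?lee_fin.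
  - move=> x wx; rewrite -!EFinD lee_fin.
    have m0 := cylinder_prob_gt0 n sm0 wx.
    have := gibbs _ wx; rewrite (birkhoff_sum_normalized n sphi wx) => gx.
    have mu0 : 0 < cylinder_prob S mu w (initial_word n x).
      by rewrite -(pmulr_rgt0 _ C0); apply: lt_le_trans gx; exact: expR_gt0.
    move: gx; rewrite -ler_ln ?posrE ?expR_gt0 ?mulr_gt0// expRK lnM//.
    rewrite /information /Q /c.
    move: (cylinder_prob S mu w _) (cylinder_prob S m w _) mu0 m0 => a b a0 b0.
    have := expR_ge1Dx (ln a - ln b).
    by rewrite expRD expRN !lnK ?posrE//; lra.
have D1 : (\int[m w]_(x in fiber S w) ((Q x)%:E + (birkhoff_sum S defect n w x)%:E) =
    \int[m w]_(x in fiber S w) (Q x)%:E +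
    \int[m w]_(x in fiber S w) (birkhoff_sum S defect n w x)%:E)%E.
  by apply: ge0_integralD => // x _; rewrite lee_fin.
move: le1; rewrite D1 -word_entropyE => le1.
have := le_trans le1 (leeD2r _ IQ).
by rewrite EFinD addeCA leeD2lE.
Qed.

End upper_bound.

(** * Averages along times of positive density *)

Section limits.
Context (R : realType).
Implicit Types (u v : nat -> \bar R).

Lemma le_cvg_frequently u v (a b : \bar R) (A : set nat) :
  (forall N, exists n, (N <= n)%N /\ A n) ->
  (u n @[n --> \oo] --> a) -> (v n @[n --> \oo] --> b) ->
  (forall n, A n -> u n <= v n)%E -> (a <= b)%E.
Proof.
move=> freqA ua vb uv.
have PA : ProperFilter (within A \oo).
  apply: Build_ProperFilter_ex => B [N _ NB].
  by have [n [Nn An]] := freqA N; exists n; exact: NB.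
have ua' : u n @[n --> within A \oo] --> a.
  by apply: cvg_trans ua; apply: cvg_app; exact: cvg_within.
have vb' : v n @[n --> within A \oo] --> b.
  by apply: cvg_trans vb; apply: cvg_app; exact: cvg_within.
apply: (lee_cvg_to ua' vb').
by exists 0%N => // n _; exact: uv.
Qed.

Lemma cvg_ereal_fin u (e : R) :
  (forall eps : R, 0 < eps -> \forall n \near \oo,
    ((e - eps)%:E <= u n <= (e + eps)%:E)%E) ->
  u n @[n --> \oo] --> e%:E.
Proof.
move=> h; apply: cvg_EFin.
  apply: filterS (h 1 ltr01) => n /andP[h1 h2].
  by case: (u n) h1 h2.
apply/cvgrPdist_le => eps eps0; apply: filterS (h _ eps0) => n /= /andP[].
case: (u n) => [x| |]//=; rewrite !lee_fin => h1 h2.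
by rewrite ler_norml; apply/andP; split; lra.
Qed.

Definition good_count (A : set nat) (n : nat) : nat := \sum_(k < n) (`[< A k >] : nat).

Lemma good_count_flat (A : set nat) m n : (m <= n)%N ->
  (forall k, (m <= k < n)%N -> ~ A k) -> good_count A n = good_count A m.
Proof.
move=> /subnK <-; elim: (n - m)%N => // j ih h.
rewrite addSn /good_count big_ord_recr/= -/(good_count _ _) ih; last first.
  by move=> k /andP[k1 k2]; apply: h; rewrite k1 ltnS ltnW.
by rewrite asboolF ?addn0//; apply: h; rewrite leq_addl ltnSn.
Qed.

(* A set of positive density has a member between n and (1 + delta) n. *)
Lemma density_next (A : set nat) (p delta : R) : 0 < p -> 0 < delta ->
  (n%:R^-1 * (good_count A n)%:R : R) @[n --> \oo] --> p ->
  \forall n \near \oo, exists k, [/\ (n <= k)%N, k%:R <= (1 + delta) * n%:R & A k].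
Proof.
move=> p0 d0 cA.
(* A gap from [n] to [(1 + delta) * n] would force [(p - eta) * (1 + delta) < p + eta], that is
   [p * delta < eta * (2 + delta)]; this [eta] makes the right side a third of the left. *)
pose eta := p * delta / (3 * (2 + delta)).
have d2 : 0 < 3 * (2 + delta) by lra.
have eta0 : 0 < eta by rewrite divr_gt0// mulr_gt0.
have etaE : eta * (3 * (2 + delta)) = p * delta by rewrite divfK// gt_eqF.
move/cvgrPdist_le : cA => /(_ eta eta0) [n0 _ cA].
exists n0.+1 => // n /= n0n; apply: contrapT => nk.
have n1 : 0 < n%:R :> R by rewrite ltr0n (leq_trans _ n0n).
pose N := (Num.truncn ((1 + delta) * n%:R)).+1.
have x0 : 0 <= (1 + delta) * n%:R by rewrite mulr_ge0// ltW// addr_gt0.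
have NN : (1 + delta) * n%:R < N%:R by exact: truncnS_gt.
have nN : (n <= N)%N.
  by rewrite -(ler_nat R) (le_trans _ (ltW NN))// ler_peMl ?ler0n// lerDl ltW.
have flat : good_count A N = good_count A n.
  apply: good_count_flat => // k /andP[nk1 kN] Ak; apply: nk; exists k; split => //.
  have /andP[tr _] := truncn_itv x0; apply: le_trans tr.
  by rewrite ler_nat -ltnS.
have N1 : 0 < N%:R :> R by rewrite ltr0n (leq_trans _ nN)// -(ltr0n R).
have := cA n (ltnW n0n); have := cA N (leq_trans (ltnW n0n) nN).
rewrite flat; move: (good_count A n)%:R => g /=.
rewrite !ler_distl => /andP[_ +] /andP[+ _].
rewrite ![_^-1 * g]mulrC => h1 h2.
have {}h1 : (p - eta) * N%:R <= g.
  rewrite -ler_pdivlMr//; lra.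
have {}h2 : g <= (p + eta) * n%:R.
  rewrite -ler_pdivrMr//; lra.
have pd : 0 < p * delta by rewrite mulr_gt0.
have ed : 0 < eta * delta by rewrite mulr_gt0.
have pe : 0 < p - eta.
  rewrite subr_gt0 ltNge; apply/negP => /(ler_wpM2r (ltW d2)).
  by rewrite etaE; lra.
have h3 : (p - eta) * ((1 + delta) * n%:R) < (p - eta) * N%:R by rewrite ltr_pM2l.
have h4 : ((p - eta) * (1 + delta)) * n%:R < (p + eta) * n%:R.
  by rewrite -mulrA (lt_le_trans h3)// (le_trans h1).
rewrite ltr_pM2r// in h4.
by lra.
Qed.

(* Sandwich along a set of times of positive density, for nondecreasing u. *)
Lemma cvg_average_nd u (lo up : nat -> \bar R) (e : \bar R) (A : set nat) (p : R) :
  0 < p -> (n%:R^-1 * (good_count A n)%:R : R) @[n --> \oo] --> p ->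
  (forall n, 0 <= u n)%E ->
  {homo u : m n / (m <= n)%N >-> (m <= n)%E} ->
  (forall n, lo n <= u n)%E -> (forall n, (0 < n)%N -> A n -> u n <= up n)%E ->
  ((n%:R^-1)%:E * lo n)%E @[n --> \oo] --> e ->
  (e != +oo -> ((n%:R^-1)%:E * up n)%E @[n --> \oo] --> e)%E ->
  (0 <= e)%E ->
  ((n%:R^-1)%:E * u n)%E @[n --> \oo] --> e.
Proof.
move=> p0 cA u0 ndu lou uup clo; case: e clo => [e| |]// clo cup; last first.
  move=> _; apply/cvgeyPge => B; move/cvgeyPge: clo => /(_ B).
  apply: filterS => n /le_trans; apply.
  by apply: lee_wpmul2l => //; rewrite lee_fin invr_ge0.
rewrite lee_fin => e0; apply: cvg_ereal_fin => eps eps0.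
have {}cup := cup isT.
(* The choice of [delta] gives [(1 + delta) * c = e + eps]: waiting for the next time in [A] costs a
   factor [1 + delta] on an average already below [c]. *)
pose c := e + eps / 2; have c0 : 0 < c by rewrite /c; lra.
pose delta := (eps / 2) / c.
have d0 : 0 < delta by rewrite divr_gt0//; lra.
have cE : (1 + delta) * c = e + eps.
  by rewrite mulrDl mul1r divfK ?gt_eqF// /c; lra.
have [n1 _ next] := density_next p0 d0 cA.
have [n2 _ upc] : \forall n \near \oo, ((n%:R^-1)%:E * up n < c%:E)%E.
  have U : nbhs e%:E [set y | (y < c%:E)%E].
    apply: open_nbhs_nbhs; split; first exact: open_ereal_lt_ereal.
    by rewrite /= lte_fin /c; lra.
  exact: cup _ U.
have [n3 _ loc] : \forall n \near \oo, ((e - eps)%:E < (n%:R^-1)%:E * lo n)%E.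
  have U : nbhs e%:E [set y | ((e - eps)%:E < y)%E].
    apply: open_nbhs_nbhs; split; first exact: open_ereal_gt_ereal.
    by rewrite /= lte_fin; lra.
  exact: clo _ U.
exists (maxn n1 (maxn n2 n3)).+1 => // n /=; rewrite !gtn_max => /and3P[h1 h2 h3].
have n0 : 0 < n%:R :> R by rewrite ltr0n (leq_ltn_trans _ h1).
apply/andP; split.
  apply: (le_trans (ltW (loc n (ltnW h3)))).
  by apply: lee_wpmul2l => //; rewrite lee_fin invr_ge0.
have [k [nk kn Ak]] := next n (ltnW h1).
have k0 : (0 < k)%N by rewrite -(ltr0n R) (lt_le_trans n0)// ler_nat.
rewrite lee_pdivrMl//; apply: (le_trans (ndu _ _ nk)); apply: (le_trans (uup k k0 Ak)).
have := ltW (upc k (leq_trans (ltnW h2) nk)).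
rewrite /= lee_pdivrMl ?ltr0n// => /le_trans; apply.
rewrite -!EFinM lee_fin -cE mulrCA mulrA; apply: ler_wpM2r => //; exact: ltW.
Qed.

End limits.

Lemma aeI d (T : measurableType d) (R : realType) (m : {measure set T -> \bar R})
    (Q Q' : T -> Prop) : {ae m, forall w, Q w} -> {ae m, forall w, Q' w} ->
  {ae m, forall w, Q w /\ Q' w}.
Proof. by move=> h1 h2; apply: filterS2 h1 h2 => w; exact: conj. Qed.

(** The whole space is not null. This allows relations between integrals over the base to be read
    off Birkhoff limits along a single orbit. *)
Lemma ae_cst d (T : measurableType d) (R : realType) (P : probability T R) (Q : Prop) :
  {ae P, forall w : T, Q} -> Q.
Proof.
move=> [A [mA A0 QA]]; apply: contrapT => nQ.
have AT : A = setT by apply/seteqP; split => // w _; exact: QA.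
by move: A0; rewrite AT probability_setT => /eqP; rewrite onee_eq0.
Qed.

Lemma cvg_mean_cst (R : realType) (K : R) :
  n%:R^-1 * K @[n --> \oo] --> (0 : R).
Proof.
rewrite -(mul0r K); apply: cvgMl.
by rewrite -cvg_shiftS; exact: cvg_harmonic.
Qed.

Lemma cvg_mean_add (R : realType) (Y : nat -> \bar R) (b : nat -> R) (K beta : R) (y : \bar R) :
  ((n%:R^-1)%:E * Y n)%E @[n --> \oo] --> y ->
  n%:R^-1 * b n @[n --> \oo] --> beta ->
  ((n%:R^-1)%:E * (Y n + (K + b n)%:E))%E @[n --> \oo] --> (y + beta%:E)%E.
Proof.
move=> cY cb.
have -> : (fun n => ((n%:R^-1)%:E * (Y n + (K + b n)%:E))%E) =
    (fun n => ((n%:R^-1)%:E * Y n + (n%:R^-1 * K + n%:R^-1 * b n)%:E)%E).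
  apply/funext => n; rewrite muleDr ?fin_num_adde_defl//.
  by rewrite -[in RHS]mulrDr EFinM.
apply: cvgeD => //; first exact: fin_num_adde_defl.
apply: cvg_EFin; first exact: nearW.
rewrite -[beta]add0r; apply: cvgD cb; exact: cvg_mean_cst.
Qed.

Lemma frequently_mean_le (R : realType) (A : set nat) (X Y : nat -> \bar R)
    (b : nat -> R) (K beta : R) (x y : \bar R) :
  (forall N, exists n, (N <= n)%N /\ A n) ->
  ((n%:R^-1)%:E * X n)%E @[n --> \oo] --> x ->
  ((n%:R^-1)%:E * Y n)%E @[n --> \oo] --> y ->
  n%:R^-1 * b n @[n --> \oo] --> beta ->
  (forall n, A n -> X n <= Y n + (K + b n)%:E)%E -> (x <= y + beta%:E)%E.
Proof.
move=> freqA cX cY cb XY.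
apply: (le_cvg_frequently freqA cX (cvg_mean_add K cY cb)) => n An.
by apply: lee_wpmul2l; [rewrite lee_fin invr_ge0|exact: XY].
Qed.

Lemma density_frequently (R : realType) (A : set nat) (p : R) : 0 < p ->
  (n%:R^-1 * (good_count A n)%:R : R) @[n --> \oo] --> p ->
  forall N, exists n, (N <= n)%N /\ A n.
Proof.
move=> p0 cA N; have [n0 _ h] := density_next p0 ltr01 cA.
have [k [k1 _ Ak]] := h (maxn n0 N) (leq_maxl _ _).
by exists k; split => //; rewrite (leq_trans _ k1)// leq_maxr.
Qed.

(** * The equilibrium state *)

Section equilibrium.
Context (R : realType) (d : measure_display) (Omega : measurableType d).
Context (P : probability Omega R) (S : rcmc Omega).
Context (Obi Obp : set Omega) (I : set nat).
Context (r : R) (kappa : Omega -> R) (phi : Omega -> seqspace -> R) (pG : R).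
Context (lambda : Omega -> R) (h : Omega -> seqspace -> R).
Context (mu nu : R.-spker Omega ~> seqspace).
Context (N : nat -> nat -> Omega -> nat).
Context (HS : is_rcmc P S) (Hbip : is_bip P S N Obi Obp I).
Context (Hphi : measurable_on_total S phi) (r01 : 0 < r < 1).
Context (HH : condition_H P S Obi Obp r kappa phi) (Hsum : condition_S P S phi).
Context (Hrpf : is_rpf P S phi r kappa pG lambda h mu nu).

Local Notation theta := (base S).
Local Notation thetaV := (base_inv S).
Implicit Types (w : Omega) (x y : seqspace) (a : seq nat).

Let erg := rcmc_ergodic HS.
Let thetaK := ergodic_cancel erg.
Let thetaVK := ergodic_cancel_inv erg.
Let mtheta := ergodic_measurable erg.
Let mthetaV := ergodic_measurable_inv erg.
Let thetaP := ergodic_preserving erg.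
Let l0 := rpf_lambda_gt0 Hrpf.
Let h0 := rpf_h_gt0 Hrpf.

Let thetaVP A : measurable A -> P (thetaV @^-1` A) = P A.
Proof.
move=> mA; rewrite -[LHS]thetaP; last first.
  by rewrite -[X in measurable X]setTI; exact: mthetaV.
congr (P _); apply/seteqP; split => w /=; by rewrite thetaK.
Qed.

Let mphi w : measurable_fun (fiber S w) (phi w).
Proof. exact: (measurable_on_fiber HS Hphi). Qed.

Let mh w : measurable_fun (fiber S w) (h w).
Proof. exact: (measurable_on_fiber HS (rpf_h_measurable Hrpf)). Qed.

Let kappa0 w : 0 <= kappa w.
Proof. by case: HH => -[]. Qed.

Let mkappa : measurable_fun setT kappa.
Proof. by case: HH => -[]. Qed.

Let ikappa : P.-integrable setT (EFin \o kappa).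
Proof. by case: HH. Qed.

(** Past fibers are included because quasi-independence at [w] concerns words that start over every
    [iter n thetaV w]. *)
Lemma ae_orbit (Q : Omega -> Prop) : {ae P, forall w, Q w} ->
  {ae P, forall w, forall n k, Q (iter k theta (iter n thetaV w))}.
Proof.
by move=> /(ae_iter mtheta thetaP) /(ae_iter mthetaV thetaVP).
Qed.

Definition ruelle_norm w : \bar R :=
  sup_norm S w (fun x => lne (ruelle S phi (thetaV w) (cst 1%E) x)).

(** The norm in (S), taken at [theta w], bounds [phi w] because [exp phi] is one term of the sum
    defining Ruelle's operator at the function 1. [fine] sends an infinite norm to 0, which happens
    only on a null set. *)
Definition phi_bound w : R := fine (ruelle_norm (theta w)).

Lemma integrable_phi_bound : P.-integrable setT (EFin \o phi_bound).
Proof.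
have i1 := integrable_preserving mtheta thetaP Hsum.
have := integrable_ae measurableT i1 => ae1.
apply/integrableP; split.
  apply/measurable_EFinP; apply: measurableT_comp => //.
  by case/integrableP : i1.
case/integrableP : i1 => m1; apply: le_lt_trans.
apply: ge0_le_integral => //.
- apply: measurableT_comp => //; apply/measurable_EFinP; exact: measurableT_comp.
- by apply: measurableT_comp.
- move=> w _; rewrite /phi_bound /= /ruelle_norm; case: (sup_norm _ _ _) => [z| |]//=; exact: leey.
Qed.

Lemma phi_le_bound w x : ruelle_norm (theta w) \is a fin_num -> fiber S w x ->
  phi w x <= phi_bound w.
Proof.
move=> fn wx; rewrite -lee_fin /phi_bound fineK//.
have : (`|lne (ruelle S phi w (cst 1%E) (left_shift x))| <= ruelle_norm (theta w))%E.
  rewrite /ruelle_norm thetaK; apply: ereal_sup_ubound.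
  by exists (left_shift x) => //; exact: fiber_shift.
apply: le_trans; apply: (le_trans _ (lee_abs _)).
have : ((expR (phi w x))%:E <= ruelle S phi w (cst 1%E) (left_shift x))%E.
  apply: esum_ge; exists [set x]; last by rewrite fsbig_set1 mule1.
  by split; [exact: finite_set1|move=> _ ->].
move=> le1; rewrite -[leLHS]expeRK lee_lne//.
- by rewrite in_itv/= lee_fin expR_ge0 leey.
- by rewrite in_itv/= leey andbT (le_trans _ le1)// lee_fin expR_ge0.
Qed.

Lemma measurable_past_series : measurable_fun setT (past_series S r kappa).
Proof.
rewrite (_ : past_series S r kappa = fun w => \sum_(k <oo | k \in [pred k | (1 <= k)%N])
  (kappa (iter k thetaV w) * r ^+ k)%:E)%E; last first.
  by apply/funext => w; rewrite /past_series eseries_cond.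
apply: ge0_emeasurable_sum.
  by move=> k w _ _; rewrite lee_fin mulr_ge0// exprn_ge0//; case/andP: r01 => /ltW.
move=> k _; apply/measurable_EFinP; apply: measurable_funM => //.
by apply: (measurableT_comp mkappa); exact: measurable_iter.
Qed.

(** Invariance of [P] under [thetaV] turns the integral of the series into a geometric series times
    the integral of [kappa], which is finite by (H). *)
Lemma past_series_fin : {ae P, forall w, (past_series S r kappa w < +oo)%E}.
Proof.
have [r0 r1] := andP r01.
pose u k w := (kappa (iter k thetaV w) * r ^+ k)%:E.
have u0 k w : (0 <= u k w)%E by rewrite lee_fin mulr_ge0// exprn_ge0// ltW.
have muk k : measurable_fun setT (u k).
  apply/measurable_EFinP; apply: measurable_funM => //.
  by apply: (measurableT_comp mkappa); exact: measurable_iter.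
have pE w : past_series S r kappa w = (\sum_(k <oo | (1 <= k)%N) u k w)%E.
  by rewrite /past_series eseries_cond.
have ple w : (past_series S r kappa w <= \sum_(k <oo) u k w)%E.
  rewrite pE eseries_mkcond; apply: lee_nneseries => k _ /=; first by case: ifP.
  by case: ifP.
have Iu k : (\int[P]_w u k w = (fine (\int[P]_w (kappa w)%:E) * r ^+ k)%:E)%E.
  rewrite EFinM fineK; last exact: (integrable_fin_num _ ikappa).
  rewrite muleC /u; under eq_integral do rewrite EFinM muleC.
  rewrite ge0_integralZl_EFin//; last 3 first.
  - by move=> w _; rewrite lee_fin.
  - by apply/measurable_EFinP; apply: (measurableT_comp mkappa); exact: measurable_iter.
  - by rewrite exprn_ge0// ltW.
  congr (_ * _)%E; elim: k => // k ih; rewrite -{}ih.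
  rewrite -(integral_preserving mthetaV thetaVP (u := fun w => (kappa (iter k thetaV w))%:E)).
    by apply: eq_integral => w _; rewrite -iterSr.
  by apply/measurable_EFinP; apply: (measurableT_comp mkappa); exact: measurable_iter.
have iu : (\int[P]_w (\sum_(k <oo) u k w) < +oo)%E.
  rewrite integral_nneseries//.
  pose a := fine (\int[P]_w (kappa w)%:E).
  have a0 : 0 <= a by apply/fine_ge0/integral_ge0 => w _; rewrite lee_fin.
  apply: (@le_lt_trans _ _ (a * (1 - r)^-1)%:E); last exact: ltry.
  apply: lime_le; first by apply: is_cvg_nneseries => k _ _; exact: integral_ge0.
  apply: nearW => n; rewrite (eq_bigr _ (fun k _ => Iu k)) sumEFin lee_fin.
  have := @geometric_seriesE R a r; rewrite lt_eqF// => /(_ isT) /(congr1 (fun f => f n)).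
  rewrite /series/= => ->; apply: ler_wpM2r; first by rewrite invr_ge0 subr_ge0 ltW.
  by rewrite ler_piMr// gerBl exprn_ge0// ltW.
have mu' : measurable_fun setT (fun w => \sum_(k <oo) u k w)%E.
  rewrite (_ : (fun w => _) = fun w => \sum_(k <oo | k \in predT) u k w)%E//.
  exact: ge0_emeasurable_sum.
have U0 w : (0 <= \sum_(k <oo) u k w)%E by apply: nneseries_ge0.
have : P.-integrable setT (fun w => \sum_(k <oo) u k w)%E.
  apply/integrableP; split => //.
  by under eq_integral do rewrite gee0_abs//.
move=> /(integrable_ae measurableT); apply: filterS => w /(_ Logic.I).
by rewrite ge0_fin_numE//; exact: le_lt_trans.
Qed.

(** The almost sure properties of one fiber, gathered so that the later arguments are pointwise
    along an orbit of regular points. *)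
Record regular w : Prop := Regular {
  reg_row : forall i, alphabet S w i ->
    exists j, alphabet S (theta w) j /\ transition S w i j;
  reg_holder : holder_at S r kappa phi w;
  reg_var1 : Obi (theta w) -> exists V : R, (Defs.variation S phi 1 w <= V%:E)%E;
  reg_mu : supported S mu w;
  reg_eigen : eigenfunction_at S phi h lambda w;
  reg_norm : (\int[mu w]_(x in fiber S w) (h w x)%:E = 1)%E;
  reg_conf : conformal_at S mu phi lambda w;
  reg_dens : density_at S h mu nu w;
  reg_lnh : exists b : R, forall x, fiber S w x -> `|ln (h w x)| <= b;
  reg_phi : forall x, fiber S w x -> phi w x <= phi_bound w;
  reg_past : (past_series S r kappa w < +oo)%E }.

Lemma ae_regular : {ae P, forall w, regular w}.
Proof.
have [[_ _ _ aeV] _ aeV1] := HH.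
have aes := integrable_ae measurableT (integrable_preserving mtheta thetaP Hsum).
have [kh [_ aeh] _] := rpf_holder Hrpf.
have A := aeI (rcmc_row HS) (aeI past_series_fin (aeI aeV
  (aeI aeV1 (aeI (rpf_mu Hrpf) (aeI (rpf_eigenfunction Hrpf)
  (aeI (rpf_normalized Hrpf) (aeI (rpf_conformal Hrpf)
  (aeI (rpf_density Hrpf) (aeI aeh aes))))))))).
apply: filterS A => w [row [past [V [V1 [mu1 [ew [norm [cw [dw [lh sw]]]]]]]]]].
split => //.
- move=> i ai; have [j [aj tj]] := esum_nat_gt0 (row i ai).
  by exists j.
- move=> n x y n2 wx wy xy; exact: variation_le (V n n2) wx wy xy.
- move=> Ow; have := V1 (or_introl Ow).
  case: (Defs.variation _ _ _ _) => [z _| |]//; first by exists z.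
  by exists 0; exact: leNye.
- move: lh; rewrite /sup_norm; set e := ereal_sup _ => elt.
  have ub x : fiber S w x -> (`|(ln (h w x))%:E| <= e)%E.
    by move=> wx; apply: ereal_sup_ubound; exists x.
  case: e elt ub => [b _ ub| |_ ub]//; first by exists b.
  by exists 0 => x /ub.
- by move=> x wx; apply: phi_le_bound => //; exact: sw.
Qed.

Definition on_orbit (Q : Omega -> Prop) w := forall k, Q (iter k theta w).

Lemma on_orbitS Q w k : on_orbit Q w -> on_orbit Q (iter k theta w).
Proof. by move=> Qw j; rewrite -iterD; exact: Qw. Qed.

Lemma regular_nu_supported w : regular w -> supported S nu w.
Proof.
by move=> rw; apply: (density_supported mh h0 (reg_mu rw) (reg_dens rw) (reg_norm rw)).
Qed.

Lemma regular_nu_invariant w : on_orbit regular w -> invariant_at S nu w.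
Proof.
move=> rw; have r0 := rw 0%N; have r1 := rw 1%N.
exact: (density_invariant l0 mh h0 (reg_conf r0) (reg_eigen r0) (reg_dens r0) (reg_dens r1)).
Qed.

Lemma ae_on_orbit_regular : {ae P, forall w, on_orbit regular w}.
Proof. by apply: (ae_iter mtheta thetaP); exact: ae_regular. Qed.

Lemma nu_invariant : random_invariant P S nu.
Proof.
split.
  by apply: filterS ae_regular => w /regular_nu_supported.
by apply: filterS ae_on_orbit_regular => w /regular_nu_invariant.
Qed.

Lemma random_invariant_orbit m : random_invariant P S m ->
  {ae P, forall w, on_orbit (supported S m) w /\ on_orbit (invariant_at S m) w}.
Proof.
move=> [sm im].
exact: (aeI (ae_iter mtheta thetaP sm) (ae_iter mtheta thetaP im)).
Qed.

(** * Fiber integrals of the defect, the information and [ln h] *)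

Definition excess w : R := phi_bound w - ln (lambda w).

Definition free_part (m : R.-spker Omega ~> seqspace) w : \bar R :=
  (\int[m w]_(x in fiber S w) (defect phi phi_bound w x)%:E)%E.

Definition mean_information w : \bar R :=
  (\int[nu w]_(x in fiber S w) (cond_information S phi h lambda w x)%:E)%E.

Let mphi_bound : measurable_fun setT phi_bound.
Proof. by apply/measurable_EFinP; exact: (measurable_int _ integrable_phi_bound). Qed.

Let mlambda : measurable_fun setT (fun w => ln (lambda w)).
Proof. exact: measurableT_comp (@measurable_ln R) (rpf_lambda_measurable Hrpf). Qed.

Lemma measurable_defect_total : measurable_on_total S (defect phi phi_bound).
Proof.
apply: measurable_maxr => //; apply: measurable_funB => //.
exact: (@measurable_on_total_base _ _ _ S _ mphi_bound).
Qed.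

Lemma measurable_ln_h_total : measurable_on_total S (fun w x => ln (h w x)).
Proof. exact: measurableT_comp (@measurable_ln R) (rpf_h_measurable Hrpf). Qed.

Lemma measurable_cond_information_total :
  measurable_on_total S (cond_information S phi h lambda).
Proof.
apply: measurable_maxr => //; apply: measurable_funB => //.
apply: measurable_funB; last exact: measurable_ln_h_total.
apply: measurable_funD; first exact: (@measurable_on_total_base _ _ _ S _ mlambda).
exact: (measurable_on_total_shift HS measurable_ln_h_total).
Qed.

Lemma measurable_free_part m : measurable_fun setT (free_part m).
Proof.
apply: (measurable_fiber_integral HS m measurable_defect_total).
by move=> w x; exact: defect_ge0.
Qed.

Lemma measurable_mean_information : measurable_fun setT mean_information.
Proof.
apply: (measurable_fiber_integral HS nu measurable_cond_information_total).
by move=> w x; exact: cond_information_ge0.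
Qed.

Lemma free_part_ge0 m w : (0 <= free_part m w)%E.
Proof. by apply: integral_ge0 => x _; rewrite lee_fin defect_ge0. Qed.

Lemma mean_information_ge0 w : (0 <= mean_information w)%E.
Proof. by apply: integral_ge0 => x _; rewrite lee_fin cond_information_ge0. Qed.

Definition ln_pos w x : R := Num.max 0 (ln (h w x)).
Definition ln_neg w x : R := Num.max 0 (- ln (h w x)).

(** The [nu]-mean of [ln h] on a fiber, as a difference of two nonnegative integrals so that
    [measurable_fiber_integral] applies to each; both are finite on regular fibers, where [ln h] is
    bounded. *)
Definition mean_ln w : R :=
  fine (\int[nu w]_(x in fiber S w) (ln_pos w x)%:E)%E -
  fine (\int[nu w]_(x in fiber S w) (ln_neg w x)%:E)%E.

Lemma measurable_ln_pos_total : measurable_on_total S ln_pos.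
Proof. by apply: measurable_maxr => //; exact: measurable_ln_h_total. Qed.

Lemma measurable_ln_neg_total : measurable_on_total S ln_neg.
Proof.
apply: measurable_maxr => //; apply: measurableT_comp => //.
exact: measurable_ln_h_total.
Qed.

Lemma measurable_mean_ln : measurable_fun setT mean_ln.
Proof.
apply: measurable_funB; apply: measurableT_comp => //.
  apply: (measurable_fiber_integral HS nu measurable_ln_pos_total).
  by move=> w x; rewrite le_max lexx.
apply: (measurable_fiber_integral HS nu measurable_ln_neg_total).
by move=> w x; rewrite le_max lexx.
Qed.

Lemma ln_pos_neg w x : ln (h w x) = ln_pos w x - ln_neg w x.
Proof.
rewrite /ln_pos /ln_neg; case: (leP 0 (ln (h w x))) => [l|/ltW l].
  by rewrite (max_idPl _) ?subr0// oppr_le0.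
by rewrite (max_idPr _) ?sub0r ?opprK// oppr_ge0.
Qed.

Lemma integral_bounded_fin (m : R.-spker Omega ~> seqspace) w (f : seqspace -> R) (b : R) :
  measurable_fun (fiber S w) f -> (forall x, 0 <= f x) ->
  (forall x, fiber S w x -> f x <= b) ->
  (fine (\int[m w]_(x in fiber S w) (f x)%:E))%:E =
  (\int[m w]_(x in fiber S w) (f x)%:E)%E.
Proof.
move=> mf f0 fb; have mF := measurable_fiber S w.
rewrite fineK// ge0_fin_numE; last by apply: integral_ge0 => x _; rewrite lee_fin.
apply: (@le_lt_trans _ _ (`|b|%:E * m w (fiber S w))%E).
  rewrite -integral_cst//; apply: ge0_le_integral => //.
  - by move=> x _; rewrite lee_fin.
  - exact/measurable_EFinP.
  - by move=> x wx; rewrite lee_fin (le_trans (fb x wx))// ler_norm.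
apply: (@le_lt_trans _ _ (`|b|%:E * 1)%E); last by rewrite mule1 ltry.
apply: lee_wpmul2l; first by rewrite lee_fin.
apply: le_trans (sprob_kernel_le1 m w).
by apply: le_measure; rewrite ?inE.
Qed.

Lemma fine_ln_pos w : regular w ->
  (fine (\int[nu w]_(x in fiber S w) (ln_pos w x)%:E))%:E =
  (\int[nu w]_(x in fiber S w) (ln_pos w x)%:E)%E.
Proof.
move=> rw; have [b hb] := reg_lnh rw.
apply: (integral_bounded_fin (b := b) nu).
- exact: (measurable_on_fiber HS measurable_ln_pos_total).
- by move=> x; rewrite le_max lexx.
- move=> x wx; rewrite ge_max (le_trans _ (hb x wx))//=.
  exact: le_trans (ler_norm _) (hb x wx).
Qed.

Lemma fine_ln_neg w : regular w ->
  (fine (\int[nu w]_(x in fiber S w) (ln_neg w x)%:E))%:E =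
  (\int[nu w]_(x in fiber S w) (ln_neg w x)%:E)%E.
Proof.
move=> rw; have [b hb] := reg_lnh rw.
apply: (integral_bounded_fin (b := b) nu).
- exact: (measurable_on_fiber HS measurable_ln_neg_total).
- by move=> x; rewrite le_max lexx.
- move=> x wx; rewrite ge_max (le_trans _ (hb x wx))//=.
  by rewrite (le_trans _ (hb x wx))// -normrN ler_norm.
Qed.

(** Pointwise, the information is the defect minus [excess] plus the increment of [ln h] along the
    skew product. To integrate nonnegative functions only, [ln h] is split into its two parts and
    each subtracted part is put on the opposite side. *)
Lemma free_part_cohomology w : on_orbit regular w ->
  (free_part nu w + (mean_ln (theta w) - mean_ln w - excess w)%:E =
   mean_information w)%E.
Proof.
move=> ow; have rw := ow 0%N; have rtw := ow 1%N; rewrite /= in rw rtw.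
have mF := measurable_fiber S w.
have sw := regular_nu_supported rw.
have iw := regular_nu_invariant ow.
have mdef : measurable_fun (fiber S w) (EFin \o defect phi phi_bound w).
  by apply/measurable_EFinP; exact: (measurable_on_fiber HS measurable_defect_total).
have mci : measurable_fun (fiber S w) (EFin \o cond_information S phi h lambda w).
  by apply/measurable_EFinP; exact: (measurable_on_fiber HS measurable_cond_information_total).
have mpos w' : measurable_fun (fiber S w') (EFin \o ln_pos w').
  by apply/measurable_EFinP; exact: (measurable_on_fiber HS measurable_ln_pos_total).
have mneg w' : measurable_fun (fiber S w') (EFin \o ln_neg w').
  by apply/measurable_EFinP; exact: (measurable_on_fiber HS measurable_ln_neg_total).
have mposS : measurable_fun (fiber S w) (fun x => (ln_pos (theta w) (left_shift x))%:E).
  apply/measurable_EFinP.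
  exact: (measurable_on_fiber HS (measurable_on_total_shift HS measurable_ln_pos_total)).
have mnegS : measurable_fun (fiber S w) (fun x => (ln_neg (theta w) (left_shift x))%:E).
  apply/measurable_EFinP.
  exact: (measurable_on_fiber HS (measurable_on_total_shift HS measurable_ln_neg_total)).
have pos0 w' x : (0 <= (ln_pos w' x)%:E)%E by rewrite lee_fin le_max lexx.
have neg0 w' x : (0 <= (ln_neg w' x)%:E)%E by rewrite lee_fin le_max lexx.
have def0 x : (0 <= (defect phi phi_bound w x)%:E)%E by rewrite lee_fin defect_ge0.
have ci0 x : (0 <= (cond_information S phi h lambda w x)%:E)%E.
  by rewrite lee_fin cond_information_ge0.
pose F x := ((defect phi phi_bound w x)%:E + (ln_pos (theta w) (left_shift x))%:E + (ln_neg w x)%:E)%E.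
pose G x := ((cond_information S phi h lambda w x)%:E + (ln_pos w x)%:E +
  (ln_neg (theta w) (left_shift x))%:E)%E.
have IF : (\int[nu w]_(x in fiber S w) F x = free_part nu w +
    \int[nu (theta w)]_(x in fiber S (theta w)) (ln_pos (theta w) x)%:E +
    \int[nu w]_(x in fiber S w) (ln_neg w x)%:E)%E.
  rewrite /F ge0_integralD//; last 2 first.
  - by move=> x _; rewrite adde_ge0.
  - exact: emeasurable_funD.
  rewrite ge0_integralD//; congr (_ + _ + _)%E.
  exact: (ge0_integral_shift sw iw (@mpos (theta w)) (fun x _ => pos0 (theta w) x)).
have IG : (\int[nu w]_(x in fiber S w) G x = mean_information w +
    \int[nu w]_(x in fiber S w) (ln_pos w x)%:E +
    \int[nu (theta w)]_(x in fiber S (theta w)) (ln_neg (theta w) x)%:E)%E.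
  rewrite /G ge0_integralD//; last 2 first.
  - by move=> x _; rewrite adde_ge0.
  - exact: emeasurable_funD.
  rewrite ge0_integralD//; congr (_ + _ + _)%E.
  exact: (ge0_integral_shift sw iw (@mneg (theta w)) (fun x _ => neg0 (theta w) x)).
have E : (\int[nu w]_(x in fiber S w) F x + (ln (lambda w) - phi_bound w)%:E =
    \int[nu w]_(x in fiber S w) G x)%E.
  apply: integral_shift_eq => //.
  - by case: sw => sw1 sw2; exact: (msupport_fiber1 sw1 sw2).
  - by apply: emeasurable_funD => //; exact: emeasurable_funD.
  - by apply: emeasurable_funD => //; exact: emeasurable_funD.
  - by move=> x _; rewrite !adde_ge0.
  - by move=> x _; rewrite !adde_ge0.
  - move=> x wx; rewrite /F /G -!EFinD; congr EFin.
    rewrite (cond_informationE l0 h0 (reg_eigen rw) wx) !ln_pos_neg /defect.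
    rewrite (max_idPr _); first by ring.
    by rewrite subr_ge0; exact: (reg_phi rw).
have [a1 E1] : exists a : R, (\int[nu w]_(x in fiber S w) (ln_pos w x)%:E = a%:E)%E.
  by eexists; exact/esym/(fine_ln_pos rw).
have [a2 E2] : exists a : R,
    (\int[nu (theta w)]_(x in fiber S (theta w)) (ln_pos (theta w) x)%:E = a%:E)%E.
  by eexists; exact/esym/(fine_ln_pos rtw).
have [a3 E3] : exists a : R, (\int[nu w]_(x in fiber S w) (ln_neg w x)%:E = a%:E)%E.
  by eexists; exact/esym/(fine_ln_neg rw).
have [a4 E4] : exists a : R,
    (\int[nu (theta w)]_(x in fiber S (theta w)) (ln_neg (theta w) x)%:E = a%:E)%E.
  by eexists; exact/esym/(fine_ln_neg rtw).
move: E; rewrite IF IG /mean_ln /excess E1 E2 E3 E4 /=.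
case: (free_part nu w) (free_part_ge0 nu w) => [f| |]// _;
case: (mean_information w) (mean_information_ge0 w) => [g| |]// _ [e].
congr EFin; lra.
Qed.

Lemma free_part_sum n w : on_orbit regular w ->
  (\sum_(k < n) free_part nu (iter k theta w) +
     (mean_ln (iter n theta w) - mean_ln w - bsum theta excess n w)%:E =
   \sum_(k < n) mean_information (iter k theta w))%E.
Proof.
move=> ow; elim: n => [|n ih]; first by rewrite !big_ord0 /bsum big_ord0 !subrr adde0.
rewrite !big_ord_recr/= -ih -(free_part_cohomology (on_orbitS n ow)) addeACA.
by rewrite -EFinD /bsum big_ord_recr/=; congr (_ + _%:E)%E; ring.
Qed.

(** * Entropy at finite times and returns to the good set *)

Lemma word_entropy_ge0 (m : R.-spker Omega ~> seqspace) n w : (0 <= word_entropy S m n w)%E.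
Proof.
by rewrite word_entropyE; apply: integral_ge0 => x _; rewrite lee_fin information_ge0.
Qed.

Lemma word_entropy_lower n w : on_orbit regular w ->
  (\sum_(k < n) mean_information (iter k theta w) <= word_entropy S nu n w)%E.
Proof.
elim: n w => [|n ih] w ow; first by rewrite big_ord0 word_entropy_ge0.
have rw := ow 0%N; have rtw := ow 1%N; rewrite /= in rw rtw.
apply: (@le_trans _ _ (word_entropy S nu n (theta w) + mean_information w)%E); last first.
  exact: (word_entropy_step l0 mphi mh h0 n (regular_nu_supported rw)
    (regular_nu_supported rtw) (regular_nu_invariant ow) (reg_conf rw)
    (reg_eigen rw) (reg_dens rw) (reg_dens rtw)).
rewrite big_ord_recl addeC; apply: leeD2r.
rewrite (eq_bigr (fun k : 'I_n => mean_information (iter k theta (theta w)))); last first.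
  by move=> k _; rewrite -iterSr.
by apply: ih; exact: (on_orbitS 1 ow).
Qed.

(** Using [M.+1] keeps the Gibbs constant positive. The bound on [mean_ln] controls the coboundary
    at the return times. *)
Definition good (M : nat) : set Omega := [set w |
  [/\ quasi_independent S mu M.+1%:R w,
      (past_series S r kappa w <= M.+1%:R%:E)%E & `|mean_ln w| <= M.+1%:R]].

Lemma measurable_cylinder_prob a n :
  measurable_fun setT (fun w => cylinder_prob S mu (iter n thetaV w) a).
Proof.
have m1 := @measurable_cylinder_kernel _ _ _ _ _ HS mu a.
have m2 : measurable_fun setT (fun w => cylinder_prob S mu w a).
  exact: measurableT_comp m1.
exact: (measurableT_comp m2 (measurable_iter mthetaV n)).
Qed.

(** Quasi-independence is a countable intersection, over pairs of a word and a letter, of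
    inequalities between measurable functions of [w]. *)
Lemma measurable_good M : measurable (good M).
Proof.
have -> : good M = [set w | quasi_independent S mu M.+1%:R w] `&`
   ([set w | (past_series S r kappa w <= M.+1%:R%:E)%E] `&` [set w | `|mean_ln w| <= M.+1%:R]).
  by apply/seteqP; split => w; [move=> [? ? ?]|move=> [? [? ?]]]; split.
apply: measurableI; last apply: measurableI.
- pose A (p : seq nat * nat) := [set w | (0 < size p.1)%N ->
    cylinder_prob S mu (iter (size p.1) thetaV w) (rcons p.1 p.2) <=
    M.+1%:R * cylinder_prob S mu (iter (size p.1) thetaV w) p.1 *
    cylinder_prob S mu w [:: p.2]].
  have -> : [set w | quasi_independent S mu M.+1%:R w] = ~` (\bigcup_p ~` A p).
    rewrite setC_bigcup; under eq_bigcapr do rewrite setCK.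
    apply/seteqP; split => w; first by move=> qw [a c] _ /=; exact: qw.
    by move=> h1 a c; exact: (h1 (a, c) Logic.I).
  apply: measurableC; apply: countable_bigcupT_measurable; first exact: countableP.
  move=> [a c]; apply: measurableC; rewrite /A/=.
  case: (posnP (size a)) => [->|a0].
    rewrite (_ : [set w | _] = setT); first exact: measurableT.
    by apply/seteqP; split.
  rewrite (_ : [set w | _] = setT `&` [set w |
    cylinder_prob S mu (iter (size a) thetaV w) (rcons a c) <=
    M.+1%:R * cylinder_prob S mu (iter (size a) thetaV w) a *
    cylinder_prob S mu w [:: c]]); last first.
    by rewrite setTI; apply/seteqP; split => w /=; [exact|move=> ? _].
  apply: measurable_fun_le => //; first exact: measurable_cylinder_prob.
  apply: measurable_funM; last exact: (measurable_cylinder_prob [:: c] 0).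
  by apply: measurable_funM => //; exact: measurable_cylinder_prob.
- rewrite -[X in measurable X]setTI.
  by apply: measurable_lee => //; exact: measurable_past_series.
- rewrite -[X in measurable X]setTI.
  apply: measurable_fun_le => //; apply: measurableT_comp => //.
  exact: measurable_mean_ln.
Qed.

Lemma exists_good w : (forall n k, regular (iter k theta (iter n thetaV w))) ->
  Obi w -> exists M, good M w.
Proof.
move=> rw Ow; have r0w := rw 0%N 0%N; have rVw := rw 1%N 0%N; rewrite /= in r0w rVw.
have [V HV] : exists V : R, (Defs.variation S phi 1 (thetaV w) <= V%:E)%E.
  by apply: (reg_var1 rVw); rewrite thetaVK.
have pos j : alphabet S w j -> 0 < cylinder_prob S mu w [:: j].
  move=> aj; have [x [wx xj]] : cylinder S w [:: j] !=set0.
    apply: cylinder1_nonempty => // k i; exact: (reg_row (rw 0%N k)).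
  have := cylinder_prob_gt0 1 (reg_mu r0w) wx.
  by rewrite /initial_word /mkseq/= (xj 0%N isT).
have [M1 H1] := quasi_independentP r01 kappa0 thetaK thetaVK l0 mphi
  (bip_finite Hbip) (fun n k => reg_conf (rw n k)) (fun n k => reg_holder (rw n k))
  (reg_past rVw) HV (bip_images Hbip Ow) pos.
have [M2 H2] : exists M2 : nat, (past_series S r kappa w <= M2%:R%:E)%E.
  case: (past_series _ _ _ _) (reg_past r0w) => [z _| |]//.
    by have [k zk] := exists_natr_gt z; exists k; rewrite lee_fin ltW.
  by exists 0%N; exact: leNye.
have [M3 H3] := exists_natr_gt `|mean_ln w|.
pose M := maxn M1 (maxn M2 M3); exists M; split.
- move=> a c a0; apply: le_trans (H1 a c a0) _.
  rewrite -!mulrA; apply: ler_wpM2r; first by rewrite mulr_ge0 ?cylinder_prob_ge0.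
  by rewrite ler_nat ltnW// ltnS leq_maxl.
- apply: (le_trans H2); rewrite lee_fin ler_nat ltnW// ltnS.
  by rewrite /M leq_max leq_maxl orbT.
- rewrite (le_trans (ltW H3))// ler_nat ltnW// ltnS.
  by rewrite /M !leq_max leqnn !orbT.
Qed.

(** Otherwise the countable union of the sets [good M] would be null, although it contains almost
    every point of [Obi]. *)
Lemma good_positive : exists M, 0 < fine (P (good M)).
Proof.
suff [M gM] : exists M, (0 < P (good M))%E.
  exists M; rewrite fine_gt0// gM.
  by rewrite (le_lt_trans (probability_le1 P (measurable_good M)) (ltry 1)).
apply: contrapT => nM; have := bip_bi_positive Hbip; rewrite ltNge => /negP; apply.
suff nO : P.-negligible Obi.
  by rewrite (measure_negligible (bip_bi_measurable Hbip) nO).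
have ng M : P.-negligible (good M).
  apply/negligibleP; first exact: measurable_good.
  by apply/eqP; rewrite eq_le measure_ge0 andbT leNgt; apply/negP => h1; apply: nM; exists M.
have := negligibleU (ae_orbit ae_regular) (negligible_bigcup ng).
apply: negligibleS => w Ow.
have [rw|nrw] := pselect (forall n k, regular (iter k theta (iter n thetaV w))); last by left.
by right; have [M gM] := exists_good rw Ow; exists M.
Qed.


(** The integral is the real number [pG], and an extended integral is finite only when its positive
    and negative parts both are. *)
Lemma integrable_ln_lambda : P.-integrable setT (EFin \o (fun w => ln (lambda w))).
Proof.
apply/integrableP; split; first exact/measurable_EFinP.
by rewrite integral_fin_num_abs// (rpf_lambda_pressure Hrpf).
Qed.

Lemma integrable_excess : P.-integrable setT (EFin \o excess).
Proof.
have := integrableB measurableT integrable_phi_bound integrable_ln_lambda.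
exact.
Qed.

Definition mean_excess : R := fine (\int[P]_w (excess w)%:E)%E.

Lemma integral_phi_bound : (\int[P]_w (phi_bound w)%:E = (pG + mean_excess)%:E)%E.
Proof.
have E : (\int[P]_w (excess w)%:E = \int[P]_w (phi_bound w)%:E - pG%:E)%E.
  rewrite -(rpf_lambda_pressure Hrpf).
  exact: (integralB_EFin measurableT integrable_phi_bound integrable_ln_lambda).
rewrite /mean_excess E.
have : (\int[P]_w (phi_bound w)%:E)%E \is a fin_num.
  exact: (integrable_fin_num measurableT integrable_phi_bound).
by case: (\int[P]_w (phi_bound w)%:E)%E => [z| |]//= _; congr EFin; ring.
Qed.

Lemma good_frequency M : {ae P, forall w,
  (n%:R^-1 * (good_count (fun k => good M (iter k theta w)) n)%:R : R)
    @[n --> \oo] --> fine (P (good M))}.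
Proof.
have mG := measurable_good M.
have iG : P.-integrable setT (EFin \o (\1_(good M) : Omega -> R)).
  apply/integrableP; split; first exact/measurable_EFinP/measurable_indic.
  under eq_integral do rewrite gee0_abs ?lee_fin//.
  rewrite integral_indic// setIT; exact: le_lt_trans (probability_le1 P mG) (ltry 1).
have := birkhoff mtheta thetaP (ergodic_trivial erg) iG.
rewrite integral_indic// setIT; apply: filterS => w.
apply: cvg_trans; apply: near_eq_cvg; apply: nearW => n.
by rewrite /bsum /good_count natr_sum.
Qed.

(** The logarithm of the constant in the Gibbs bound at times of return to [good M]. *)
Definition entropy_gap (M : nat) : R := ln (expR M.+1%:R * M.+1%:R).

Lemma word_entropy_le (m : R.-spker Omega ~> seqspace) M n w : (0 < n)%N ->
  on_orbit regular w -> on_orbit (supported S m) w -> on_orbit (invariant_at S m) w ->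
  good M (iter n theta w) ->
  (word_entropy S m n w <= \sum_(k < n) free_part m (iter k theta w) +
     (entropy_gap M - bsum theta excess n w)%:E)%E.
Proof.
move=> n0 rw sw iw [qw pw _].
have C0 : 0 < expR M.+1%:R * M.+1%:R :> R by rewrite mulr_gt0 ?expR_gt0.
have := word_entropy_upper (phi := phi) (lambda := lambda) (s := phi_bound) (mu := mu)
  (n := n) mphi C0 sw iw (fun k => @reg_phi _ (rw k)).
rewrite -/(excess) => h1.
rewrite -leeBlDr// -EFinN opprB; apply: h1 => x wx.
exact: (gibbs_upper r01 kappa0 thetaK l0 mphi n0 (fun k => reg_conf (rw k))
  (fun k => reg_holder (rw k)) (reg_mu (rw n)) qw pw wx).
Qed.

Let birk_oppr : {ae P, forall w,
  n%:R^-1 * - bsum theta excess n w @[n --> \oo] --> - mean_excess}.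
Proof.
have := birkhoff mtheta thetaP (ergodic_trivial erg) integrable_excess.
by apply: filterS => w cb; under eq_fun do rewrite mulrN; exact: cvgN cb.
Qed.

Let birk := birkhoff mtheta thetaP (ergodic_trivial erg) integrable_excess.

Let ebirk_free m : {ae P, forall w,
  ((n%:R : R)^-1%:E * \sum_(k < n) free_part m (iter k theta w))%E
    @[n --> \oo] --> (\int[P]_w free_part m w)%E}.
Proof.
exact: (ebirkhoff mtheta thetaP (ergodic_trivial erg) (measurable_free_part m)
  (free_part_ge0 m)).
Qed.

Let ebirk_info := ebirkhoff mtheta thetaP (ergodic_trivial erg)
  measurable_mean_information mean_information_ge0.

(** At returns to [good M] the coboundary [mean_ln (iter n theta w) - mean_ln w] is bounded, hence
    disappears after division by [n]. Both Birkhoff averages converge, possibly to infinity, so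
    comparing them along these times compares their limits. *)
Lemma integral_free_part_nu : (\int[P]_w free_part nu w =
  \int[P]_w mean_information w + mean_excess%:E)%E.
Proof.
have [M p0] := good_positive.
have A := aeI (good_frequency M) (aeI birk (aeI (ebirk_free nu)
  (aeI ebirk_info ae_on_orbit_regular))).
apply: (ae_cst (P := P)); apply: filterS A => w [cg [cb [cf [ci rw]]]].
have freq := density_frequently p0 cg.
apply/eqP; rewrite eq_le; apply/andP; split.
  apply: (frequently_mean_le (K := M.+1%:R + `|mean_ln w|) freq cf ci cb) => n [_ _ gn].
  rewrite -(free_part_sum n rw) -addeA -EFinD.
  rewrite -[leLHS]adde0; apply: leeD2l; rewrite lee_fin.
  have := ler_norm (mean_ln w); move: gn; rewrite ler_norml => /andP[]; lra.
have cb' : n%:R^-1 * - bsum theta excess n w @[n --> \oo] --> - mean_excess.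
  by under eq_fun do rewrite mulrN; exact: cvgN cb.
rewrite -leeBrDr// -EFinN.
apply: (frequently_mean_le (K := M.+1%:R + `|mean_ln w|) freq ci cf cb') => n [_ _ gn].
rewrite -(free_part_sum n rw); apply: leeD2l; rewrite lee_fin.
have := ler_norm (- mean_ln w); rewrite normrN.
by move: gn; rewrite ler_norml => /andP[]; lra.
Qed.

Lemma mean_information_integral_ge0 : (0 <= \int[P]_w mean_information w)%E.
Proof. by apply: integral_ge0 => w _; exact: mean_information_ge0. Qed.

(** The lower and upper bounds have the same linear growth rate by [integral_free_part_nu]; if this
    rate is infinite, the lower bound alone decides. *)
Lemma nu_fiber_entropy : is_fiber_entropy P S nu (\int[P]_w mean_information w)%E.
Proof.
have [M p0] := good_positive.
have A := aeI (good_frequency M) (aeI birk_oppr (aeI (ebirk_free nu)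
  (aeI ebirk_info (aeI ae_on_orbit_regular (random_invariant_orbit nu_invariant))))).
apply: filterS A => w [cg [cb [cf [ci [rw [sw iw]]]]]].
apply: (cvg_average_nd p0 cg (up := fun n =>
  (\sum_(k < n) free_part nu (iter k theta w) +
     (entropy_gap M - bsum theta excess n w)%:E)%E) _ _ _ _ ci).
- by move=> n; exact: word_entropy_ge0.
- by apply: homo_leq => [n|? ? ? |n]; [exact: lexx|exact: le_trans|exact: word_entropy_nd (sw 0%N)].
- by move=> n; exact: word_entropy_lower.
- by move=> n n0 gn; exact: word_entropy_le.
- move=> _; have := cvg_mean_add (entropy_gap M) cf cb.
  by rewrite integral_free_part_nu EFinN addeK.
- exact: mean_information_integral_ge0.
Qed.

(** The limit [e] is given, so it can be computed along the good times alone. *)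
Lemma fiber_entropy_le m e : random_invariant P S m -> is_fiber_entropy P S m e ->
  (e + mean_excess%:E <= \int[P]_w free_part m w)%E.
Proof.
move=> im em; have [M p0] := good_positive.
have A := aeI (good_frequency M) (aeI birk_oppr (aeI (ebirk_free m)
  (aeI em (aeI ae_on_orbit_regular (random_invariant_orbit im))))).
apply: (ae_cst (P := P)); apply: filterS A => w [cg [cb [cf [ce [rw [sw iw]]]]]].
rewrite -leeBrDr// -EFinN.
apply: (frequently_mean_le (A := [set n | (0 < n)%N /\ good M (iter n theta w)])
  (K := entropy_gap M) _ ce cf cb).
  (* A return after [n0.+1] is requested to make the time positive, as the bound on the word entropy
     requires. *)
  move=> n0; have [n [nn gn]] := density_frequently p0 cg n0.+1.
  by exists n; split; [exact: ltnW|split => //; exact: leq_trans nn].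
by move=> n [n0 gn]; exact: word_entropy_le.
Qed.

(** * The variational inequality and the equality for [nu] *)

Lemma measurable_fiber_phi (m : R.-spker Omega ~> seqspace) :
  measurable_fun setT (fun w => \int[m w]_(x in fiber S w) (phi w x)%:E)%E.
Proof.
rewrite (_ : (fun w => _) = fun w =>
    (\int[m w]_(x in fiber S w) (Num.max 0 (phi w x))%:E -
     \int[m w]_(x in fiber S w) (Num.max 0 (- phi w x))%:E)%E); last first.
  apply/funext => w; rewrite integralE; congr (_ - _)%E; apply: eq_integral => x _.
    by rewrite funeposE EFin_max maxC.
  by rewrite funenegE EFin_max maxC.
apply: emeasurable_funB; apply: (measurable_fiber_integral HS).
- exact: measurable_maxr.
- by move=> w x; rewrite le_max lexx.
- by apply: measurable_maxr => //; exact: measurableT_comp.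
- by move=> w x; rewrite le_max lexx.
Qed.

(** On almost every fiber [phi] is [phi_bound] minus the defect, and [phi_bound w] is constant on a
    fiber of mass 1. The integral of the defect may be infinite, which [integralBr_ge0] permits. *)
Lemma fiber_integralE m : random_invariant P S m ->
  fiber_integral P S phi m =
  ((pG + mean_excess)%:E - \int[P]_w free_part m w)%E.
Proof.
move=> im; rewrite -integral_phi_bound -integralBr_ge0//; last 3 first.
- exact: integrable_phi_bound.
- exact: measurable_free_part.
- by move=> w _; exact: free_part_ge0.
apply: ae_eq_integral => //.
- exact: measurable_fiber_phi.
- apply: emeasurable_funB; first exact/measurable_EFinP.
  exact: measurable_free_part.
have A := aeI ae_regular im.1; apply: filterS A => w [rw [m1 ms]] _.
have mF := measurable_fiber S w.
have mF1 := msupport_fiber1 m1 ms.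
rewrite /free_part -[X in (X - _)%E](integral_cst_unit_mass _ mF mF1).
rewrite -integralBr_ge0//; last 3 first.
- apply/integrableP; split; first exact: measurable_cst.
  by rewrite (integral_cst_unit_mass _ mF mF1)/= ltry.
- by apply/measurable_EFinP; exact: (measurable_on_fiber HS measurable_defect_total).
- by move=> x _; rewrite lee_fin defect_ge0.
apply: eq_integral => x /[!inE] wx; rewrite /defect -EFinB; congr EFin.
rewrite (max_idPr _) ?subr_ge0; [by rewrite subKr|exact: (reg_phi rw)].
Qed.

(** In the sum of the entropy bound and the formula for the fiber integral, [mean_excess] and the
    defect cancel. An infinite defect makes the fiber integral [-oo], and entropy [+oo] is then
    excluded because the sum is required to be defined. *)
Lemma free_energy_le v : free_energies P S phi v -> (v <= pG%:E)%E.
Proof.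
move=> [m [e [im em ef ->]]].
have := fiber_entropy_le im em; move: ef; rewrite (fiber_integralE im).
case: (\int[P]_w free_part m w)%E => [f| |] /=; case: e em => [e| |]//= em _.
- by rewrite !lee_fin; lra.
- by move=> _; exact: leNye.
- by move=> _; exact: leNye.
- by move=> _; exact: leNye.
Qed.

(** If the integral of the information is infinite, so is that of the defect, and the fiber integral
    of [phi] is [-oo]; the condition [+?] excludes exactly this indeterminate sum. *)
Lemma nu_equilibrium :
  exists e : \bar R,
    [/\ random_invariant P S nu,
        is_fiber_entropy P S nu e &
        (e +? fiber_integral P S phi nu)%E ->
          pG%:E = (e + fiber_integral P S phi nu)%E /\
          equilibrium_state P S phi nu].
Proof.
exists (\int[P]_w mean_information w)%E; split.
- exact: nu_invariant.
- exact: nu_fiber_entropy.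
move=> ef; have pE : (pG%:E = \int[P]_w mean_information w + fiber_integral P S phi nu)%E.
  move: ef; rewrite (fiber_integralE nu_invariant) integral_free_part_nu.
  have := mean_information_integral_ge0.
  case: (\int[P]_w mean_information w)%E => [f| |]//= _ _.
  by congr EFin; ring.
split => //; split; first exact: nu_invariant.
exists (\int[P]_w mean_information w)%E; split => //; first exact: nu_fiber_entropy.
rewrite -pE; apply/eqP; rewrite eq_le; apply/andP; split.
  apply: ereal_sup_ubound; exists nu, (\int[P]_w mean_information w)%E.
  by split => //; [exact: nu_invariant|exact: nu_fiber_entropy].
by apply: ge_ereal_sup => v; exact: free_energy_le.
Qed.

End equilibrium.

Theorem mainTheorem11 (R : realType) (d : measure_display)
    (Omega : measurableType d) (P : probability Omega R) (S : rcmc Omega)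
    (N : nat -> nat -> Omega -> nat) (Obi Obp : set Omega) (I : set nat)
    (r : R) (kappa : Omega -> R) (phi : Omega -> seqspace -> R)
    (i : nat) (xi : Omega -> seqspace) (N0 : nat) (pG : R)
    (lambda : Omega -> R) (h : Omega -> seqspace -> R)
    (mu nu : R.-spker Omega ~> seqspace) :
  is_rcmc P S ->
  is_bip P S N Obi Obp I ->
  measurable_on_total S phi ->
  0 < r < 1 ->
  condition_H P S Obi Obp r kappa phi ->
  condition_S P S phi ->
  is_gurevic_pressure P S N phi i xi N0 pG ->
  is_rpf P S phi r kappa pG lambda h mu nu ->
  exists e : \bar R,
    [/\ random_invariant P S nu,
        is_fiber_entropy P S nu e &
        (e +? fiber_integral P S phi nu)%E ->
          pG%:E = (e + fiber_integral P S phi nu)%E /\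
          equilibrium_state P S phi nu].
Proof.
move=> HS Hbip Hphi r01 HH Hsum _ Hrpf.
exact: (nu_equilibrium HS Hbip Hphi r01 HH Hsum Hrpf).
Qed.
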